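(* Let $d\in\{2,3\}$, let $\Omega\subset\mathbb{R}^d$ be a bounded domain with sufficiently smooth boundary, and let $T>0$. Let $\lambda,\gamma,\tau,h,k>0$ be constants, $f(s)=\frac{(s-1)^2s^2}{4h^2}$, and let $\eta,\kappa\in C^1(\mathbb{R})$, $\nu\in C^3(\mathbb{R})$ be such that for some $\alpha,\beta>0$, $\alpha\le\eta(s),\nu(s),\kappa(s)\le\beta$ for all $s\in\mathbb{R}$. Let $(u,p,F,\phi,\mu)$ be a smooth (up to the boundary) solution on $\Omega\times(0,T)$ of $$\begin{cases}\partial_tu+u\cdot\nabla u+\nabla p-\nabla\cdot(\eta(\phi)\nabla u)=-\lambda\nabla\cdot(\nabla\phi\otimes\nabla\phi)+\nabla\cdot\big(\nu(\phi)(FF^T-I)\big)-\dfrac{\eta(\phi)(1-\phi)u}{\kappa(\phi)},\\ \nabla\cdot u=0,\\ \partial_tF-k\big(\nu(\phi)\Delta F+2\nabla\nu(\phi)\cdot\nabla F\big)+u\cdot\nabla F=\nabla u\,F,\\ \partial_t\phi+u\cdot\nabla\phi=\tau\Delta\mu,\\ \mu=-\lambda\Delta\phi+\lambda\gamma f'(\phi)+\dfrac{\nu'(\phi)}{2}\operatorname{tr}(FF^T-I),\end{cases}$$ with $u=0$ and $\partial_n\mu=\partial_n\phi=\partial_nF^{i,j}=0$ ($1\le i,j\le d$) on $\partial\Omega\times(0,T)$. Then for all $t\in(0,T)$, $$\frac12\frac{d}{dt}\int_\Omega\Big(|u|^2+\lambda|\nabla\phi|^2+2\lambda\gamma f(\phi)+\nu(\phi)\operatorname{tr}(FF^T-I)\Big)dx$$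 $$=-\int_\Omega\big(\eta(\phi)|\nabla u|^2+\tau|\nabla\mu|^2\big)dx-k\int_\Omega\nu(\phi)^2\sum_{i,j}|\nabla F^{i,j}|^2dx-\int_\Omega\frac{\eta(\phi)}{\kappa(\phi)}(1-\phi)|u|^2dx.$$
   Context: The unknowns are the velocity $u$ ($\mathbb{R}^d$-valued), the deformation variable $F=(F^{ij})$ ($d\times d$-matrix-valued), the scalar phase field $\phi$, the scalar pressure $p$ and the chemical potential $\mu$. $n$ is the outward unit normal on $\partial\Omega$ and $\partial_n$ the normal derivative. Conventions: $[\nabla u]_{ij}=\partial_ju^i$; the $F$-equation reads componentwise $\partial_tF^{ij}-k(\nu(\phi)\Delta F^{ij}+2\nabla(\nu(\phi))\cdot\nabla F^{ij})+\sum_{l}u^l\partial_lF^{ij}=\sum_{l}\partial_lu^iF^{lj}$; $\nabla\cdot(\eta(\phi)\nabla u)$ has $i$-th component $\nabla\cdot(\eta(\phi)\nabla u^i)$; the divergences of the symmetric matrices $\nabla\phi\otimes\nabla\phi$ and $\nu(\phi)(FF^T-I)$ are taken row-wise. In the integrals, $|u|$, $|\nabla\phi|$, $|\nabla u|$, $|\nabla\mu|$, $|\nabla F^{i,j}|$ denote pointwise Euclidean (Frobenius) norms. *)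

(* Defs.v *)
From HB Require Import structures.
From mathcomp Require Import all_boot all_order all_algebra.
From mathcomp Require Import all_classical all_reals all_analysis.

Set Implicit Arguments.
Unset Strict Implicit.
Unset Printing Implicit Defensive.
Import Order.TTheory GRing.Theory Num.Theory numFieldNormedType.Exports.
Local Open Scope classical_set_scope.
Local Open Scope ring_scope.

Section cons_measure.
Context {R : realType} (n : nat).
Local Notation mR := (measurableTypeR R).
Variable m : {sigma_finite_measure set (n.-tuple mR) -> \bar R}.

Definition cons_pair (p : mR * n.-tuple mR) : n.+1.-tuple mR :=
  [tuple of p.1 :: p.2].

(* The product of the one-dimensional Lebesgue measure with [m], carried from
   [R * R^n] to [R^n.+1]. *)
Definition cons_measure : set (n.+1.-tuple mR) -> \bar R :=
  pushforward (lebesgue_measure \x m)%E cons_pair.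

Let measurable_cons_pair : measurable_fun setT cons_pair.
Proof. exact: measurable_cons. Qed.

Let pushm : {measure set (n.+1.-tuple mR) -> \bar R} :=
  measure_function_pushforward__canonical__measure_function_Measure
    (lebesgue_measure \x m)%E measurable_cons_pair.

HB.instance Definition _ := isMeasure.Build _ _ _ cons_measure
  (measure0 pushm) (measure_ge0 pushm) (@measure_semi_sigma_additive _ _ _ pushm).

Let cons_measure_sigma_finite : sigma_finite setT cons_measure.
Proof.
have /sigma_finiteP[F [FT ndF Foo]] := sigma_finiteT (@lebesgue_measure R).
have /sigma_finiteP[G [GT ndG Goo]] := sigma_finiteT m.
pose uncons (x : n.+1.-tuple mR) : mR * n.-tuple mR :=
  (thead x, [tuple of behead x]).
have muncons : measurable_fun setT uncons.
  apply/measurable_fun_pairP; split; last exact: measurable_behead.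
  exact: (@measurable_tnth _ mR n.+1 ord0).
have unconsK p : uncons (cons_pair p) = p.
  by case: p => x y; congr pair; exact/val_inj.
exists (fun k => uncons @^-1` (F k `*` G k)).
  apply/esym; rewrite -subTset => x _.
  have : setT (uncons x).1 by []. rewrite FT => -[i _ Fi].
  have : setT (uncons x).2 by []. rewrite GT => -[j _ Gj].
  exists (maxn i j) => //; split.
  - by move: Fi; exact/subsetPset/ndF/leq_maxl.
  - by move: Gj; exact/subsetPset/ndG/leq_maxr.
move=> k; have [mF Fk] := Foo k; have [mG Gk] := Goo k; split.
  by rewrite -[X in measurable X]setTI; apply: muncons => //; exact: measurableX.
rewrite /cons_measure /pushforward (_ : cons_pair @^-1` _ = F k `*` G k).
  by rewrite product_measure1E// lte_mul_pinfty// ge0_fin_numE.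
by rewrite -comp_preimage (_ : uncons \o _ = id)//; exact/funext.
Qed.

HB.instance Definition _ := Measure_isSigmaFinite.Build _ _ _ cons_measure
  cons_measure_sigma_finite.

End cons_measure.

(* Lebesgue measure on [R^n]. The Borel sigma-algebra of [R^n] is the product
   one, which the library provides on [n.-tuple R] and not on ['rV[R]_n]. *)
Fixpoint lebesgue_tuple (R : realType) (n : nat) :
    {sigma_finite_measure set (n.-tuple (measurableTypeR R)) -> \bar R} :=
  match n with
  | 0 => \d_ [tuple]
  | m.+1 => cons_measure (lebesgue_tuple R m)
  end.

Definition row_of_tuple (R : realType) n (x : n.-tuple (measurableTypeR R)) :
  'rV[R]_n := \row_i tnth x i.

Definition space_integral (R : realType) d (Om : set 'rV[R]_d)
    (g : 'rV[R]_d -> R) : R :=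
  \int[lebesgue_tuple R d]_(x in @row_of_tuple R d @^-1` Om)
    g (row_of_tuple x).

Notation "'\int_' ( x 'in' Om ) g" := (space_integral Om (fun x => g))
  (at level 36, x name, g at level 36, Om at level 50,
   format "'\int_' ( x  'in'  Om )  g") : ring_scope.

Section calculus.
Context {R : realType} {d : nat}.
Local Notation V := 'rV[R]_d.

(* The norm of the normed space ['rV[R]_d] is the sup norm; it is used only
   for the topology. Pointwise norms are Euclidean and go through [dotv]. *)
Definition dotv (v w : V) : R := \sum_i v 0 i * w 0 i.

Definition partial (i : 'I_d) (g : V -> R) (x : V) : R :=
  'D_(delta_mx 0 i) g x.

Definition grad (g : V -> R) (x : V) : V := \row_i partial i g x.

Definition divergence (X : V -> V) (x : V) : R :=
  \sum_i partial i (fun y => X y 0 i) x.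

Definition laplacian (g : V -> R) (x : V) : R :=
  \sum_i partial i (partial i g) x.

(* Fields depending on time are functions [R -> V -> _], time first. *)
Definition dt (f : R -> V -> R) (t : R) (x : V) : R := derive1 (f ^~ x) t.

Definition component (u : R -> V -> V) (i : 'I_d) : R -> V -> R :=
  fun t x => u t x 0 i.

Definition entry (F : R -> V -> 'M[R]_d) (i j : 'I_d) : R -> V -> R :=
  fun t x => F t x i j.

Fixpoint Ck_on (k : nat) (U : set V) (g : V -> R) : Prop :=
  {within U, continuous g} /\
  match k with
  | 0 => True
  | k'.+1 => forall i,
      (forall x, U x -> derivable g x (delta_mx 0 i)) /\
      Ck_on k' U (partial i g)
  end.

Definition extends_continuously (Om : set V) (T : R) (f : R -> V -> R) : Prop :=
  exists G : R * V -> R,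
    {within `]0, T[%classic `*` closure Om, continuous G} /\
    forall t x, 0 < t < T -> Om x -> G (t, x) = f t x.

(* [f] has all partial derivatives in space and time up to order [k] on
   [(0, T) * Om], and they (and [f]) extend continuously to
   [(0, T) * closure Om]. *)
Fixpoint Ck_up_to_boundary (k : nat) (Om : set V) (T : R) (f : R -> V -> R) :
    Prop :=
  extends_continuously Om T f /\
  match k with
  | 0 => True
  | k'.+1 =>
      (forall i,
        (forall t x, 0 < t < T -> Om x -> derivable (f t) x (delta_mx 0 i)) /\
        Ck_up_to_boundary k' Om T (fun t => partial i (f t))) /\
      (forall t x, 0 < t < T -> Om x -> derivable (f ^~ x) t 1) /\
      Ck_up_to_boundary k' Om T (dt f)
  end.

Definition bounded_domain (Om : set V) : Prop :=
  [/\ open Om, connected Om, Om !=set0 & bounded_set Om].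

Definition bdry (Om : set V) : set V := closure Om `\` Om°.

(* Near [x0], [Om] is the sublevel set [rho < 0] of a [C^k] function without
   critical point; [grad rho] then points out of [Om]. *)
Definition local_defining_function (k : nat) (Om : set V) (x0 : V)
    (U : set V) (rho : V -> R) : Prop :=
  [/\ open U, U x0, Ck_on k U rho, forall x, U x -> grad rho x != 0 &
      forall x, U x -> (Om x <-> rho x < 0)].

Definition Ck_boundary (k : nat) (Om : set V) : Prop :=
  forall x0, bdry Om x0 ->
    exists U rho, local_defining_function k Om x0 U rho.

Definition outward_unit_normal (Om : set V) (n : V -> V) : Prop :=
  forall x, bdry Om x ->
    exists U rho, local_defining_function 1 Om x U rho /\
      n x = (Num.sqrt (dotv (grad rho x) (grad rho x)))^-1 *: grad rho x.

(* Fields are only assumed regular inside [Om], with derivatives extending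
   continuously to the closure; their boundary values are those of the
   extensions, i.e. limits from inside. The total function [g] may take
   unrelated values on [bdry Om]. *)
Definition has_trace (Om : set V) (g : V -> R) (x : V) (l : R) : Prop :=
  g y @[y --> within Om (nbhs x)] --> l.

Definition has_normal_derivative (Om : set V) (n : V -> V) (g : V -> R)
    (x : V) (l : R) : Prop :=
  has_trace Om (fun y => dotv (n x) (grad g y)) x l.

End calculus.

Definition Ck_real (R : realType) (k : nat) (g : R -> R) : Prop :=
  (forall j, (j < k)%N -> forall s, derivable (derive1n j g) s 1) /\
  continuous (derive1n k g).

Definition double_well (R : realType) (h s : R) : R :=
  (s - 1) ^+ 2 * s ^+ 2 / (4 * h ^+ 2).

(* Main.v *)
Require Import Defs.
From mathcomp Require Import all_boot all_order all_algebra.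
From mathcomp Require Import all_classical all_reals all_analysis.
From mathcomp Require Import measurable_realfun.
From mathcomp Require Import ring lra.
Import Order.TTheory GRing.Theory Num.Theory numFieldNormedType.Exports.
Local Open Scope classical_set_scope.
Local Open Scope ring_scope.
Set Implicit Arguments.
Unset Strict Implicit.
Unset Printing Implicit Defensive.

(** Testing the equations against [u], [mu], [lam * dt phi] and
    [k * nu^2 * F^ij] shows that, pointwise, half the time derivative of the
    energy density plus the dissipation is the divergence of fields that are
    tangential on the boundary: they contain [u] or a normal derivative as a
    factor. The only form of the divergence theorem needed is therefore that
    the integral of [div X] vanishes when [X] is [C^1] up to the boundary with
    zero normal component, and no surface measure enters. A covering by
    cutoffs reduces this to [X] supported near one boundary point, where [Om]
    is [rho < 0]. The field [step (- rho / eps) * X] has compact support in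
    [Om], so the integral of its divergence vanishes by the fundamental
    theorem of calculus on lines. The error lives in the layer
    [- 2 eps < rho < 0], of measure [O(eps)], and there it is at most
    [C + (2 / eps) * |grad rho . X|] with [grad rho . X] uniformly small. *)

(** * Integration over R^n by slices *)

(** The weight [nu ^+ 2] in the dissipation comes from the factor 2 in the [F]-equation:
    [nu * (nu * Lap F + 2 * grad nu . grad F)] is the divergence of [nu ^+ 2 * grad F]. The
    convective terms and the pressure assemble into [u . grad Q], where [Q] is minus half the energy
    density minus [p], so the vanishing of [u] on the boundary together with [div u = 0] disposes of
    all of them at once. Two obstacles shape the divergence theorem. Fields are controlled only
    inside [Om], so boundary values are always read off continuous extensions. And the normal at
    each boundary point comes from a defining function chosen for that very point, whereas the layer
    argument fixes one [rho] near [x0]; the gradients of two defining functions must therefore be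
    shown proportional, with only continuous partial derivatives at hand. Slices along one
    coordinate axis serve twice: a slice bound 0 kills derivatives of compactly supported functions,
    and a slice bound of order [eps] measures the layer without a change of variables. *)

Lemma bounded_supported_integrable {R : realType} {dd : measure_display}
  {T : measurableType dd} (m : {measure set T -> \bar R}) (B : set T) (v C : R) (g : T -> R) :
  measurable B -> (m B <= v%:E)%E -> measurable_fun setT g ->
  (forall x, `|g x| <= C) -> (forall x, ~ B x -> g x = 0) ->
  m.-integrable setT (EFin \o g).
Proof.
move=> mB mBv mg gC g0.
have Bfin : (m B < +oo)%E by rewrite (le_lt_trans mBv)// ltry.
have gB : g = g \_ B.
  by apply/funext => x; rewrite patchE; case: ifPn => // /negP; rewrite in_setE => /g0.
rewrite gB -restrict_EFin; apply/(integrable_mkcond (EFin \o g) mB).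
apply: measurable_bounded_integrable => //; first exact: measurable_funTS.
by exists C; split; [exact: num_real|move=> y Cy x _; exact: (le_trans (gC x) (ltW Cy))].
Qed.

Lemma norm_Rintegral_le_supported {R : realType} {dd : measure_display}
  {T : measurableType dd} (m : {measure set T -> \bar R}) (B : set T) (v C : R) (g : T -> R) :
  0 <= C -> measurable B -> (m B <= v%:E)%E -> measurable_fun setT g ->
  (forall x, `|g x| <= C) -> (forall x, ~ B x -> g x = 0) ->
  `|(\int[m]_x g x)%R| <= C * v.
Proof.
move=> C0 mB mBv mg gC g0.
have ig := bounded_supported_integrable mB mBv mg gC g0.
have Bfin : (m B < +oo)%E by rewrite (le_lt_trans mBv)// ltry.
apply: (le_trans (le_normr_Rintegral measurableT ig)).
have gB : (fun x => `|g x|) = (fun x => `|g x|) \_ B.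
  apply/funext => x; rewrite patchE; case: ifPn => // /negP; rewrite in_setE => /g0 ->.
  by rewrite normr0.
rewrite gB -Rintegral_mkcond.
apply: (@le_trans _ _ (\int[m]_(x in B) C)).
  apply: le_Rintegral => //.
  - apply: (integrableS measurableT) => //.
    by have /= := integrable_norm ig.
  - by apply: measurable_bounded_integrable => //; exists C; split => //; [exact: num_real|move=> y Cy x _ /=; rewrite ger0_norm// ltW].
rewrite Rintegral_cst//.
apply: ler_wpM2l => //.
by rewrite -lee_fin fineK// ge0_fin_numE.
Qed.

Lemma eq_le_ereal {R : realType} (x y : \bar R) : x = y -> (x <= y)%E.
Proof. by move=> ->. Qed.

Section slices.
Context {R : realType}.
Local Notation mR := (measurableTypeR R).

Definition box (n : nat) (M : R) : set (n.-tuple mR) :=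
  [set x | forall j, `|tnth x j| <= M].

Lemma measurable_box n M : measurable (@box n M).
Proof.
rewrite (_ : @box n M = \bigcap_(j in [set: 'I_n]) ((@tnth n mR ^~ j) @^-1` `[- M, M])).
  apply: fin_bigcap_measurable; first exact: finite_finset.
  move=> j _; rewrite -[X in measurable X]setTI; apply: measurable_tnth => //.
apply/seteqP; split => x /=; rewrite /box.
  by move=> h j _ /=; rewrite in_itv/= -ler_norml; exact: h.
by move=> h j; have /= := h j I; rewrite in_itv/= -ler_norml.
Qed.

Definition seg (M : R) : set mR := `[- M, M].

Lemma segP M a : seg M a <-> `|a| <= M.
Proof. by rewrite /seg/= in_itv/= -ler_norml. Qed.

Lemma measurable_seg M : measurable (seg M).
Proof. exact: measurable_itv. Qed.

Lemma lebesgue_segment_sym (M : R) : 0 <= M ->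
  lebesgue_measure (seg M) = (2 * M)%:E.
Proof.
move=> M0; rewrite /seg lebesgue_measure_itv/= lte_fin; case: ifPn => h.
  by rewrite -EFinB; congr EFin; lra.
by congr EFin; move: h; rewrite -leNgt => h; lra.
Qed.

Lemma lebesgue_seg_le (M : R) : 0 <= M -> (lebesgue_measure (seg M) <= (2 * M)%:E)%E.
Proof. by move=> M0; rewrite lebesgue_segment_sym. Qed.

Lemma lebesgue_tuple_box n M : 0 <= M ->
  (lebesgue_tuple R n (@box n M) <= ((2 * M) ^+ n)%:E)%E.
Proof.
move=> M0; elim: n => [|n IH].
  (* In dimension 0 the measure is a Dirac mass, at most [1 = (2 * M) ^+ 0]. *)
  rewrite /= diracE expr0 lee_fin; by case: (_ \in _).
have -> : lebesgue_tuple R n.+1 (@box n.+1 M) =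
    (lebesgue_measure \x lebesgue_tuple R n)%E (seg M `*` @box n M).
  transitivity ((lebesgue_measure \x lebesgue_tuple R n)%E
    (@cons_pair R n @^-1` @box n.+1 M)) => //; congr (_ _).
  apply/seteqP; split => -[a z] /=.
    move=> h; split => /=.
      by have := h ord0; rewrite segP.
    by move=> j; have := h (lift ord0 j); rewrite tnthS.
  move=> [/=]; rewrite segP => ha hz j.
  by case: (unliftP ord0 j) => [k|] ->; rewrite ?tnthS.
rewrite product_measure1E; [|exact: measurable_seg|exact: measurable_box].
rewrite exprS (EFinM (2 * M) (_ ^+ _)); apply: lee_pmul => //.
exact: lebesgue_seg_le.
Qed.

Lemma measurable_cons_pairl n (z : n.-tuple mR) :
  measurable_fun setT (fun a : mR => cons_pair (a, z)).
Proof.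
by apply: measurable_cons; [exact: measurable_id|exact: measurable_cst].
Qed.

Lemma measurable_cons_pairr n (a : mR) :
  measurable_fun setT (fun z : n.-tuple mR => cons_pair (a, z)).
Proof.
by apply: measurable_cons; [exact: measurable_cst|exact: measurable_id].
Qed.

(** Fubini, transported through the pushforward by [cons_pair]. Both orders are kept because
    [slice_bound] integrates the head coordinate either first or last, and measurability of the
    partial integrals is what lets a bound be applied to them in turn. *)
Lemma Rintegral_lebesgue_tupleS n (M C : R) (g : n.+1.-tuple mR -> R) :
  0 <= M -> 0 <= C -> measurable_fun setT g -> (forall x, `|g x| <= C) ->
  (forall x, ~ @box n.+1 M x -> g x = 0) ->
  let ga := fun a z => g (cons_pair (a, z)) in
  [/\ measurable_fun setT (fun a => \int[lebesgue_tuple R n]_z (ga a z)),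
      measurable_fun setT (fun z => \int[lebesgue_measure]_a (ga a z)),
      \int[lebesgue_tuple R n.+1]_x g x =
        \int[lebesgue_measure]_a (\int[lebesgue_tuple R n]_z (ga a z)) &
      \int[lebesgue_tuple R n.+1]_x g x =
        \int[lebesgue_tuple R n]_z (\int[lebesgue_measure]_a (ga a z))].
Proof.
move=> M0 C0 mg gC g0 ga.
have ig := bounded_supported_integrable (@measurable_box _ M)
  (lebesgue_tuple_box n.+1 M0) mg gC g0.
pose f := EFin \o (g \o @cons_pair R n).
have mcons : measurable_fun setT (@cons_pair R n) by exact: measurable_cons.
have mf : measurable_fun setT (g \o @cons_pair R n) by exact: measurableT_comp.
have itf : (lebesgue_measure \x lebesgue_tuple R n)%E.-integrable setT f.
  refine (@bounded_supported_integrable R _ _ _ (seg M `*` @box n M) ((2 * M) ^+ n.+1) C (g \o @cons_pair R n) _ _ _ _ _) => //.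
  - by apply: measurableX; [exact: measurable_seg|exact: measurable_box].
  - have PM := @product_measure1E _ _ _ _ R lebesgue_measure (lebesgue_tuple R n)
      (seg M) (@box n M) (measurable_seg M) (measurable_box M).
    apply: le_trans; first exact: (eq_le_ereal PM).
    rewrite exprS (EFinM (2 * M) (_ ^+ _)); apply: lee_pmul => //.
      exact: lebesgue_seg_le.
    exact: lebesgue_tuple_box.
  - by move=> x; exact: gC.
  - move=> [a z] h; apply: g0 => h2; apply: h; split => /=.
      by have := h2 ord0; rewrite segP.
    by move=> j; have := h2 (lift ord0 j); rewrite tnthS.
have E : (\int[lebesgue_tuple R n.+1]_x g x)%R = fine (\int[lebesgue_measure \x lebesgue_tuple R n]_p f p)%E.
  rewrite /Rintegral; congr fine.
  rewrite /= (_ : \int[_]_x _ = \int[pushforward (lebesgue_measure \x lebesgue_tuple R n)%E (@cons_pair R n)]_x (g x)%:E)%E//.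
  by rewrite integral_pushforward//; exact/measurable_EFinP.
have fin1 a : (\int[lebesgue_tuple R n]_z f (a, z))%E = (\int[lebesgue_tuple R n]_z (ga a z))%:E.
  rewrite /Rintegral fineK//; apply: integrable_fin_num => //.
  apply: (bounded_supported_integrable (@measurable_box _ M) (lebesgue_tuple_box n M0) (C := C)) => //.
    exact: (measurableT_comp mg (@measurable_cons_pairr n _)).
    by move=> z; exact: gC.
  move=> z h; apply: g0 => h2; apply: h => j.
  by have := h2 (lift ord0 j); rewrite tnthS.
have fin2 z : (\int[lebesgue_measure]_a f (a, z))%E = (\int[lebesgue_measure]_a (ga a z))%:E.
  rewrite /Rintegral fineK//; apply: integrable_fin_num => //.
  apply: (@bounded_supported_integrable _ _ _ lebesgue_measure (seg M) (2 * M) C (ga ^~ z)).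
  - exact: measurable_seg.
  - exact: lebesgue_seg_le.
  - exact: (measurableT_comp mg (measurable_cons_pairl _)).
  - by move=> a; exact: gC.
  move=> a h; apply: g0 => h2; apply: h => /=.
  by have := h2 ord0; rewrite segP.
split.
- apply/measurable_EFinP; have := measurable_fubini_F itf.
  by apply: eq_measurable_fun => a _; rewrite /fubini_F/= fin1.
- apply/measurable_EFinP; have := measurable_fubini_G itf.
  by apply: eq_measurable_fun => z _; rewrite /fubini_G/= fin2.
- rewrite E -integral12_prod_meas1//; congr fine; apply: eq_integral => a _.
  by rewrite /fubini_F fin1.
- rewrite E -integral21_prod_meas1//; congr fine; apply: eq_integral => a _.
  by rewrite /fubini_G fin2.
Qed.

Definition tset n (x : n.-tuple mR) (i : 'I_n) (s : mR) : n.-tuple mR :=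
  [tuple if j == i then s else tnth x j | j < n].

(** Integrate along the [i]-th axis first; the other [n.-1] coordinates range over a box of volume
    at most [(2 * M) ^+ n.-1]. The constant [C] only ensures integrability and does not enter the
    bound. *)
Lemma slice_bound n (i : 'I_n) (M C delta : R) (g : n.-tuple mR -> R) :
  0 <= M -> 0 <= C -> 0 <= delta -> measurable_fun setT g -> (forall x, `|g x| <= C) ->
  (forall x, ~ @box n M x -> g x = 0) ->
  (forall x, `|\int[lebesgue_measure]_s g (tset x i s)| <= delta) ->
  `|\int[lebesgue_tuple R n]_x g x| <= delta * (2 * M) ^+ n.-1.
Proof.
move=> M0 + d0; elim: n i C g => [[]//|n IH] i C g C0 mg gC g0 gd.
have [m1 m2 e1 e2] := Rintegral_lebesgue_tupleS M0 C0 mg gC g0.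
case: (unliftP ord0 i) => [k|] ik; last first.
  (* Here [i] is the head: it is integrated innermost, and the tail ranges over its box. *)
  rewrite e2; apply: (norm_Rintegral_le_supported d0 (@measurable_box n M) (lebesgue_tuple_box n M0)) => //.
    move=> z; have := gd (cons_pair (0, z)); congr (`|_| <= _).
    apply: eq_Rintegral => s _; congr g; apply: eq_from_tnth => j.
    rewrite tnth_mktuple ik; case: (unliftP ord0 j) => [l|] ->; rewrite ?eqxx// ?tnthS//.
  move=> z hz; rewrite (_ : (fun a => _) = cst 0).
    by rewrite Rintegral_cst// mul0r.
  apply/funext => a; apply: g0 => h2; apply: hz => j.
  by have := h2 (lift ord0 j); rewrite tnthS.
have n0 : (0 < n)%N by apply: leq_ltn_trans (ltn_ord k).
(* Here [i] lies in the tail: the induction hypothesis bounds each section with fixed head, and the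
   head contributes one more factor [2 * M]. *)
rewrite e1 (_ : _ ^+ _ = (2 * M) ^+ n.-1 * (2 * M)); last first.
  by rewrite -exprSr prednK.
rewrite mulrA; apply: (@norm_Rintegral_le_supported _ _ _ lebesgue_measure (seg M) (2 * M)).
- by rewrite mulr_ge0// exprn_ge0//; lra.
- exact: measurable_seg.
- exact: lebesgue_seg_le.
- exact: m1.
- move=> a; apply: (IH k C) => //.
  + exact: (measurableT_comp mg (@measurable_cons_pairr n _)).
  + move=> z hz; apply: g0 => h2; apply: hz => j.
    by have := h2 (lift ord0 j); rewrite tnthS.
  + move=> z; have := gd (cons_pair (a, z)); congr (`|_| <= _).
    apply: eq_Rintegral => s _; congr g; apply: eq_from_tnth => j.
    rewrite tnth_mktuple ik; case: (unliftP ord0 j) => [l|] ->.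
      by rewrite !tnthS tnth_mktuple (inj_eq lift_inj).
    by rewrite !tnth0.
- move=> a ha; rewrite (_ : (fun a => _) = cst 0).
    by rewrite Rintegral_cst// mul0r.
  apply/funext => z; apply: g0 => h2; apply: ha => /=.
  by have := h2 ord0; rewrite segP.
Qed.

End slices.

Section space_integral_theory.
Context {R : realType} {d : nat}.
Local Notation V := 'rV[R]_d.
Local Notation mR := (measurableTypeR R).
Implicit Types (Om U : set V) (f g : V -> R).

Lemma ball_rowP (x y : V) (e : R) : 0 < e ->
  ball x e y <-> forall j, `|x 0 j - y 0 j| < e.
Proof.
move=> e0; split.
  by move=> [_ h] j; have := h 0 j.
by move=> h; split => // i j; rewrite ord1; exact: h.
Qed.

(** The sigma-algebra on tuples is the product one, so openness has to be turned into a countable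
    union of boxes: those with rational centre and radius [1 / (k + 1)] that lie inside [U]. *)
Lemma measurable_open_row U : open U -> measurable (@row_of_tuple R d @^-1` U).
Proof.
move=> oU.
pose cube (q : 'rV[rat]_d) (k : nat) : set V :=
  [set x | forall j, `|ratr (q 0 j) - x 0 j| < k.+1%:R^-1].
pose B (i : nat) : set V :=
  if unpickle i is Some (q, k) then
    [set x | cube q k `<=` U /\ cube q k x] else set0.
have -> : U = \bigcup_i B i.
  apply/seteqP; split => x.
    move=> Ux; have /nbhs_ballP[e /= e0 eU] := open_nbhs_nbhs (conj oU Ux).
    (* Half of [e], because the centre is within [w] of [x] and the cube has radius [w]. *)
    have [k ke] : exists k : nat, k.+1%:R^-1 < e / 2.
      have [k _ hk] := @near_infty_natSinv_lt R (PosNum (divr_gt0 e0 (ltr0Sn R 1))).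
      by exists k; apply: hk => /=.
    have k0 : 0 < k.+1%:R^-1 :> R by rewrite invr_gt0.
    move: k0 ke; set w : R := k.+1%:R^-1 => k0 ke.
    have /choice[q hq] : forall j : 'I_d, exists r : rat, `|ratr r - x 0 j| < w.
      move=> j; have [r] := @rat_in_itvoo R (x 0 j - w) (x 0 j + w) ltac:(lra).
      by rewrite in_itv/= => /andP[r1 r2]; exists r; rewrite ltr_norml; apply/andP; split; lra.
    exists (pickle (\row_j q j, k)) => //; rewrite /B pickleK; split.
      move=> y hy; apply: eU; apply/ball_rowP => // j.
      have := hy j; rewrite !mxE -/w => h1; have h2 := hq j.
      rewrite (_ : x 0 j - y 0 j = (ratr (q j) - y 0 j) - (ratr (q j) - x 0 j)); last by ring.
      by rewrite (le_lt_trans (ler_normB _ _))//; lra.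
    by move=> j; rewrite mxE; exact: hq.
  by move=> [i _]; rewrite /B; case: unpickle => [[q k] [h1 h2]|//]; exact: h1.
rewrite preimage_bigcup; apply: bigcupT_measurable => i; rewrite /B.
case: unpickle => [[q k]|]; last by rewrite preimage_set0; exact: measurable0.
(* The inclusion depends on the index alone, so this member of the union is either the full cube or
   empty. *)
have [cU|ncU] := pselect (cube q k `<=` U); last first.
  rewrite (_ : _ @^-1` _ = set0); first exact: measurable0.
  by apply/seteqP; split => // x [].
rewrite (_ : _ @^-1` _ = \bigcap_(j in [set: 'I_d])
  ((@tnth d mR ^~ j) @^-1` `]ratr (q 0 j) - k.+1%:R^-1, ratr (q 0 j) + k.+1%:R^-1[)).
  apply: fin_bigcap_measurable; first exact: finite_finset.
  move=> j _; rewrite -[X in measurable X]setTI; apply: measurable_tnth => //.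
apply/seteqP; split => x /=.
  move=> [_ h] j _ /=; have := h j; rewrite mxE in_itv/= ltr_norml.
  by move: (k.+1%:R^-1 : R) => w /andP[? ?]; apply/andP; split; lra.
move=> h; split => // j; have /= := h j I; rewrite mxE in_itv/= ltr_norml.
by move: (k.+1%:R^-1 : R) => w /andP[? ?]; apply/andP; split; lra.
Qed.

Lemma measurable_continuous_row Om f : open Om ->
  (forall x, Om x -> {for x, continuous f}) ->
  measurable_fun (@row_of_tuple R d @^-1` Om) (f \o @row_of_tuple R d).
Proof.
move=> oOm cf; apply: (measurability _ (RGenOpens.measurableE R)).
move=> _ [_ [a [b ->] <-]].
apply: (@measurable_open_row (Om `&` f @^-1` `]a, b[)%classic).
rewrite openE => x [Omx /= fx]; apply: filterI; first exact: open_nbhs_nbhs.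
apply: (cf x Omx); apply: open_nbhs_nbhs; split => //; exact: interval_open.
Qed.

Definition bounded_by (M : R) Om := forall x, Om x -> forall j, `|x 0 j| <= M.

Section on_bounded_open.
Variables (Om : set V) (M : R).
Hypotheses (M0 : 0 <= M) (oOm : open Om) (OmM : bounded_by M Om).

Lemma lebesgue_tuple_bounded_lty :
  (lebesgue_tuple R d (@row_of_tuple R d @^-1` Om) < +oo)%E.
Proof.
apply: (@le_lt_trans _ _ (lebesgue_tuple R d (@box R d M))).
  apply: le_measure; rewrite ?inE.
  - exact: measurable_open_row.
  - exact: measurable_box.
  - by move=> x /OmM h j; have := h j; rewrite mxE.
by rewrite (le_lt_trans (@lebesgue_tuple_box _ _ _ M0))// ltry.
Qed.

Lemma space_integrable f C : (forall x, Om x -> {for x, continuous f}) ->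
  (forall x, Om x -> `|f x| <= C) ->
  (lebesgue_tuple R d).-integrable (@row_of_tuple R d @^-1` Om)
    (EFin \o (f \o @row_of_tuple R d)).
Proof.
move=> cf fC; apply: measurable_bounded_integrable => //.
- exact: measurable_open_row.
- exact: lebesgue_tuple_bounded_lty.
- exact: measurable_continuous_row.
exists C; split; [exact: num_real|move=> y Cy x Omx /=].
exact: (le_trans (fC _ Omx) (ltW Cy)).
Qed.

Lemma eq_space_integral f g : (forall x, Om x -> f x = g x) ->
  \int_(x in Om) f x = \int_(x in Om) g x.
Proof.
by move=> fg; apply: eq_Rintegral => x; rewrite inE => Omx; exact: fg.
Qed.

Lemma space_integral_slice_bound (i : 'I_d) (C delta : R) f :
  0 <= C -> 0 <= delta -> (forall x, Om x -> {for x, continuous f}) ->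
  (forall x, Om x -> `|f x| <= C) ->
  (forall x : V, `|\int[lebesgue_measure]_s
      (f \_ Om) (\row_j if j == i then s else x 0 j)| <= delta) ->
  `|\int_(x in Om) f x| <= delta * (2 * M) ^+ d.-1.
Proof.
move=> C0 d0 cf fC fd.
have mOm := measurable_open_row oOm.
rewrite /space_integral Rintegral_mkcond.
apply: (@slice_bound _ _ i M C) => //.
- have := measurable_continuous_row oOm cf.
  by move/(measurable_restrictT _ mOm).
- by move=> x; rewrite patchE; case: ifPn => [|_]; rewrite ?normr0// inE => /fC.
- move=> x hx; rewrite patchE; case: ifPn => //; rewrite inE => /OmM h.
  by exfalso; apply: hx => j; have := h j; rewrite mxE.
- move=> x; have := fd (row_of_tuple x); congr (`|_| <= _).
  apply: eq_Rintegral => s _; rewrite !patchE.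
  have -> : (\row_j (if j == i then s else row_of_tuple x 0 j)) = row_of_tuple (tset x i s).
    by apply/rowP => j; rewrite !mxE tnth_mktuple.
  by rewrite (_ : (_ \in _ @^-1` Om) = (row_of_tuple (tset x i s) \in Om))//; apply/idP/idP; rewrite !inE.
Qed.

End on_bounded_open.
End space_integral_theory.

(** * Derivatives along lines and a C^1 step *)

Section line_derivatives.
Context {R : realType}.

(** Both sides have the same difference quotient. This reduces directional derivatives to
    one-variable calculus, here and for the time direction as well. *)
Lemma is_derive_lineP (V : normedModType R) (g : V -> R) (x v : V) (r dg : R) :
  is_derive (r *: v + x) v g dg <-> is_derive r 1 (fun s : R => g (s *: v + x)) dg.
Proof.
have E : (fun h : R => h^-1 *: (g (h *: v + (r *: v + x)) - g (r *: v + x))) =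
         (fun h : R => h^-1 *: (g ((h *: 1 + r) *: v + x) - g (r *: v + x))).
  by apply/funext => h; rewrite scalerDl addrA scaler1.
split => -[d1 d2]; apply: DeriveDef.
- by move: d1; rewrite /derivable/= E.
- by move: d2; rewrite /derive/= E.
- by move: d1; rewrite /derivable/= E.
- by move: d2; rewrite /derive/= E.
Qed.

(** Chain rule for a single direction: fields are known to have partial derivatives, and [g] is not
    assumed differentiable. *)
Lemma is_derive_comp1 (V : normedModType R) (h : R -> R) (g : V -> R) (x v : V) (dh dg : R) :
  is_derive (g x) 1 h dh -> is_derive x v g dg -> is_derive x v (h \o g) (dh * dg).
Proof.
move=> Hh Hg.
have xE : x = (0 : R) *: v + x by rewrite scale0r add0r.
move: Hg; rewrite {1}xE => /is_derive_lineP Hg.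
rewrite xE; apply/is_derive_lineP.
by apply: (@is_derive1_comp _ h (fun s : R => g (s *: v + x))); rewrite -?xE.
Qed.

(** Mean value theorem based at 0 for either sign of [t], so that later arguments need no case
    split. *)
Lemma MVT_abs (f df : R -> R) (t : R) :
  (forall r : R, `|r| <= `|t| -> is_derive r 1 f (df r)) ->
  exists2 r, `|r| <= `|t| & f t - f 0 = df r * t.
Proof.
move=> H.
have cf (a b : R) : (forall r, r \in `[a, b] -> `|r| <= `|t|) -> {within `[a, b], continuous f}.
  by move=> h; apply: derivable_within_continuous => r /h /H[].
have [t0|t0] := leP 0 t.
  have h (r : R) : r \in `[0, t] -> `|r| <= `|t|.
    by rewrite in_itv/= => /andP[r0 rt]; rewrite !ger0_norm.
  have [c cab e] := MVT_segment t0 (fun r hr => H r (h r (subset_itv_oo_cc hr))) (cf _ _ h).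
  by exists c; [exact: h|rewrite e subr0].
have h (r : R) : r \in `[t, 0] -> `|r| <= `|t|.
  by rewrite in_itv/= => /andP[r0 rt]; rewrite !ler0_norm ?lerN2// ltW.
have [c cab e] := MVT_segment (ltW t0) (fun r hr => H r (h r (subset_itv_oo_cc hr))) (cf _ _ h).
exists c; first exact: h.
by rewrite -[LHS]opprB e sub0r mulrN opprK.
Qed.

Lemma MVT_line (V : normedModType R) (g : V -> R) (x v : V) (t : R) :
  (forall r : R, `|r| <= `|t| -> derivable g (r *: v + x) v) ->
  exists2 r : R, `|r| <= `|t| & g (t *: v + x) - g x = 'D_v g (r *: v + x) * t.
Proof.
move=> H.
have [r rt e] := @MVT_abs (fun s : R => g (s *: v + x)) (fun s => 'D_v g (s *: v + x)) t
  (fun r hr => proj1 (@is_derive_lineP V g x v r _) (derivableP (H r hr))).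
by exists r => //; rewrite -e scale0r add0r.
Qed.

(** Apply the mean value theorem in the first variable to [G s h - G s 0], then in the second
    variable to [Gx s]. *)
Lemma mixed_difference (G Gx Gxy : R -> R -> R) (e h : R) : 0 < h < e ->
  (forall s r : R, `|s| < e -> `|r| < e -> is_derive s 1 (G ^~ r) (Gx s r)) ->
  (forall s r : R, `|s| < e -> `|r| < e -> is_derive r 1 (Gx s) (Gxy s r)) ->
  exists p : R * R, [/\ `|p.1| <= h, `|p.2| <= h &
    G h h - G h 0 - G 0 h + G 0 0 = Gxy p.1 p.2 * h ^+ 2].
Proof.
move=> /andP[h0 he] HG HGx.
have le (r : R) : `|r| <= `|h| -> `|r| < e by move=> rh; rewrite (le_lt_trans rh)// gtr0_norm.
have e0 : `|0 : R| < e by rewrite normr0 (lt_trans h0).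
have eh : `|h| < e by rewrite gtr0_norm.
have [s sh es] := @MVT_abs (fun s => G s h - G s 0) (fun s => Gx s h - Gx s 0) h
  (fun s hs => is_deriveB (HG s h (le s hs) eh) (HG s 0 (le s hs) e0)).
have [r rh er] := @MVT_abs (Gx s) (Gxy s) h (fun r hr => HGx s r (le s sh) (le r hr)).
exists (s, r); split => /=; [by rewrite -(gtr0_norm h0)|by rewrite -(gtr0_norm h0)|].
by rewrite expr2 mulrA -er -es; ring.
Qed.

(** Schwarz's theorem: the second difference is symmetric in the two variables, so [Gxy] and [Gyx]
    take a common value at two points near the origin, and both are continuous there. *)
Lemma mixed_derivatives_eq (G Gx Gy Gxy Gyx : R -> R -> R) (e : R) : 0 < e ->
  (forall s r : R, `|s| < e -> `|r| < e -> is_derive s 1 (G ^~ r) (Gx s r)) ->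
  (forall s r : R, `|s| < e -> `|r| < e -> is_derive r 1 (Gx s) (Gxy s r)) ->
  (forall s r : R, `|s| < e -> `|r| < e -> is_derive r 1 (G s) (Gy s r)) ->
  (forall s r : R, `|s| < e -> `|r| < e -> is_derive s 1 (Gy ^~ r) (Gyx s r)) ->
  (forall eta, 0 < eta -> exists2 h, 0 < h & forall s r : R, `|s| <= h -> `|r| <= h ->
     `|Gxy s r - Gxy 0 0| <= eta) ->
  (forall eta, 0 < eta -> exists2 h, 0 < h & forall s r : R, `|s| <= h -> `|r| <= h ->
     `|Gyx s r - Gyx 0 0| <= eta) ->
  Gxy 0 0 = Gyx 0 0.
Proof.
move=> e0 H1 H2 H3 H4 c1 c2; apply/eqP; rewrite -subr_eq0 -normr_le0.
apply/ler_addgt0Pl => eta eta0; rewrite addr0.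
have eta2 : 0 < eta / 2 by lra.
have [h1 h10 hh1] := c1 _ eta2; have [h2 h20 hh2] := c2 _ eta2.
pose h := Num.min (Num.min h1 h2) (e / 2).
have h0 : 0 < h by rewrite !lt_min h10 h20/=; lra.
have hh1' : h <= h1 by rewrite !ge_min lexx.
have hh2' : h <= h2 by rewrite !ge_min lexx orbT.
have he : h < e by rewrite (@le_lt_trans _ _ (e / 2))//; [rewrite !ge_min lexx !orbT|lra].
have hi : 0 < h < e by rewrite h0.
have [[s r] /= [sh rh e1]] := mixed_difference hi H1 H2.
have [[r' s'] /= [rh' sh' e2]] := @mixed_difference (fun r s => G s r) (fun r s => Gy s r)
  (fun r s => Gyx s r) e h hi (fun r s hr hs => H3 s r hs hr) (fun r s hr hs => H4 s r hs hr).
have E : Gxy s r = Gyx s' r'.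
  apply: (@mulIf _ (h ^+ 2)); first by rewrite expf_neq0// gt_eqF.
  by rewrite -e1 -e2; ring.
have := hh1 s r (le_trans sh hh1') (le_trans rh hh1').
have := hh2 s' r' (le_trans sh' hh2') (le_trans rh' hh2').
by rewrite E !ler_norml => /andP[? ?] /andP[? ?]; apply/andP; split; lra.
Qed.

End line_derivatives.

Section cutoff.
Context {R : realType}.

Definition pos_sq (s : R) : R := Num.max 0 s ^+ 2.

Lemma continuous_pos : continuous (fun s : R => Num.max 0 s).
Proof. by move=> s; apply: continuous_max; [exact: cvg_cst|exact: cvg_id]. Qed.

(** The remainder of the first-order expansion is at most [h ^+ 2] whatever the signs of [s] and
    [h + s]; one estimate covers the kink at 0 as well. *)
Lemma is_derive_pos_sq (s : R) : is_derive s 1 pos_sq (2 * Num.max 0 s).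
Proof.
have lim : h^-1 *: (pos_sq (h *: 1 + s) - pos_sq s) @[h --> (0:R)^'] --> (2 * Num.max 0 s).
  apply/cvgrPdist_le => /= e e0; near=> h.
  have h0 : h != 0 by near: h; exact: nbhs_dnbhs_neq.
  have he : `|h| <= e.
    near: h; apply: dnbhs0_le => //.
  apply: le_trans he; rewrite scaler1.
  have : `|2 * Num.max 0 s * h - (pos_sq (h + s) - pos_sq s)| <= `|h| * `|h|.
    rewrite -normrM -expr2 (ger0_norm (sqr_ge0 _)) /pos_sq.
    case: (leP 0 s) => s0; case: (leP 0 (h + s)) => hs0; rewrite ler_norml; apply/andP; split; nra.
  move=> P; rewrite -(@ler_pM2r _ `|h|) ?normr_gt0//; apply: le_trans P.
  by rewrite -normrM mulrBl /GRing.scale/= [h^-1 * _ * h]mulrAC mulVf// mul1r.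
by apply: DeriveDef; [apply/cvg_ex; eexists; exact: lim|exact: cvg_lim lim].
Unshelve. all: by end_near. Qed.

(* A C^1 step from 0 (left of 1) to 1 (right of 2): the quadratic spline whose
   derivative is the hat function on [1, 2]. *)
Definition step (s : R) : R :=
  2 * (pos_sq (s - 1) - 2 * pos_sq (s - 3 / 2) + pos_sq (s - 2)).

Definition dstep (s : R) : R :=
  4 * (Num.max 0 (s - 1) - 2 * Num.max 0 (s - 3 / 2) + Num.max 0 (s - 2)).

Lemma is_derive_step (s : R) : is_derive s 1 step (dstep s).
Proof.
have H (c : R) : is_derive s 1 (fun s => pos_sq (s - c)) (2 * Num.max 0 (s - c)).
  have := @is_derive1_comp R pos_sq (fun s => s - c) s _ _ (is_derive_pos_sq (s - c))
    (is_deriveB (is_derive_id s (1:R)) (is_derive_cst c s (1:R))).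
  by move/is_derive_eq; apply; rewrite subr0 mulr1.
have := is_deriveZ 2 (is_deriveD (is_deriveB (H 1) (is_deriveZ 2 (H (3/2)))) (H 2)).
move/is_derive_eq; apply; rewrite /dstep /GRing.scale/=; ring.
Qed.

Lemma continuous_dstep : continuous dstep.
Proof.
have H (c : R) : continuous (fun s : R => Num.max 0 (s - c)).
  move=> s; apply: (@continuous_comp _ _ _ (fun s => s - c) (fun s => Num.max 0 s)).
    by apply: cvgB; [exact: cvg_id|exact: cvg_cst].
  exact: continuous_pos.
move=> s; apply: cvgMr; apply: cvgD; last exact: H.
by apply: cvgB; [exact: H|apply: cvgMr; exact: H].
Qed.

Lemma step_le1 s : s <= 1 -> step s = 0.
Proof.
by move=> s1; rewrite /step /pos_sq !max_l ?expr0n/= ?mulr0 ?subr0 ?addr0 ?mulr0//; lra.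
Qed.

Lemma step_ge2 s : 2 <= s -> step s = 1.
Proof. by move=> s1; rewrite /step /pos_sq !max_r; [field|lra|lra|lra]. Qed.

Lemma step_bound s : 0 <= step s <= 1.
Proof.
rewrite /step /pos_sq; case: (leP 0 (s - 1)) => ?; case: (leP 0 (s - 3/2)) => ?;
  case: (leP 0 (s - 2)) => ?; apply/andP; split; nra.
Qed.

(** The hat function peaks at [3 / 2] with value [4 * (1 / 2)]; this is the 2 in the later factor
    [2 / eps]. *)
Lemma dstep_bound s : 0 <= dstep s <= 2.
Proof.
rewrite /dstep; case: (leP 0 (s - 1)) => ?; case: (leP 0 (s - 3/2)) => ?;
  case: (leP 0 (s - 2)) => ?; apply/andP; split; lra.
Qed.

Lemma dstep_ge2 s : 2 <= s -> dstep s = 0.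
Proof. by move=> s1; rewrite /dstep !max_r; lra. Qed.

End cutoff.

Lemma near_eq_continuous_at (T U : topologicalType) (f g : T -> U) (x : T) :
  (\near x, f x = g x) -> {for x, continuous f} -> {for x, continuous g}.
Proof.
move=> fg cf; rewrite /prop_for /continuous_at -(nbhs_singleton fg).
by apply: cvg_trans cf; apply: near_eq_cvg.
Qed.

(** * Integrals of partial derivatives of functions vanishing near the boundary *)

Section coordinates.
Context {R : realType} {d : nat}.
Local Notation V := 'rV[R]_d.
Local Notation e_ i := (delta_mx 0 i : V).

Lemma coord_lineE (x : V) (i : 'I_d) (s : R) :
  \row_j (if j == i then s else x 0 j) =
  s *: e_ i + \row_j (if j == i then 0 else x 0 j).
Proof.
by apply/rowP => j; rewrite !mxE eqxx/=; case: eqVneq => _; rewrite ?mulr1 ?mulr0 ?addr0 ?add0r.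
Qed.

Lemma continuous_line (x v : V) : continuous (fun s : R => s *: v + x).
Proof.
move=> s; apply: cvgD; last exact: cvg_cst.
by apply: cvgZr_tmp; exact: cvg_id.
Qed.

(** Since [y] vanishes off a closed [K] inside [Om], its extension by zero is [C^1] along every line
    parallel to the [j]-th axis. The fundamental theorem of calculus makes each slice integral 0,
    and [slice_bound] applies with [delta = 0]. *)
Lemma space_integral_partial_eq0 (Om K : set V) (M C : R) (j : 'I_d) (y : V -> R) :
  0 <= M -> open Om -> bounded_by M Om -> closed K -> K `<=` Om -> 0 <= C ->
  (forall x, Om x -> derivable y x (e_ j)) ->
  (forall x, Om x -> {for x, continuous (partial j y)}) ->
  (forall x, Om x -> `|partial j y x| <= C) ->
  (forall x, Om x -> ~ K x -> y x = 0) ->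
  \int_(x in Om) partial j y x = 0.
Proof.
move=> M0 oOm OmM cK KOm C0 dy cdy bdy y0.
apply/eqP; rewrite -normr_le0 -(mul0r ((2 * M) ^+ d.-1)).
apply: (@space_integral_slice_bound _ _ _ _ M0 oOm OmM j C) => // x.
pose x0 : V := \row_k (if k == j then 0 else x 0 k).
under eq_Rintegral do rewrite coord_lineE -/x0.
pose L (s : R) : V := s *: e_ j + x0.
have cL : continuous L by exact: continuous_line.
pose Y (z : V) := (y \_ Om) z.
(* A point outside [Om] is outside [K], whose complement is open; so [Y] is locally either [y] or 0,
   even at boundary points. *)
have nearY z : (Om z /\ \near z, y z = Y z) \/ (~ Om z /\ \near z, 0 = Y z).
  have [Oz|nOz] := pselect (Om z); [left|right]; split => //.
    near=> w; rewrite /Y patchE mem_set//; near: w; exact: open_nbhs_nbhs.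
  near=> w; rewrite /Y patchE; case: ifPn => //; rewrite inE => Ow.
  rewrite y0//; near: w; apply: open_nbhs_nbhs; split; last by move=> /KOm.
  by rewrite openC.
have dY (s : R) : is_derive s 1 (Y \o L) ((partial j y \_ Om) (L s)).
  apply/(@is_derive_lineP R V Y x0 (e_ j) s); rewrite patchE -/(L s).
  case: (nearY (L s)) => -[Os ys].
    by rewrite mem_set//; apply: (near_eq_is_derive ys); apply/derivableP/dy.
  by rewrite memNset//; apply: (near_eq_is_derive ys); exact: is_derive_cst.
have cY : continuous (fun s => (partial j y \_ Om) (L s)).
  move=> s; apply: (@continuous_comp _ _ _ L (partial j y \_ Om)); first exact: cL.
  case: (nearY (L s)) => -[Os ys].
    apply: (near_eq_continuous_at _ (cdy _ Os)).
    near=> w; rewrite patchE mem_set//; near: w; exact: open_nbhs_nbhs.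
  apply: (near_eq_continuous_at (f := cst 0)); last exact: cst_continuous.
  (* [Y] is 0 on a whole neighbourhood of each such [w], so if [w] is in [Om] the partial derivative
     of [y] at [w] is 0 too. *)
  apply: filterS (nbhs_interior ys) => w yw.
  rewrite patchE; case: ifPn => //; rewrite inE => Ow.
  rewrite /partial -(near_eq_derive (f := cst 0)) ?derive_cst//.
  by apply: filterS2 yw (open_nbhs_nbhs (conj oOm Ow)) => v -> ; rewrite /Y patchE => /mem_set ->.
have outM s : M < `|s| -> ~ Om (L s).
  move=> Ms /OmM /(_ j); rewrite !mxE !eqxx/= mulr1 addr0 => h.
  by move: Ms; rewrite ltNge h.
(* Past [M], so that both endpoints of the segment [[- b, b]] lie off [Om], where [Y] is 0. *)
pose b := M + 1.
have bb : - b < b by rewrite /b; lra.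
rewrite [X in `|X|](_ : _ = 0) ?normr0//.
transitivity (\int[lebesgue_measure]_(s in `[- b, b]) ((partial j y \_ Om) (L s))).
  rewrite [RHS]Rintegral_mkcond; apply: eq_Rintegral => s _; rewrite [RHS]patchE.
  case: ifPn => //; rewrite notin_setE/= in_itv/= -ler_norml => /negP; rewrite -ltNge => bs.
  by rewrite patchE memNset//; apply: outM; rewrite (lt_trans _ bs)// /b; lra.
rewrite /Rintegral (@continuous_FTC2 _ _ (Y \o L) _ _ bb).
- rewrite /Y/= !patchE !memNset ?subrr//; apply: outM; rewrite ?normrN gtr0_norm /b; lra.
- exact: continuous_subspaceT.
- have cYL : continuous (Y \o L).
    by move=> s; apply/differentiable_continuous/derivable1_diffP; have [] := dY s.
  split.
  + by move=> s _; have [] := dY s.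
  + by apply: cvg_at_right_filter; exact: cYL.
  + by apply: cvg_at_left_filter; exact: cYL.
- by move=> s _; rewrite derive1E; have [] := dY s.
Unshelve. all: by end_near. Qed.

End coordinates.

(** * Domains and boundary regularity *)

Section continuous_extension.
Context {R : realType} {d : nat}.
Local Notation V := 'rV[R]_d.
Local Notation e_ i := (delta_mx 0 i : V).
Implicit Types (Om : set V) (f g : V -> R).

(** [extends_continuously] at a frozen time. Nothing is said about [f] itself off [Om]. *)
Definition cont_ext Om f := exists G : V -> R,
  {within closure Om, continuous G} /\ forall x, Om x -> G x = f x.

Definition C1_ext Om f := [/\ cont_ext Om f,
  forall i x, Om x -> derivable f x (e_ i) & forall i, cont_ext Om (partial i f)].

Lemma within_cvg Om (G : V -> R) x : {within closure Om, continuous G} -> closure Om x ->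
  G y @[y --> within (closure Om) (nbhs x)] --> G x.
Proof. by move=> /subspace_continuousP; apply. Qed.

Lemma within_cvg_interior Om (G : V -> R) x : {within closure Om, continuous G} -> closure Om x ->
  G y @[y --> within Om (nbhs x)] --> G x.
Proof.
move=> cG Ox; apply: cvg_trans (within_cvg cG Ox); apply: cvg_app.
move=> A wA; have {}wA : nbhs x (fun y => closure Om y -> A y) := wA.
suff : nbhs x (fun y => Om y -> A y) by [].
by apply: filterS wA => y h Oy; exact/h/subset_closure.
Qed.

(** The bridge between the two descriptions of boundary values: limits from inside and values of an
    extension. *)
Lemma cont_ext_trace Om (G f : V -> R) x : {within closure Om, continuous G} ->
  (forall x, Om x -> G x = f x) -> closure Om x -> has_trace Om f x (G x).
Proof.
move=> cG Gf Ox; apply: cvg_trans (within_cvg_interior cG Ox).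
apply: near_eq_cvg; rewrite near_withinE; near=> y => Oy; exact: Gf.
Unshelve. all: by end_near. Qed.

Lemma cont_ext_continuous Om f : open Om -> cont_ext Om f ->
  forall x, Om x -> {for x, continuous f}.
Proof.
move=> oOm [G [cG Gf]] x Ox.
have h := within_cvg_interior cG (subset_closure Ox).
have W : within Om (nbhs x) = nbhs x by apply: within_interior; move: oOm; rewrite openE; apply.
rewrite W in h; apply: (near_eq_continuous_at (f := G)) => //.
by apply: filterS (open_nbhs_nbhs (conj oOm Ox)) => y; exact: Gf.
Qed.

Lemma cont_extW Om f : continuous f -> cont_ext Om f.
Proof. by move=> cf; exists f; split => //; exact: continuous_subspaceT. Qed.

Lemma cont_ext_eq Om f g : (forall x, Om x -> f x = g x) -> cont_ext Om f -> cont_ext Om g.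
Proof. by move=> fg [G [cG Gf]]; exists G; split => // x Ox; rewrite Gf// fg. Qed.

Lemma cont_extD Om f g : cont_ext Om f -> cont_ext Om g -> cont_ext Om (fun x => f x + g x).
Proof.
move=> [F [cF Ff]] [G [cG Gg]]; exists (fun x => F x + G x); split.
  by move=> x; apply: cvgD; [exact: cF|exact: cG].
by move=> x Ox; rewrite Ff// Gg.
Qed.

Lemma cont_extM Om f g : cont_ext Om f -> cont_ext Om g -> cont_ext Om (fun x => f x * g x).
Proof.
move=> [F [cF Ff]] [G [cG Gg]]; exists (fun x => F x * G x); split.
  by move=> x; apply: cvgM; [exact: cF|exact: cG].
by move=> x Ox; rewrite Ff// Gg.
Qed.

Lemma cont_ext_cst Om (c : R) : cont_ext Om (cst c).
Proof. by apply: cont_extW; exact: cst_continuous. Qed.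

Lemma partialD Om f g i x : C1_ext Om f -> C1_ext Om g -> Om x ->
  partial i (fun x => f x + g x) x = partial i f x + partial i g x.
Proof.
by move=> [_ f1 _] [_ g1 _] Ox; rewrite /partial -(deriveD (f1 i x Ox) (g1 i x Ox)).
Qed.

Lemma C1_ext_D Om f g : C1_ext Om f -> C1_ext Om g -> C1_ext Om (fun x => f x + g x).
Proof.
move=> Hf Hg; have [f0 f1 f2] := Hf; have [g0 g1 g2] := Hg; split; first exact: cont_extD.
  by move=> i x Ox; apply: derivableD; [exact: f1|exact: g1].
move=> i; apply: (cont_ext_eq _ (cont_extD (f2 i) (g2 i))) => x Ox.
by rewrite (partialD _ Hf Hg).
Qed.

Lemma partialM Om f g i x : C1_ext Om f -> C1_ext Om g -> Om x ->
  partial i (fun x => f x * g x) x = f x * partial i g x + g x * partial i f x.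
Proof.
by move=> [_ f1 _] [_ g1 _] Ox; rewrite /partial (deriveM (f1 i x Ox) (g1 i x Ox)).
Qed.

Lemma C1_ext_M Om f g : C1_ext Om f -> C1_ext Om g -> C1_ext Om (fun x => f x * g x).
Proof.
move=> Hf Hg; have [f0 f1 f2] := Hf; have [g0 g1 g2] := Hg; split; first exact: cont_extM.
  by move=> i x Ox; apply: derivableM; [exact: f1|exact: g1].
move=> i; apply: (cont_ext_eq _ (cont_extD (cont_extM f0 (g2 i)) (cont_extM g0 (f2 i)))) => x Ox.
by rewrite (partialM _ Hf Hg).
Qed.

Lemma bounded_closure Om : bounded_set Om -> bounded_set (closure Om).
Proof.
move=> [M [Mr H]]; exists M; split => // N MN x cx /=.
have Mn : (M + N) / 2 > M by lra.
rewrite leNgt; apply/negP => Nx.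
have Nn : nbhs x [set y : V | N < `|y|].
  exact: (@cvgr_norm_gt R V V (nbhs x) _ id x cvg_id N Nx).
have [y [Oy]] := cx _ Nn.
by move=> /=; rewrite ltNge (H N MN y Oy).
Qed.

Lemma compact_closure_bounded Om : bounded_set Om -> compact (closure Om).
Proof. by move=> bOm; apply: bounded_closed_compact; [exact: bounded_closure|exact: closed_closure]. Qed.

Lemma cont_ext_bounded Om f : bounded_set Om -> cont_ext Om f ->
  exists2 C, 0 <= C & forall x, Om x -> `|f x| <= C.
Proof.
move=> bOm [G [cG Gf]].
have /compact_bounded[C [_ HC]] := continuous_compact cG (compact_closure_bounded bOm).
exists (`|C| + 1); first by have := normr_ge0 C; lra.
move=> x Ox; rewrite -Gf//; apply: (HC (`|C| + 1)); first by have := ler_norm C; lra.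
by exists x => //; exact: subset_closure.
Qed.

Lemma bounded_set_bounded_by Om : bounded_set Om -> exists2 M : R, 0 <= M & bounded_by M Om.
Proof.
move=> [M [_ H]]; exists (`|M| + 1); first by have := normr_ge0 M; lra.
move=> x Ox j; apply: (@le_trans _ _ `|x|); last first.
  by apply: (H (`|M| + 1)) => //; have := ler_norm M; lra.
by rewrite [leRHS]/Num.Def.normr/= mx_normrE; apply/bigmax_geP; right => /=; exists (0, j).
Qed.

End continuous_extension.

(** * Local defining functions and the direction of their gradients *)

Section defining_functions.
Context {R : realType} {d : nat}.
Local Notation V := 'rV[R]_d.
Local Notation e_ i := (delta_mx 0 i : V).
Implicit Types (Om : set V).

(** The radius [eta] is chosen so that the perturbation [(|a| + |b|) * eta] uses up less than half
    of the negative quantity. *)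
Lemma descent_num (a b A B P Q : R) : a * A + b * B < 0 ->
  let eta := - (a * A + b * B) / (2 * (`|a| + `|b| + 1)) in
  `|P - A| < eta -> `|Q - B| < eta -> a * P + b * Q < 0.
Proof.
move=> lt0; set w := _ + 1 => eta hP hQ.
have w0 : 0 < w by rewrite /w; have := normr_ge0 a; have := normr_ge0 b; lra.
have eta0 : 0 < eta by rewrite divr_gt0; lra.
have etaE : a * A + b * B = - (2 * (w * eta)) by rewrite /eta; field; rewrite gt_eqF.
have k1 : a * (P - A) <= `|a| * eta.
  by apply: (le_trans (ler_norm _)); rewrite normrM; apply: ler_wpM2l; rewrite ?normr_ge0 ?ltW.
have k2 : b * (Q - B) <= `|b| * eta.
  by apply: (le_trans (ler_norm _)); rewrite normrM; apply: ler_wpM2l; rewrite ?normr_ge0 ?ltW.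
have k3 : w * eta = `|a| * eta + `|b| * eta + eta by rewrite /w; ring.
have k4 : 0 < w * eta by rewrite mulr_gt0.
by move: k1 k2 k3 k4 etaE; rewrite !mulrBr; move: (w * eta) => ?; lra.
Qed.

(** With only partial derivatives available, the displacement is split into a leg along [e_ i]
    followed by a leg along [e_ j]. The mean value theorem on each leg gives a slope close to the
    one at [x], by continuity of the partials. *)
Lemma descent_direction (g : V -> R) (x : V) (i j : 'I_d) (a b : R) :
  (\near x, forall k, derivable g x (e_ k)) ->
  {for x, continuous (partial i g)} -> {for x, continuous (partial j g)} ->
  a * partial i g x + b * partial j g x < 0 ->
  \forall s \near 0^'+, g (s *: (a *: e_ i + b *: e_ j) + x) < g x.
Proof.
move=> dg ci cj lt0.
set A := partial i g x in lt0 *; set B := partial j g x in lt0 *.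
pose w : R := `|a| + `|b| + 1.
have w0 : 0 < w by rewrite /w; have := normr_ge0 a; have := normr_ge0 b; lra.
pose eta : R := - (a * A + b * B) / (2 * w).
have eta0 : 0 < eta by rewrite divr_gt0; lra.
have [r /= r0 hr] : exists2 r : R, 0 < r & forall y, ball x r y ->
    [/\ forall k, derivable g y (e_ k), `|partial i g y - A| < eta & `|partial j g y - B| < eta].
  have H1 : \near x, `|partial i g x - A| < eta.
    by have /cvgrPdist_lt/(_ _ eta0) := ci; apply: filterS => y; rewrite distrC.
  have H2 : \near x, `|partial j g x - B| < eta.
    by have /cvgrPdist_lt/(_ _ eta0) := cj; apply: filterS => y; rewrite distrC.
  have /nbhs_ballP[r r0 hr] : nbhs x [set y | [/\ forall k, derivable g y (e_ k),
      `|partial i g y - A| < eta & `|partial j g y - B| < eta]].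
    by apply: filterS3 dg H1 H2 => y.
  by exists r.
(* For [s < r / w] the two legs have total length at most [s * (|a| + |b|) < r], so both stay in the
   ball. *)
have rw0 : 0 < r / w by rewrite divr_gt0.
near=> s.
have s0 : 0 < s by near: s; exact: nbhs_right_gt.
have sr : s < r / w by near: s; exact: nbhs_right_lt.
have inball (t1 t2 : R) : `|t1| <= `|s * a| -> `|t2| <= `|s * b| ->
    ball x r (t2 *: e_ j + (t1 *: e_ i + x)).
  rewrite !normrM (gtr0_norm s0) => h1 h2; apply/ball_rowP => // k; rewrite !mxE.
  have hs : s * w < r by rewrite -ltr_pdivlMr.
  have hd (l : 'I_d) (t : R) : `|t * ((0 == 0 :> 'I_1) && (k == l))%:R| <= `|t|.
    by rewrite normrM ler_piMr//; case: (_ && _); rewrite ?normr1 ?normr0.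
  rewrite (_ : _ - _ = - (t2 * ((0 == 0 :> 'I_1) && (k == j))%:R + t1 * ((0 == 0 :> 'I_1) && (k == i))%:R)); last by ring.
  rewrite normrN; apply: (le_lt_trans (ler_normD _ _)).
  by apply: le_lt_trans hs; have := hd j t2; have := hd i t1; rewrite /w !mulrDr mulr1; lra.
have n0 : `|0 : R| <= `|s * b| by rewrite normr0.
have D1 (r' : R) : `|r'| <= `|s * a| -> derivable g (r' *: e_ i + x) (e_ i).
  by move=> hr'; have := inball r' 0 hr' n0; rewrite scale0r add0r => /hr[].
have D2 (r' : R) : `|r'| <= `|s * b| -> derivable g (r' *: e_ j + ((s * a) *: e_ i + x)) (e_ j).
  by move=> hr'; have /hr[] := inball (s * a) r' (lexx _) hr'.
have [t1 ht1 e1] := MVT_line D1.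
have [t2 ht2 e2] := MVT_line D2.
have E : s *: (a *: e_ i + b *: e_ j) + x = (s * b) *: e_ j + ((s * a) *: e_ i + x).
  by rewrite scalerDr !scalerA [RHS]addrA [X in X + x]addrC.
rewrite E -subr_lt0 -(subrKA (g ((s * a) *: e_ i + x))) e1 e2.
have := inball t1 0 ht1 n0; rewrite scale0r add0r => /hr[_ h1 _].
have /hr[_ _ h2] := inball (s * a) t2 (lexx _) ht2.
rewrite -/(partial j g _) -/(partial i g (t1 *: e_ i + x)).
set P := partial i g _ in h1 *; set Q := partial j g _ in h2 *.
rewrite (_ : _ + _ = s * (a * P + b * Q)); last by ring.
by rewrite pmulr_rlt0//; exact: (@descent_num a b A B).
Unshelve. all: by end_near. Qed.

Lemma defining_function_regular Om (x0 : V) (U : set V) (rho : V -> R) :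
  local_defining_function 1 Om x0 U rho -> forall x, U x ->
  [/\ {for x, continuous rho}, forall k, derivable rho x (e_ k) &
      forall k, {for x, continuous (partial k rho)}].
Proof.
move=> [oU _ [cr dr] _ _] x Ux.
have C (f : V -> R) : {within U, continuous f} -> {for x, continuous f}.
  by rewrite continuous_open_subspace// => /(_ x); apply; rewrite inE.
split; first exact: C.
  by move=> k; have [h _] := dr k; exact: h.
by move=> k; have [_ [h _]] := dr k; exact: C.
Qed.

Lemma defining_function_closure Om (x0 : V) (U : set V) (rho : V -> R) :
  local_defining_function 1 Om x0 U rho -> forall x, U x -> closure Om x -> rho x <= 0.
Proof.
move=> H x Ux cx; have [cr _ _] := defining_function_regular H Ux.
rewrite leNgt; apply/negP => r0.
have [oU _ _ _ OmE] := H.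
have N : nbhs x (U `&` [set y | 0 < rho y]).
  apply: filterI; first exact: open_nbhs_nbhs.
  exact: (@cvgr_gt R V (nbhs x) _ rho (rho x) cr 0 r0).
have [y [Oy [Uy /= ry]]] := cx _ N.
by have /(OmE y Uy) := Oy; rewrite ltNge (ltW ry).
Qed.

Lemma defining_function_bdry Om (x0 : V) (U : set V) (rho : V -> R) : open Om ->
  local_defining_function 1 Om x0 U rho -> forall x, U x -> closure Om x ->
  bdry Om x <-> rho x = 0.
Proof.
move=> oOm H x Ux cx; have [_ _ _ _ OmE] := H.
have -> : bdry Om x <-> ~ Om x.
  have OmI : Om° = Om := proj1 (interior_id Om) oOm.
  by split; [move=> [_]; rewrite OmI|move=> nO; split => //; rewrite OmI].
rewrite OmE//; have := defining_function_closure H Ux cx.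
rewrite le_eqVlt => /orP[/eqP ->|lt0]; first by rewrite ltxx; split.
by split => // e; rewrite e ltxx in lt0.
Qed.

(* Otherwise some direction in the (i, j)-plane would decrease rho1 and
   increase rho2, hence point both into and out of Om. *)
Lemma defining_functions_parallel Om (x : V) (x1 x2 : V) (U1 U2 : set V) (rho1 rho2 : V -> R) :
  open Om -> bdry Om x -> U1 x -> U2 x ->
  local_defining_function 1 Om x1 U1 rho1 -> local_defining_function 1 Om x2 U2 rho2 ->
  forall i j, partial i rho1 x * partial j rho2 x = partial j rho1 x * partial i rho2 x.
Proof.
move=> oOm bx Ux1 Ux2 H1 H2 i j.
have [cx _] := bx.
have r1 := (defining_function_bdry oOm H1 Ux1 cx).1 bx.
have r2 := (defining_function_bdry oOm H2 Ux2 cx).1 bx.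
have [c1 d1 p1] := defining_function_regular H1 Ux1.
have [c2 d2 p2] := defining_function_regular H2 Ux2.
have [oU1 _ _ _ E1] := H1; have [oU2 _ _ _ E2] := H2.
apply/eqP; rewrite -subr_eq0; apply/negP => /negP m0.
set A := partial i rho1 x in m0 *; set B := partial j rho1 x in m0 *.
set A' := partial i rho2 x in m0 *; set B' := partial j rho2 x in m0 *.
set m := A * B' - B * A' in m0.
have m2 : 0 < m ^+ 2 by rewrite exprn_even_gt0.
(* The direction is [m] times the quarter turn of the sum of the two gradients in the plane. Its
   product with the first gradient is [- m ^+ 2], with the second [m ^+ 2]. *)
pose a : R := - m * (B' + B); pose b := m * (A + A').
have L1 : a * A + b * B < 0.
  by rewrite (_ : _ + _ = - m ^+ 2) ?oppr_lt0// /a /b /m; ring.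
have pN k : \near x, - partial k rho2 x = partial k (fun y => - rho2 y) x.
  near=> y; rewrite /partial.
  have Uy : U2 y by near: y; exact: open_nbhs_nbhs.
  have [_ dy _] := defining_function_regular H2 Uy.
  by rewrite (deriveN (dy k)).
have L2 : a * partial i (fun y => - rho2 y) x + b * partial j (fun y => - rho2 y) x < 0.
  rewrite -!(nbhs_singleton (pN _)) -/A' -/B'.
  by rewrite (_ : _ + _ = - m ^+ 2) ?oppr_lt0// /a /b /m; ring.
have cN k : {for x, continuous (partial k (fun y => - rho2 y))}.
  apply: (near_eq_continuous_at (pN k)).
  exact: (@continuousN _ _ _ _ _ (p2 k)).
have N1 : \near x, forall k, derivable rho1 x (e_ k).
  near=> y; have Uy : U1 y by near: y; exact: open_nbhs_nbhs.
  by have [] := defining_function_regular H1 Uy.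
have N2 : \near x, forall k, derivable (fun y => - rho2 y) x (e_ k).
  near=> y => k; have Uy : U2 y by near: y; exact: open_nbhs_nbhs.
  have [_ dy _] := defining_function_regular H2 Uy.
  exact: (derivableN (dy k)).
have D1 := descent_direction N1 (p1 i) (p1 j) L1.
have D2 := descent_direction N2 (cN i) (cN j) L2.
pose v : V := a *: e_ i + b *: e_ j.
have cv : (s *: v + x) @[s --> 0^'+] --> x.
  have := @continuous_line R d x v 0; rewrite /continuous_at scale0r add0r.
  exact: cvg_at_right_filter.
have NU : \forall s \near 0^'+, (U1 `&` U2) (s *: v + x).
  have N : nbhs x (U1 `&` U2) by apply: open_nbhs_nbhs; split => //; exact: openI.
  exact: (cv _ N).
(* A single small [s] puts the point in both neighbourhoods with [rho1 < 0 < rho2]: inside [Om] by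
   the first function, outside by the second. *)
have [s [[/= s1 s2] [u1 u2]]] := filter_ex (filterI (filterI D1 D2) NU).
have O : Om (s *: v + x) by apply/(E1 _ u1); rewrite -r1.
have := (E2 _ u2).1 O; move: s2; rewrite -/v r2 oppr0 oppr_lt0 => ? ?; lra.
Unshelve. all: by end_near. Qed.

End defining_functions.

(** * Divergence theorem for tangential fields *)

Section admissible.
Context {R : realType} {d : nat}.
Local Notation V := 'rV[R]_d.
Implicit Types (Om : set V) (f g : V -> R).

(** The class of integrands on which linearity of the integral is used. It asks nothing at the
    boundary, so it also admits the cutoff fields, built from a [rho] that is regular only on
    [U]. *)
Definition cont_bounded Om f :=
  (forall x, Om x -> {for x, continuous f}) /\
  exists2 C : R, 0 <= C & forall x, Om x -> `|f x| <= C.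

Lemma cont_ext_cont_bounded Om f : open Om -> bounded_set Om -> cont_ext Om f ->
  cont_bounded Om f.
Proof.
by move=> oOm bOm cf; split; [exact: cont_ext_continuous|exact: cont_ext_bounded].
Qed.

Lemma cont_boundedD Om f g : cont_bounded Om f -> cont_bounded Om g ->
  cont_bounded Om (fun x => f x + g x).
Proof.
move=> [cf [C C0 hC]] [cg [D D0 hD]]; split.
  by move=> x Ox; apply: (@continuousD _ _ _ f g); [exact: cf|exact: cg].
exists (C + D); first exact: addr_ge0.
by move=> x Ox; rewrite (le_trans (ler_normD _ _))// lerD ?hC ?hD.
Qed.

Lemma cont_boundedM Om f g : cont_bounded Om f -> cont_bounded Om g ->
  cont_bounded Om (fun x => f x * g x).
Proof.
move=> [cf [C C0 hC]] [cg [D D0 hD]]; split.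
  by move=> x Ox; apply: (@continuousM _ _ f g); [exact: cf|exact: cg].
exists (C * D); first exact: mulr_ge0.
by move=> x Ox; rewrite normrM ler_pM ?hC ?hD.
Qed.

Lemma cont_bounded_cst Om (c : R) : cont_bounded Om (cst c).
Proof.
split; first by move=> x _; exact: cst_continuous.
by exists `|c|.
Qed.

Lemma cont_bounded_sum Om (I : Type) (r : seq I) (f : I -> V -> R) :
  (forall i, cont_bounded Om (f i)) -> cont_bounded Om (fun x => \sum_(i <- r) f i x).
Proof.
move=> H; elim: r => [|i r IH].
  by rewrite (_ : (fun x => _) = cst 0); [exact: cont_bounded_cst|apply/funext => x; rewrite big_nil].
by under eq_fun do rewrite big_cons; exact: cont_boundedD.
Qed.

Variable Om : set V.
Hypotheses (oOm : open Om) (bOm : bounded_set Om).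

Lemma cont_bounded_integrable f : cont_bounded Om f ->
  (lebesgue_tuple R d).-integrable (@row_of_tuple R d @^-1` Om)
    (EFin \o (f \o @row_of_tuple R d)).
Proof.
move=> [cf [C C0 hC]]; have [M M0 OmM] := bounded_set_bounded_by bOm.
exact: (space_integrable M0 oOm OmM cf hC).
Qed.

Lemma space_integralD f g : cont_bounded Om f -> cont_bounded Om g ->
  \int_(x in Om) (f x + g x) = \int_(x in Om) f x + \int_(x in Om) g x.
Proof.
move=> /cont_bounded_integrable cf /cont_bounded_integrable cg.
exact: (RintegralD (measurable_open_row oOm) cf cg).
Qed.

Lemma space_integralZ c f : cont_bounded Om f ->
  \int_(x in Om) (c * f x) = c * \int_(x in Om) f x.
Proof.
move=> /cont_bounded_integrable cf; exact: (RintegralZl _ (measurable_open_row oOm) cf).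
Qed.

Lemma space_integral_sum (I : Type) (r : seq I) (f : I -> V -> R) :
  (forall i, cont_bounded Om (f i)) ->
  \int_(x in Om) (\sum_(i <- r) f i x) = \sum_(i <- r) \int_(x in Om) f i x.
Proof.
move=> H; elim: r => [|i r IH].
  rewrite big_nil; under eq_fun do rewrite big_nil.
  by rewrite -[RHS](mul0r (\int_(x in Om) 0)) -space_integralZ; [congr space_integral; apply/funext => x; rewrite mul0r|exact: cont_bounded_cst].
rewrite big_cons -IH -space_integralD//; last exact: cont_bounded_sum.
by congr space_integral; apply/funext => x; rewrite big_cons.
Qed.

End admissible.

(** * Estimates for thin boundary layers *)

Section localization.
Context {R : realType} {d : nat}.
Local Notation V := 'rV[R]_d.
Local Notation e_ i := (delta_mx 0 i : V).

(** Around any point [s0] where [G] is nonzero, the interval of radius [l] contains all the others;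
    its length gives the factor [2 * l]. *)
Lemma norm_Rintegral_le_diam (G : measurableTypeR R -> R) (D l : R) : 0 <= D -> 0 <= l ->
  measurable_fun setT G -> (forall s, `|G s| <= D) ->
  (forall s s' : R, G s != 0 -> G s' != 0 -> `|s - s'| <= l) ->
  `|\int[lebesgue_measure]_s G s| <= D * (2 * l).
Proof.
move=> D0 l0 mG GD Gl.
have [[s0 Gs0]|N] := pselect (exists s, G s != 0); last first.
  rewrite (_ : G = cst 0); last first.
    by apply/funext => s; apply/eqP/negP => /negP h; apply: N; exists s.
  by rewrite Rintegral_cst// mul0r normr0 !mulr_ge0.
pose B : set (measurableTypeR R) := `[s0 - l, s0 + l]%classic.
have mB : (lebesgue_measure B <= (2 * l)%:E)%E.
  rewrite /B lebesgue_measure_itv/= lte_fin; case: ifPn => h.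
    by rewrite -EFinB lee_fin; lra.
  by rewrite lee_fin; lra.
apply: (norm_Rintegral_le_supported D0 _ mB mG GD); first exact: measurable_itv.
move=> s hs; apply/eqP/negP => /negP Gs; apply: hs => /=.
by rewrite /B/= in_itv/= -ler_distl distrC Gl.
Qed.

Definition cube (x0 : V) (r : R) : set V := [set x | `|x - x0| <= r].

Lemma cubeP x0 r x : 0 <= r -> cube x0 r x <-> forall j, `|x 0 j - x0 0 j| <= r.
Proof.
move=> r0; rewrite /cube/= [X in X <= r]/Num.Def.normr/= mx_normrE; split.
  by move=> /bigmax_leP[_ h] j; have := h (0, j) isT; rewrite !mxE.
by move=> h; apply/bigmax_leP; split => // -[i j] _; rewrite !mxE ord1; exact: h.
Qed.

Lemma closed_cube x0 r : closed (cube x0 r).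
Proof.
have c : continuous (fun x : V => `|x - x0|).
  move=> x; apply: (@continuous_comp _ _ _ (fun x : V => x - x0) (Num.norm : V -> R)).
    exact: (@cvgB R V V (nbhs x) _ id (cst x0) x x0 cvg_id (cvg_cst x0)).
  exact: norm_continuous.
apply: (@closed_comp _ _ (fun x : V => `|x - x0|) [set y | y <= r]); last exact: closed_le.
by move=> x _; exact: c.
Qed.

Lemma cvg_sum_seq (T I : Type) (F : set_system T) {FF : Filter F} (r : seq I)
    (f : I -> T -> R) (l : I -> R) :
  (forall i, f i y @[y --> F] --> l i) ->
  \sum_(i <- r) f i y @[y --> F] --> \sum_(i <- r) l i.
Proof.
move=> H; elim: r => [|i r IH].
  by rewrite big_nil; under eq_fun do rewrite big_nil; exact: cvg_cst.
by rewrite big_cons; under eq_fun do rewrite big_cons; exact: cvgD (H i) IH.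
Qed.

(** A compactness argument. On the closed part of the cube, [q = max (- rho) (eta - |w|)] is
    positive: where [rho = 0] the point is on the boundary and [w = 0]. The minimum of [q] is the
    required [e0], since [- rho < e0] forces the other entry of the maximum to be at least [e0]. *)
Lemma boundary_layer_small (Om : set V) (x1 x0 : V) (r : R) (U : set V) (rho : V -> R)
  (Z Zb : 'I_d -> V -> R) :
  open Om -> bounded_set Om -> local_defining_function 1 Om x1 U rho ->
  cube x0 r `<=` U ->
  (forall j, {within closure Om, continuous (Zb j)}) ->
  (forall j x, Om x -> Zb j x = Z j x) ->
  (forall a, cube x0 r a -> bdry Om a -> \sum_j partial j rho a * Zb j a = 0) ->
  forall eta, 0 < eta -> exists2 e0, 0 < e0 & forall x, Om x -> cube x0 r x -> - e0 < rho x ->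
    `|\sum_j partial j rho x * Z j x| <= eta.
Proof.
move=> oOm bOm Hr WU cZ ZbZ tang eta eta0.
pose K := closure Om `&` cube x0 r.
have cK : compact K.
  by apply: compact_closedI; [exact: compact_closure_bounded|exact: closed_cube].
pose w x := \sum_j partial j rho x * Zb j x.
pose q x := Num.max (- rho x) (eta - `|w x|).
have [[x2 Kx2]|K0] := pselect (K !=set0); last first.
  by exists 1 => // x Ox Wx _; exfalso; apply: K0; exists x; split => //; exact: subset_closure.
have sub x (f : V -> R) : {for x, continuous f} -> f y @[y --> within K (nbhs x)] --> f x.
  by move=> h; apply: cvg_trans h; apply: cvg_app; exact: cvg_within.
have c1 : {within K, continuous (fun x => - rho x)}.
  apply/subspace_continuousP => x [cx Wx].
  have [cr _ _] := defining_function_regular Hr (WU _ Wx).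
  by apply: cvgN; exact: sub.
have c2 : {within K, continuous (fun x => eta - `|w x|)}.
  apply/subspace_continuousP => x [cx Wx].
  have [_ _ cp] := defining_function_regular Hr (WU _ Wx).
  apply: cvgB; first exact: cvg_cst.
  apply: cvg_norm; apply: cvg_sum_seq => j.
  apply: cvgM; first by apply: sub; exact: cp.
  apply: cvg_trans (within_cvg (cZ j) cx); apply: cvg_app.
  move=> A wA; have {}wA : nbhs x (fun y => closure Om y -> A y) := wA.
  suff : nbhs x (fun y => K y -> A y) by [].
  by apply: filterS wA => y h [/h].
have cq : {within K, continuous q}.
  move=> x; exact: (@continuous_max _ _ (fun x : subspace K => - rho x) (fun x => eta - `|w x|) x (c1 x) (c2 x)).
have [c + hc] := compact_EVT_min (ex_intro _ x2 Kx2) cK cq.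
rewrite inE => -[cc Wc].
have qc : 0 < q c.
  rewrite /q lt_max; have := defining_function_closure Hr (WU _ Wc) cc.
  rewrite le_eqVlt => /orP[/eqP r0|]; last by rewrite oppr_gt0 => ->.
  have bc := (defining_function_bdry oOm Hr (WU _ Wc) cc).2 r0.
  by rewrite /w (tang _ Wc bc) normr0 subr0 eta0 orbT.
exists (q c) => // x Ox Wx rx.
have Kx : x \in K by rewrite inE; split => //; exact: subset_closure.
have := hc x Kx; rewrite {2}/q le_max => /orP[h|h].
  by move: rx; rewrite ltrNl ltNge h.
have -> : \sum_j partial j rho x * Z j x = w x by apply: eq_bigr => j _; rewrite ZbZ.
by move: (lt_le_trans qc h); rewrite subr_gt0 => /ltW.
Qed.

End localization.

(** * Cutting a field off near a piece of the boundary *)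

Section local_divergence.
Context {R : realType} {d : nat}.
Local Notation V := 'rV[R]_d.
Local Notation e_ i := (delta_mx 0 i : V).

Section boundary_cutoff.
Variables (Om : set V) (x1 x0 : V) (r : R) (U : set V) (rho : V -> R) (eps : R).
Variable (Z : 'I_d -> V -> R).
Hypotheses (oOm : open Om) (bOm : bounded_set Om) (r0 : 0 <= r).
Hypothesis Hr : local_defining_function 1 Om x1 U rho.
Hypothesis WU : cube x0 r `<=` U.
Hypothesis HZ : forall j, C1_ext Om (Z j).
Hypothesis Z0 : forall j x, Om x -> ~ cube x0 r x -> Z j x = 0.
Hypothesis eps0 : 0 < eps.

(** On [U] it is 0 where [rho >= - eps], in particular off [Om], and 1 where [rho <= - 2 * eps]. *)
Definition layer_step (x : V) : R := step (- rho x / eps).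
Definition layer_dstep (x : V) : R := dstep (- rho x / eps).
(** The product rule for [layer_step * Z j]. Off the cube, where [rho] may take arbitrary values,
    both terms vanish through [Z j]. *)
Definition cutoff_partial j (x : V) : R := layer_step x * partial j (Z j) x - layer_dstep x / eps * (partial j rho x * Z j x).

Let nearW x : ~ cube x0 r x -> \near x, ~ cube x0 r x.
Proof.
by move=> nW; apply: open_nbhs_nbhs; split => //; apply: closed_openC; exact: closed_cube.
Qed.

Let nearOm x : Om x -> \near x, Om x.
Proof. by move=> Ox; exact: open_nbhs_nbhs. Qed.

Lemma cutoff_zero_partial j k x : Om x -> ~ cube x0 r x -> partial k (Z j) x = 0.
Proof.
move=> Ox nW; rewrite /partial -(near_eq_derive (f := cst 0)) ?derive_cst//.
by apply: filterS2 (nearOm Ox) (nearW nW) => y Oy nWy; rewrite Z0.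
Qed.

Let th_derive j x : cube x0 r x ->
  is_derive x (e_ j) layer_step (layer_dstep x * (- partial j rho x / eps)).
Proof.
move=> Wx; have [_ dr _] := defining_function_regular Hr (WU Wx).
have h : is_derive x (e_ j) (fun y => - rho y / eps) (- partial j rho x / eps).
  have dj : is_derive x (e_ j) rho (partial j rho x) := derivableP (dr j).
  have := is_deriveZ (- eps^-1) dj.
  rewrite (_ : _ \*: _ = fun y => - rho y / eps).
    by move/is_derive_eq; apply; rewrite /GRing.scale/=; ring.
  by apply/funext => y; transitivity (- eps^-1 * rho y) => //; ring.
exact: (is_derive_comp1 (is_derive_step _) h).
Qed.

Let thZ_derive j x : Om x -> is_derive x (e_ j) (fun y => layer_step y * Z j y) (cutoff_partial j x).
Proof.
move=> Ox; have [Wx|nWx] := pselect (cube x0 r x).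
  have [_ dZ _] := HZ j.
  have dj : is_derive x (e_ j) (Z j) (partial j (Z j) x) := derivableP (dZ j x Ox).
  have := is_deriveM (th_derive j Wx) dj.
  move/is_derive_eq; apply; rewrite /cutoff_partial /GRing.scale/=; ring.
rewrite /cutoff_partial (cutoff_zero_partial _ _ Ox nWx) (Z0 _ Ox nWx) !mulr0 subr0.
apply: (near_eq_is_derive (f := cst 0)).
by apply: filterS2 (nearOm Ox) (nearW nWx) => y Oy nWy; rewrite Z0// mulr0.
Qed.

Let thZ_partial j x : Om x -> partial j (fun y => layer_step y * Z j y) x = cutoff_partial j x.
Proof. by move=> Ox; have [_] := thZ_derive j Ox. Qed.

Let cont_scaled_rho x : cube x0 r x -> {for x, continuous (fun y => - rho y / eps)}.
Proof.
move=> Wx; have [cr _ _] := defining_function_regular Hr (WU Wx).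
exact: (@continuousM R V (fun y => - rho y) (cst eps^-1) x
  (@continuousN _ _ _ _ _ cr) (@cst_continuous _ _ _ x)).
Qed.

Let cont_th x : cube x0 r x -> {for x, continuous layer_step} /\ {for x, continuous layer_dstep}.
Proof.
move=> Wx; split.
  apply: (@continuous_comp _ _ _ _ step); first exact: cont_scaled_rho.
  by apply/differentiable_continuous/derivable1_diffP; have [] := is_derive_step (- rho x / eps).
apply: (@continuous_comp _ _ _ _ dstep); first exact: cont_scaled_rho.
exact: continuous_dstep.
Qed.

Let P_cont j x : Om x -> {for x, continuous (cutoff_partial j)}.
Proof.
move=> Ox; have [Wx|nWx] := pselect (cube x0 r x).
  have [_ _ cr] := defining_function_regular Hr (WU Wx).
  have [Z1 _ Z2] := HZ j.
  have [c1 c2] := cont_th Wx.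
  have cZ := cont_ext_continuous oOm Z1 Ox.
  have cdZ := cont_ext_continuous oOm (Z2 j) Ox.
  exact: (@continuousB R R V (fun x => layer_step x * partial j (Z j) x)
    (fun x => layer_dstep x / eps * (partial j rho x * Z j x)) x (continuousM c1 cdZ)
    (continuousM (continuousM c2 (@cst_continuous _ _ eps^-1 x)) (continuousM (cr j) cZ))).
apply: (near_eq_continuous_at (f := cst 0)); last exact: cst_continuous.
apply: filterS2 (nearOm Ox) (nearW nWx) => y Oy nWy.
by rewrite /cutoff_partial (cutoff_zero_partial _ _ Oy nWy) (Z0 _ Oy nWy) !mulr0 subr0.
Qed.

(** This constant blows up as [eps] tends to 0; it serves only for integrability. The estimate that
    survives the limit is made in [local_divergence_boundary]. *)
Let P_bounded j : exists2 C : R, 0 <= C & forall x, Om x -> `|cutoff_partial j x| <= C.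
Proof.
have [Z1 _ Z2] := HZ j.
have [C1 C10 h1] := cont_ext_bounded bOm Z1.
have [C2 C20 h2] := cont_ext_bounded bOm (Z2 j).
have cW : compact (cube x0 r).
  apply: bounded_closed_compact; last exact: closed_cube.
  exists (`|x0| + r); split; first exact: num_real.
  move=> N hN x /= Wx; rewrite -(subrK x0 x) (le_trans (ler_normD _ _))//.
  by move: Wx; rewrite /cube/=; lra.
have cr : {within cube x0 r, continuous (partial j rho)}.
  apply: continuous_in_subspaceT => x; rewrite inE => Wx.
  by have [_ _ cr] := defining_function_regular Hr (WU Wx); exact: cr.
have /compact_bounded[C3 [_ h3]] := continuous_compact cr cW.
pose D := `|C3| + 1.
have D0 : 0 <= D by rewrite addr_ge0.
have hD x : cube x0 r x -> `|partial j rho x| <= D.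
  by move=> Wx; apply: h3; [rewrite /D; have := ler_norm C3; lra|exists x].
have B0 : 0 <= C2 + 2 / eps * (D * C1).
  apply: addr_ge0 => //; apply: mulr_ge0; last exact: mulr_ge0.
  by apply: divr_ge0; [lra|exact: ltW].
exists (C2 + 2 / eps * (D * C1)) => //.
move=> x Ox; have [Wx|nWx] := pselect (cube x0 r x); last first.
  by rewrite /cutoff_partial (cutoff_zero_partial _ _ Ox nWx) (Z0 _ Ox nWx) !mulr0 subr0 normr0.
rewrite /cutoff_partial; apply: (le_trans (ler_normB _ _)); apply: lerD.
  rewrite normrM -[leRHS]mul1r; apply: ler_pM => //; last exact: h2.
  by have /andP[a b] := step_bound (- rho x / eps); rewrite ger0_norm.
rewrite normrM; apply: ler_pM => //.
  rewrite normrM; apply: ler_pM => //.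
    by have /andP[a b] := dstep_bound (- rho x / eps); rewrite ger0_norm.
  by rewrite gtr0_norm// invr_gt0.
by rewrite normrM ler_pM// ?hD ?h1.
Qed.

Lemma cutoff_partial_integral j : \int_(x in Om) cutoff_partial j x = 0.
Proof.
have [M M0 OmM] := bounded_set_bounded_by bOm.
have [C C0 hC] := P_bounded j.
rewrite -(eq_space_integral (f := partial j (fun y => layer_step y * Z j y))); last first.
  by move=> x; exact: thZ_partial.
apply: (@space_integral_partial_eq0 _ _ Om
  (cube x0 r `&` [set x | rho x <= - eps]) M C) => //.
(* The sublevel set of [rho] alone need not be closed, as [rho] is continuous only on [U]; limit
   points are first placed in the closed cube, which lies in [U]. *)
- rewrite -(setIidl WU) -setIA => x cx.
  have Wx : cube x0 r x.
    by apply: closed_cube; apply: closure_subset cx; apply: subIsetl.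
  split => //; split; first exact: WU.
  have [cr _ _] := defining_function_regular Hr (WU Wx).
  rewrite /= leNgt; apply/negP => h.
  have N : nbhs x [set y | - eps < rho y] by exact: (@cvgr_gt R V (nbhs x) _ rho (rho x) cr _ h).
  have [y [[_ [_ /= y1]] /= y2]] := cx _ N.
  by move: y2; rewrite ltNge y1.
- move=> x [Wx /= rx]; have [_ _ _ _ E] := Hr; apply/(E x (WU Wx)).
  by rewrite (le_lt_trans rx)// oppr_lt0.
- by move=> x Ox; have [] := thZ_derive j Ox.
- move=> x Ox; apply: (near_eq_continuous_at (f := cutoff_partial j)); last exact: P_cont.
  by apply: filterS (nearOm Ox) => y Oy; rewrite thZ_partial.
- by move=> x Ox; rewrite thZ_partial// hC.
- move=> x Ox nK; have [Wx|nWx] := pselect (cube x0 r x); last by rewrite Z0// mulr0.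
  rewrite /layer_step step_le1 ?mul0r//.
  rewrite ler_pdivrMr// mul1r lerNl leNgt; apply/negP => h; apply: nK; split => //=.
  exact: ltW.
Qed.

Lemma cutoff_cont_bounded j : cont_bounded Om (cutoff_partial j).
Proof. by split; [move=> x; exact: P_cont|exact: P_bounded]. Qed.

End boundary_cutoff.
End local_divergence.

Section local_divergence_at_boundary.
Context {R : realType} {d : nat}.
Local Notation V := 'rV[R]_d.
Local Notation e_ i := (delta_mx 0 i : V).

(** The lower bound [c] on one partial derivative of [rho] makes the [i]-th axis transversal to the
    boundary: each line in that direction meets the layer of depth [2 * eps] within a set of
    diameter at most [2 * eps / c]. The error integrand may be as large as [eta / eps], but its
    slices are then only of order [eta]. *)
Lemma local_divergence_boundary (Om : set V) (x1 x0 : V) (r c : R) (U : set V) (rho : V -> R)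
  (i : 'I_d) (Z Zb : 'I_d -> V -> R) :
  open Om -> bounded_set Om -> 0 <= r -> local_defining_function 1 Om x1 U rho ->
  cube x0 r `<=` U -> 0 < c -> (forall x, cube x0 r x -> c <= `|partial i rho x|) ->
  (forall j, C1_ext Om (Z j)) ->
  (forall j x, Om x -> ~ cube x0 r x -> Z j x = 0) ->
  (forall j, {within closure Om, continuous (Zb j)}) ->
  (forall j x, Om x -> Zb j x = Z j x) ->
  (forall a, cube x0 r a -> bdry Om a -> \sum_j partial j rho a * Zb j a = 0) ->
  \int_(x in Om) \sum_j partial j (Z j) x = 0.
Proof.
move=> oOm bOm r0 Hr WU c0 hc HZ Z0 cZb ZbZ tang.
have [M M0 OmM] := bounded_set_bounded_by bOm.
have cdZ j : cont_bounded Om (partial j (Z j)).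
  by have [_ _ h] := HZ j; exact: cont_ext_cont_bounded.
have cdiv : cont_bounded Om (fun x => \sum_j partial j (Z j) x) by exact: cont_bounded_sum.
have [cc [C C0 hC]] := cdiv.
set I := space_integral _ _.
(* The slice bound is [D * (2 * (2 * eps / c))] with [D = C + 2 / eps * eta], that is
   [(4 * C * eps + 8 * eta) / c], and [eps <= eta]. *)
suff key : forall eta, 0 < eta -> `|I| <= ((4 * C + 8) / c * (2 * M) ^+ d.-1) * eta.
  set B := _ * _ ^+ _ in key.
  have B0 : 0 <= B.
    apply: mulr_ge0; last by apply: exprn_ge0; lra.
    by apply: divr_ge0; [lra|exact: ltW].
  apply/eqP; rewrite -normr_le0; apply/ler_addgt0Pl => e e0; rewrite addr0.
  have B1 : 0 < B + 1 by lra.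
  apply: (le_trans (key (e / (B + 1)) (divr_gt0 e0 B1))).
  rewrite mulrCA ger_pMr// ler_pdivrMr// mul1r; lra.
move=> eta eta0.
have [e0 e00 layer] := boundary_layer_small oOm bOm Hr WU cZb ZbZ tang eta0.
(* Below [eta] to absorb the term with [C]; below [e0 / 2] so that the layer of depth [2 * eps] lies
   where [boundary_layer_small] applies. *)
pose eps : R := Num.min eta (e0 / 2).
have eps0 : 0 < eps by rewrite lt_min eta0 divr_gt0.
have epse : eps <= eta by rewrite ge_min lexx.
have eps2 : 2 * eps <= e0.
  by have : eps <= e0 / 2 by [rewrite ge_min lexx orbT]; lra.
pose P j := cutoff_partial rho eps Z j.
have cP j : cont_bounded Om (P j).
  exact: (cutoff_cont_bounded oOm bOm Hr WU HZ Z0 eps0).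
have iP j : \int_(x in Om) P j x = 0.
  exact: (cutoff_partial_integral oOm bOm Hr WU HZ Z0 eps0).
pose g x := \sum_j partial j (Z j) x + (-1) * \sum_j P j x.
have cSP : cont_bounded Om (fun x => \sum_j P j x) by exact: cont_bounded_sum.
have cg : cont_bounded Om g.
  by apply: cont_boundedD => //; apply: cont_boundedM => //; exact: cont_bounded_cst.
have Ig : I = \int_(x in Om) g x.
  rewrite /g space_integralD//; last by apply: cont_boundedM => //; exact: cont_bounded_cst.
  rewrite space_integralZ// (space_integral_sum oOm bOm _ cP) [X in _ + _ * X]big1 ?mulr0 ?addr0//.
(* Both coefficients vanish once [- rho >= 2 * eps], which confines [g] to the layer. *)
have gE x : g x = (1 - step (- rho x / eps)) * \sum_j partial j (Z j) x
    + dstep (- rho x / eps) / eps * \sum_j partial j rho x * Z j x.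
  rewrite /g /P /cutoff_partial /layer_step /layer_dstep sumrB -!mulr_sumr; ring.
have g0 x : Om x -> g x != 0 -> cube x0 r x /\ - (2 * eps) < rho x < 0.
  move=> Ox gx; have Wx : cube x0 r x.
    apply: contrapT => nW; move/eqP: gx; apply.
    have z0 : \sum_j partial j rho x * Z j x = 0.
      by rewrite big1// => j _; rewrite Z0// mulr0.
    have dz0 : \sum_j partial j (Z j) x = 0.
      by rewrite big1// => j _; exact: (cutoff_zero_partial oOm Z0).
    by rewrite gE z0 dz0 !mulr0 addr0.
  split => //; have [_ _ _ _ E] := Hr; apply/andP; split; last exact/(E x (WU _ Wx)).
  rewrite ltNge; apply/negP => h; move/eqP: gx; apply.
  have h2 : 2 <= - rho x / eps by rewrite ler_pdivlMr//; lra.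
  by rewrite gE step_ge2// dstep_ge2// subrr !mul0r addr0.
pose D := C + 2 / eps * eta.
have D0 : 0 <= D.
  by apply: addr_ge0 => //; apply: mulr_ge0; [apply: divr_ge0; [lra|exact: ltW]|exact: ltW].
have gD x : Om x -> `|g x| <= D.
  move=> Ox; have [->|gx] := eqVneq (g x) 0; first by rewrite normr0.
  have [Wx /andP[rx1 rx2]] := g0 x Ox gx.
  rewrite gE; apply: (le_trans (ler_normD _ _)); apply: lerD.
    rewrite normrM -[leRHS]mul1r; apply: ler_pM => //; last exact: hC.
    have /andP[a b] := step_bound (- rho x / eps).
    by rewrite ger0_norm; lra.
  rewrite normrM; apply: ler_pM => //; last by apply: layer => //; lra.
  rewrite normrM; apply: ler_pM => //; last by rewrite gtr0_norm// invr_gt0.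
  by have /andP[a b] := dstep_bound (- rho x / eps); rewrite ger0_norm.
rewrite Ig; have l0 : 0 <= 2 * eps / c by apply: divr_ge0; lra.
apply: (le_trans (@space_integral_slice_bound _ _ _ _ M0 oOm OmM i D (D * (2 * (2 * eps / c))) g D0 _ cg.1 gD _)).
- by apply: mulr_ge0 => //; lra.
- move=> x; pose x2 : V := \row_k (if k == i then 0 else x 0 k).
  under eq_Rintegral do rewrite coord_lineE -/x2.
  pose L (s : R) : V := s *: e_ i + x2.
  have cL : continuous L by exact: continuous_line.
  pose oL : set R := L @^-1` Om.
  have ooL : open oL by apply: open_comp => // s _; exact: cL.
  apply: norm_Rintegral_le_diam => //.
  + rewrite (_ : (fun s => _) = (g \o L) \_ oL); last first.
      apply/funext => s; rewrite !patchE.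
      by rewrite (_ : (s \in oL) = (L s \in Om))//; apply/idP/idP; rewrite !inE.
    apply/(measurable_restrictT _ (open_measurable ooL)).
    apply: open_continuous_measurable_fun => // s; rewrite inE => Os.
    apply: continuous_comp; first exact: cL.
    exact: (cg.1 _ Os).
  + move=> s; rewrite patchE; case: ifPn => [|_]; rewrite ?normr0// inE; exact: gD.
  (* The cube is convex, so the whole segment between the two points stays in it. The mean value
     theorem then bounds [c * (s' - s)] by the variation of [rho], less than [2 * eps], even if the
     segment leaves [Om]. *)
  + have sub (s s' : R) : s <= s' -> (g \_ Om) (L s) != 0 -> (g \_ Om) (L s') != 0 ->
        s' - s <= 2 * eps / c.
      rewrite !patchE => ss'; case: ifPn => [|_]; rewrite ?eqxx// inE => Os gs.
      case: ifPn => [|_]; rewrite ?eqxx// inE => Os' gs'.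
      have [Ws /andP[rs1 rs2]] := g0 _ Os gs.
      have [Ws' /andP[rs1' rs2']] := g0 _ Os' gs'.
      have Lin t : t \in `[s, s'] -> cube x0 r (L t).
        rewrite in_itv/= => /andP[st ts']; apply/cubeP => // j.
        move/cubeP : Ws => /(_ r0 j); move/cubeP : Ws' => /(_ r0 j).
        rewrite /L !mxE; case: (eqVneq j i) => _; rewrite ?andbF ?eqxx/= ?mulr1 ?mulr0// !addr0 !ler_norml.
        by move=> /andP[? ?] /andP[? ?]; apply/andP; split; lra.
      have dL t : t \in `[s, s'] -> is_derive t 1 (rho \o L) (partial i rho (L t)).
        move=> ht; apply/(@is_derive_lineP R V rho x2 (e_ i) t).
        have [_ dr _] := defining_function_regular Hr (WU _ (Lin t ht)).
        exact: derivableP.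
      have cont : {within `[s, s'], continuous (rho \o L)}.
        by apply: derivable_within_continuous => t /dL[].
      have [t ht e] := MVT_segment ss' (fun t ht => dL t (subset_itv_oo_cc ht)) cont.
      have h1 := hc _ (Lin t ht).
      rewrite ler_pdivlMr// mulrC; apply: (@le_trans _ _ (`|partial i rho (L t)| * (s' - s))).
        by rewrite ler_wpM2r// subr_ge0.
      rewrite -[X in _ * X]ger0_norm ?subr_ge0// -normrM -e/= ler_norml; apply/andP; split; lra.
    move=> s s' gs gs'; have [ss'|ss'] := leP s s'.
      rewrite distrC ger0_norm ?subr_ge0//; exact: (sub s s' ss' gs gs').
    rewrite ger0_norm; last by rewrite subr_ge0 ltW.
    exact: (sub s' s (ltW ss') gs' gs).
rewrite [leRHS]mulrAC; apply: ler_wpM2r; first by apply: exprn_ge0; lra.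
have -> : D * (2 * (2 * eps / c)) = (4 * C * eps + 8 * eta) / c.
  by rewrite /D; field; rewrite !gt_eqF.
rewrite [leRHS]mulrAC; apply: ler_wpM2r; first by rewrite invr_ge0 ltW.
have : 4 * C * eps <= 4 * C * eta by apply: ler_wpM2l => //; lra.
rewrite mulrDl; lra.
Qed.

End local_divergence_at_boundary.

(** * From local to global by multiplying with holes *)

Section divergence_theorem.
Context {R : realType} {d : nat}.
Local Notation V := 'rV[R]_d.
Local Notation e_ i := (delta_mx 0 i : V).
Implicit Types (Om : set V).

(** Euclidean although the topology uses the sup norm, because a smooth function is needed. *)
Definition sq_dist (x0 y : V) : R := \sum_j (y 0 j - x0 0 j) ^+ 2.

Lemma is_derive_sq_dist (x0 y : V) k :
  is_derive y (e_ k) (sq_dist x0) (2 * (y 0 k - x0 0 k)).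
Proof.
have H j : is_derive y (e_ k) (fun z : V => (z 0 j - x0 0 j) ^+ 2)
    (2 * (y 0 j - x0 0 j) * (j == k)%:R).
  have yE : y = (0 : R) *: e_ k + y by rewrite scale0r add0r.
  have h : is_derive y (e_ k) (fun z : V => z 0 j - x0 0 j) (j == k)%:R.
    rewrite {1}yE; apply/is_derive_lineP.
    have := is_deriveD (is_deriveZ ((j == k)%:R : R) (is_derive_id (0:R) (1:R)))
      (is_derive_cst (y 0 j - x0 0 j) (0:R) (1:R)).
    rewrite (_ : _ + _ = fun s : R => (s *: e_ k + y) 0 j - x0 0 j).
      by move/is_derive_eq; apply; rewrite /GRing.scale/= mulr1 addr0.
    apply/funext => s; transitivity ((j == k)%:R * s + (y 0 j - x0 0 j)) => //.
    by rewrite !mxE eqxx/=; ring.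
  have := is_deriveX 2 h; move/is_derive_eq; apply.
  by rewrite /GRing.scale/= expr1 -mulr_natl; ring.
have := is_derive_sum H.
rewrite (_ : \sum_j _ = sq_dist x0); last by apply/funext => z; rewrite fct_sumE.
move/is_derive_eq; apply; rewrite (bigD1 k)//= eqxx mulr1 big1 ?addr0// => j /negbTE ->.
by rewrite mulr0.
Qed.

Lemma continuous_coordB (x0 : V) j : continuous (fun y : V => y 0 j - x0 0 j).
Proof.
move=> y; exact: (@cvgB R R V (nbhs y) _ (fun y : V => y 0 j) (cst (x0 0 j)) _ _
  (@coord_continuous R 1 d 0 j y) (cvg_cst _)).
Qed.

Lemma continuous_sq_dist (x0 : V) : continuous (sq_dist x0).
Proof.
move=> y; apply: (@cvg_sum_seq R V 'I_d (nbhs y) _ _ (fun j y => (y 0 j - x0 0 j) ^+ 2)) => j.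
exact: (@continuousM R V _ _ y (@continuous_coordB x0 j y) (@continuous_coordB x0 j y)).
Qed.

(** The scaling sends squared distance [r ^+ 2 / 2] to 1 and [r ^+ 2] to 2, the ends of the
    transition of [step]; outside the sup-norm cube the squared distance exceeds [r ^+ 2]. *)
Definition hole (x0 : V) (r : R) (y : V) : R := step (2 / r ^+ 2 * sq_dist x0 y).

Lemma is_derive_hole x0 r y k : is_derive y (e_ k) (hole x0 r)
  (dstep (2 / r ^+ 2 * sq_dist x0 y) * (2 / r ^+ 2 * (2 * (y 0 k - x0 0 k)))).
Proof.
exact: (is_derive_comp1 (is_derive_step _) (is_deriveZ (2 / r ^+ 2) (is_derive_sq_dist x0 y k))).
Qed.

Lemma continuous_scaled_sq_dist (x0 : V) (c : R) : continuous (fun y => c * sq_dist x0 y).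
Proof.
move=> y; exact: (@continuousM R V (cst c) (sq_dist x0) y (@cst_continuous _ _ c y)
  (@continuous_sq_dist x0 y)).
Qed.

Lemma continuous_hole x0 r : continuous (hole x0 r).
Proof.
have cs : continuous (@step R).
  by move=> s; apply/differentiable_continuous/derivable1_diffP; have [] := is_derive_step s.
move=> y; exact: (@continuous_comp V R R (fun y => 2 / r ^+ 2 * sq_dist x0 y) step y
  (@continuous_scaled_sq_dist x0 _ y) (cs _)).
Qed.

Lemma C1_ext_hole Om x0 r : C1_ext Om (hole x0 r).
Proof.
split; first exact/cont_extW/continuous_hole.
  by move=> i x _; have [] := is_derive_hole x0 r x i.
move=> k; apply: cont_extW.
rewrite (_ : partial k _ = fun y => dstep (2 / r ^+ 2 * sq_dist x0 y) * (2 / r ^+ 2 * (2 * (y 0 k - x0 0 k)))).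
  have c1 : continuous (fun y => dstep (2 / r ^+ 2 * sq_dist x0 y)).
    move=> y; exact: (@continuous_comp V R R (fun y => 2 / r ^+ 2 * sq_dist x0 y) dstep y
      (@continuous_scaled_sq_dist x0 _ y) (@continuous_dstep R _)).
  move=> y; exact: (@continuousM R V _ _ y (c1 y) (@continuousM R V (cst _) _ y
    (@cst_continuous _ _ _ y) (@continuousM R V (cst _) _ y (@cst_continuous _ _ _ y)
    (@continuous_coordB x0 k y)))).
by apply/funext => y; have [_] := is_derive_hole x0 r y k.
Qed.

Lemma hole_eq0 x0 r y : 0 < r -> sq_dist x0 y < r ^+ 2 / 2 -> hole x0 r y = 0.
Proof.
move=> r0 h; apply: step_le1; rewrite mulrAC ler_pdivrMr ?exprn_gt0//; lra.
Qed.

Lemma hole_eq1 x0 r y : 0 < r -> ~ cube x0 r y -> hole x0 r y = 1.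
Proof.
move=> r0 nW; apply: step_ge2; rewrite mulrAC ler_pdivlMr ?exprn_gt0// ler_wpM2l//.
have [j hj] : exists j, r < `|y 0 j - x0 0 j|.
  apply: contrapT => N; apply: nW; apply/cubeP; first exact: ltW.
  by move=> j; rewrite leNgt; apply/negP => h; apply: N; exists j.
rewrite /sq_dist (bigD1 j)//= -[leLHS]addr0; apply: lerD; last by apply: sumr_ge0 => l _; exact: sqr_ge0.
by rewrite -(real_normK (num_real (y 0 j - x0 0 j))) ler_sqr ?nnegrE ?normr_ge0 ?(ltW r0) ?(ltW hj).
Qed.

(** The normal is frozen at the boundary point while [X] varies, since [n] is meaningful only on the
    boundary. *)
Definition tangential_field Om (n : V -> V) (X : 'I_d -> V -> R) :=
  (forall j, C1_ext Om (X j)) /\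
  forall x, bdry Om x -> has_trace Om (fun y => \sum_j n x 0 j * X j y) x 0.

Lemma tangential_field_scale Om n c X : C1_ext Om c -> continuous c ->
  tangential_field Om n X -> tangential_field Om n (fun j y => c y * X j y).
Proof.
move=> Cc cc [CX tX]; split; first by move=> j; exact: C1_ext_M.
move=> x bx; rewrite /has_trace.
under eq_fun do under eq_bigr do rewrite mulrCA.
under eq_fun do rewrite -mulr_sumr.
have cx : c y @[y --> within Om (nbhs x)] --> c x.
  by apply: cvg_trans (cc x); apply: cvg_app; exact: cvg_within.
by have := cvgM cx (tX x bx); rewrite mulr0; apply.
Qed.

Lemma cube_in_nbhs (x0 : V) (A : set V) : nbhs x0 A -> exists2 r : R, 0 < r & cube x0 r `<=` A.
Proof.
move=> /nbhs_ballP[r /= r0 h]; exists (r / 2); first by rewrite divr_gt0.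
move=> x /cubeP hx; apply: h; apply/ball_rowP => // j.
by rewrite distrC (le_lt_trans (hx _ j)); lra.
Qed.

Lemma C1_ext_opp1 Om c : C1_ext Om c -> C1_ext Om (fun y => 1 - c y).
Proof.
move=> Hc; have C1 : forall a : R, C1_ext Om (cst a).
  move=> a; split; [exact: cont_ext_cst|by move=> i x _; exact: derivable_cst|].
  move=> i; rewrite (_ : partial i _ = cst 0); first exact: cont_ext_cst.
  by apply/funext => y; rewrite /partial derive_cst.
have := C1_ext_D (C1 1) (C1_ext_M (C1 (-1)) Hc); congr C1_ext.
by apply/funext => y; rewrite mulN1r.
Qed.

(** Uniqueness of limits gives [n . Xb = 0], hence orthogonality to the gradient of the function
    [rho'] that defines [n] at [a]. The gradient of the given [rho] is a multiple of it by
    [defining_functions_parallel], the ratio being read off a nonzero component [k]. *)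
Lemma normal_component_eq0 Om n (X Xb : 'I_d -> V -> R) (x1 a : V) (U : set V) (rho : V -> R) :
  open Om -> outward_unit_normal Om n -> tangential_field Om n X ->
  (forall j, {within closure Om, continuous (Xb j)}) ->
  (forall j x, Om x -> Xb j x = X j x) ->
  local_defining_function 1 Om x1 U rho -> U a -> bdry Om a ->
  \sum_j partial j rho a * Xb j a = 0.
Proof.
move=> oOm hn [CX tX] cXb XbX Hr Ua ba.
have [ca _] := ba.
have Fn : ProperFilter (within Om (nbhs a)) by exact: within_nbhs_proper.
have e0 : \sum_j n a 0 j * Xb j a = 0.
  have h : \sum_j n a 0 j * X j y @[y --> within Om (nbhs a)] --> \sum_j n a 0 j * Xb j a.
    apply: cvg_sum_seq => j; apply: cvgM; first exact: cvg_cst.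
    exact: (cont_ext_trace (cXb j) (XbX j) ca).
  exact: (cvg_unique _ h (tX a ba)).
have [U' [rho' [Hr' na]]] := hn a ba.
have [_ U'a _ /(_ a) g0 _] := Hr'.
have [k Bk] : exists k, partial k rho' a != 0.
  apply: contrapT => N; move/eqP: (g0 U'a); apply; apply/rowP => k; rewrite !mxE.
  by apply/eqP/negP => /negP h; apply: N; exists k.
have s0 : Num.sqrt (dotv (grad rho' a) (grad rho' a)) != 0.
  rewrite gt_eqF// sqrtr_gt0 /dotv (bigD1 k)//= !mxE; apply: ltr_pwDl.
    by rewrite -expr2 exprn_even_gt0.
  by apply: sumr_ge0 => l _; rewrite -expr2 sqr_ge0.
have e1 : \sum_j partial j rho' a * Xb j a = 0.
  move: e0; under eq_bigr do rewrite na !mxE -mulrA.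
  by rewrite -mulr_sumr => /eqP; rewrite mulf_eq0 invr_eq0 (negbTE s0)/= => /eqP.
have -> : \sum_j partial j rho a * Xb j a =
    partial k rho a / partial k rho' a * \sum_j partial j rho' a * Xb j a.
  rewrite mulr_sumr; apply: eq_bigr => j _.
  rewrite mulrA; apply: (congr1 ( *%R^~ (Xb j a))).
  have := defining_functions_parallel oOm ba Ua U'a Hr Hr' j k => h.
  by apply: (mulIf Bk); rewrite h mulrAC divfK.
by rewrite e1 mulr0.
Qed.

(** The removed part [(1 - hole) * X] lives in a small cube, either inside [Om] or around a boundary
    point. The radius is chosen before [X], so that the same one serves for the successively
    modified fields of the covering argument. *)
Lemma integral_divergence_hole Om n : open Om -> bounded_set Om ->
  outward_unit_normal Om n -> forall x0, closure Om x0 -> exists2 r : R, 0 < r &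
    forall X, tangential_field Om n X ->
      \int_(x in Om) \sum_j partial j (X j) x =
      \int_(x in Om) \sum_j partial j (fun y => hole x0 r y * X j y) x.
Proof.
move=> oOm bOm hn x0 cx0.
suff [r r0 H] : exists2 r : R, 0 < r & forall X, tangential_field Om n X ->
    \int_(x in Om) \sum_j partial j (fun y => (1 - hole x0 r y) * X j y) x = 0.
  exists r; [exact: r0|move=> X TX; have [CX _] := TX].
  have Ch := C1_ext_hole Om x0 r.
  have C1 j : C1_ext Om (fun y => (1 - hole x0 r y) * X j y).
    by apply: C1_ext_M => //; exact: C1_ext_opp1.
  have C2 j : C1_ext Om (fun y => hole x0 r y * X j y) by exact: C1_ext_M.
  have D1 : cont_bounded Om (fun x => \sum_j partial j (fun y => (1 - hole x0 r y) * X j y) x).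
    by apply: cont_bounded_sum => j; have [_ _ h] := C1 j; exact: cont_ext_cont_bounded.
  have D2 : cont_bounded Om (fun x => \sum_j partial j (fun y => hole x0 r y * X j y) x).
    by apply: cont_bounded_sum => j; have [_ _ h] := C2 j; exact: cont_ext_cont_bounded.
  have E := space_integralD oOm bOm D1 D2; rewrite (H X TX) add0r in E; rewrite -E.
  apply: eq_space_integral => x Ox; rewrite -big_split/=; apply: eq_bigr => j _.
  rewrite -(partialD j (C1 j) (C2 j) Ox); congr partial.
  by apply/funext => y; rewrite mulrBl mul1r subrK.
have Z0 r (X : 'I_d -> V -> R) j x : 0 < r -> ~ cube x0 r x -> (1 - hole x0 r x) * X j x = 0.
  by move=> r0 nW; rewrite hole_eq1// subrr mul0r.
have [Ox0|nOx0] := pselect (Om x0).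
  have [r r0 WO] := cube_in_nbhs (open_nbhs_nbhs (conj oOm Ox0)).
  exists r; [exact: r0|move=> X [CX _]].
  have C1 j : C1_ext Om (fun y => (1 - hole x0 r y) * X j y).
    by apply: C1_ext_M => //; apply: C1_ext_opp1; exact: C1_ext_hole.
  rewrite space_integral_sum//; last by move=> j; have [_ _ h] := C1 j; exact: cont_ext_cont_bounded.
  apply: big1 => j _; have [h1 h2 h3] := C1 j.
  have [M M0 OmM] := bounded_set_bounded_by bOm.
  have [c1 [C C0 hC]] := cont_ext_cont_bounded oOm bOm (h3 j).
  apply: (@space_integral_partial_eq0 _ _ Om (cube x0 r) M C) => //.
  - exact: closed_cube.
  - exact: h2.
  - by move=> x _; exact: (Z0 r X j x r0).
have bx0 : bdry Om x0 by split => // /interior_subset.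
have [U [rho [Hr _]]] := hn x0 bx0.
have [oU Ux0 _ /(_ x0 Ux0) g0 _] := Hr.
have [i Ai] : exists i, partial i rho x0 != 0.
  apply: contrapT => N; move/eqP: g0; apply; apply/rowP => k; rewrite !mxE.
  by apply/eqP/negP => /negP h; apply: N; exists k.
(* Half the value at [x0], so that the lower bound persists on a neighbourhood. *)
pose c : R := `|partial i rho x0| / 2.
have c0 : 0 < c by rewrite divr_gt0// normr_gt0.
have N : nbhs x0 [set y | U y /\ c < `|partial i rho y|].
  have [_ _ cp] := defining_function_regular Hr Ux0.
  apply: filterI; first exact: open_nbhs_nbhs.
  apply: (cvgr_norm_gt _ (cp i)).
  by rewrite /c; have : 0 < `|partial i rho x0| by [rewrite normr_gt0]; lra.
have [r r0 W] := cube_in_nbhs N.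
exists r; [exact: r0|move=> X TX; have [CX _] := TX].
have C1 j : C1_ext Om (fun y => (1 - hole x0 r y) * X j y).
  by apply: C1_ext_M => //; apply: C1_ext_opp1; exact: C1_ext_hole.
have /choice[Xb hXb] : forall j, exists G : V -> R, {within closure Om, continuous G} /\
    forall x, Om x -> G x = X j x by move=> j; have [] := CX j.
apply: (@local_divergence_boundary _ _ Om x0 x0 r c U rho i _ (fun j y => (1 - hole x0 r y) * Xb j y)) => //.
- exact: ltW.
- by move=> x /W[].
- by move=> x /W[_ /ltW].
- by move=> j x _; exact: (Z0 r X j x r0).
- move=> j; apply/subspace_continuousP => x cx; apply: cvgM.
    apply: cvgB; first exact: cvg_cst.
    by apply: cvg_trans (@continuous_hole x0 r x); apply: cvg_app; exact: cvg_within.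
  exact: (within_cvg (hXb j).1 cx).
- by move=> j x Ox; rewrite (hXb j).2.
- move=> a /W[Ua _] ba; under eq_bigr do rewrite mulrCA; rewrite -mulr_sumr.
  by rewrite (normal_component_eq0 oOm hn TX _ _ Hr Ua ba) ?mulr0// => j; have [] := hXb j.
Qed.

Lemma integral_divergence_eq0 Om (X : 'I_d -> V -> R) : open Om -> bounded_set Om ->
  (forall j y, Om y -> X j y = 0) -> \int_(x in Om) \sum_j partial j (X j) x = 0.
Proof.
move=> oOm bOm X0.
have dX j x : Om x -> partial j (X j) x = 0.
  move=> Ox; rewrite /partial -(near_eq_derive (f := cst 0)) ?derive_cst//.
  by apply: filterS (open_nbhs_nbhs (conj oOm Ox)) => y Oy; rewrite X0.
rewrite (@eq_space_integral _ _ _ _ (fun x => 0 * (cst 0 x))); last first.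
  by move=> x Ox; rewrite mul0r; apply: big1 => j _; exact: dX.
by rewrite (space_integralZ oOm bOm 0 (cont_bounded_cst Om (0:R))) mul0r.
Qed.

(** No partition of unity is normalized. Each point of the closure has a neighbourhood on which its
    hole vanishes; multiplying by the finitely many holes of a subcover never changes the integral
    and ends with the zero field. *)
Theorem integral_divergence_tangential Om n X : open Om -> bounded_set Om ->
  outward_unit_normal Om n -> tangential_field Om n X ->
  \int_(x in Om) \sum_j partial j (X j) x = 0.
Proof.
move=> oOm bOm hn TX.
have /choice[r hr] : forall x0, exists r : R, closure Om x0 -> 0 < r /\
    forall X, tangential_field Om n X ->
      \int_(x in Om) \sum_j partial j (X j) x =
      \int_(x in Om) \sum_j partial j (fun y => hole x0 r y * X j y) x.
  move=> x0; have [cx|ncx] := pselect (closure Om x0); last by exists 0.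
  by have [r r0 h] := integral_divergence_hole oOm bOm hn cx; exists r.
have := compact_closure_bounded bOm; rewrite compact_cover.
move=> /(_ V (closure Om) (fun x0 => [set y | sq_dist x0 y < r x0 ^+ 2 / 2])).
case.
- move=> x0 _; apply: (@open_comp _ _ (sq_dist x0) [set z | z < r x0 ^+ 2 / 2]).
    by move=> y _; exact: continuous_sq_dist.
  exact: open_lt.
- move=> x cx; exists x => //=; rewrite /sq_dist big1 ?divr_gt0 ?exprn_gt0//; first by have [] := hr x cx.
  by move=> j _; rewrite subrr expr0n.
move=> D DO cover.
(* The field stays tangential after each multiplication, so the next hole can be applied to it. *)
pose Y (s : seq V) := foldr (fun x0 (Z : 'I_d -> V -> R) j y => hole x0 (r x0) y * Z j y) X s.
have HY (s : seq V) : (forall x, x \in s -> closure Om x) -> tangential_field Om n (Y s) /\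
    \int_(x in Om) \sum_j partial j (X j) x = \int_(x in Om) \sum_j partial j (Y s j) x.
  elim: s => [//|x0 s IH] hs.
  have [TY IY] := IH (fun x hx => hs x (mem_behead (s := x0 :: s) hx)).
  split; first exact: (tangential_field_scale (C1_ext_hole Om x0 (r x0)) (@continuous_hole x0 (r x0)) TY).
  have [_ h] := hr x0 (hs x0 (mem_head _ _)).
  by apply: (etrans IY); exact: (h _ TY).
have Ds x : x \in (finmap.enum_fset D) -> closure Om x by move=> /DO /set_mem.
have [_ ->] := HY _ Ds.
have Y0 j y : Om y -> Y (finmap.enum_fset D) j y = 0.
  move=> Oy; have [x0 /= xD hy] := cover y (subset_closure Oy).
  have xs : x0 \in finmap.enum_fset D by [].
  have [rx _] := hr x0 (Ds _ xs).
  elim: (finmap.enum_fset D) xs => [//|x2 s IH]; rewrite inE => /predU1P[<-|xs] /=.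
    by rewrite hole_eq0// mul0r.
  by rewrite (IH xs) mulr0.
exact: integral_divergence_eq0.
Qed.

End divergence_theorem.

(** * Fields depending on time *)

Section time_fields.
Context {R : realType} {d : nat}.
Local Notation V := 'rV[R]_d.
Local Notation e_ i := (delta_mx 0 i : V).
Variables (Om : set V) (T : R).
Hypotheses (oOm : open Om) (bOm : bounded_set Om).
Implicit Types (f g : R -> V -> R).
Local Notation ext := (extends_continuously Om T).

Lemma ext_eq f g : (forall t x, 0 < t < T -> Om x -> f t x = g t x) -> ext f -> ext g.
Proof.
by move=> fg [G [cG Gf]]; exists G; split => // t x tT Ox; rewrite Gf// fg.
Qed.

Lemma ext_comp (psi : R -> R) f : continuous psi -> ext f -> ext (fun t x => psi (f t x)).
Proof.
move=> cpsi [G [cG Gf]]; exists (psi \o G); split; last by move=> t x tT Ox; rewrite /= Gf.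
apply/subspace_continuousP => z Kz.
apply: (@continuous_cvg _ _ _ _ _ _ psi); first exact: cpsi.
by move/subspace_continuousP : cG; apply.
Qed.

Lemma ext_cst (c : R) : ext (fun _ _ => c).
Proof. by exists (cst c); split => // z; exact: cst_continuous. Qed.

Lemma extD f g : ext f -> ext g -> ext (fun t x => f t x + g t x).
Proof.
move=> [F [cF Ff]] [G [cG Gg]]; exists (fun z => F z + G z); split.
  by move=> z; apply: cvgD; [exact: cF|exact: cG].
by move=> t x tT Ox; rewrite Ff// Gg.
Qed.

Lemma extM f g : ext f -> ext g -> ext (fun t x => f t x * g t x).
Proof.
move=> [F [cF Ff]] [G [cG Gg]]; exists (fun z => F z * G z); split.
  by move=> z; apply: cvgM; [exact: cF|exact: cG].
by move=> t x tT Ox; rewrite Ff// Gg.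
Qed.

Lemma ext_sum (I : Type) (r : seq I) (f : I -> R -> V -> R) :
  (forall i, ext (f i)) -> ext (fun t x => \sum_(i <- r) f i t x).
Proof.
move=> H; elim: r => [|i r IH].
  by apply: (ext_eq _ (ext_cst 0)) => t x _ _; rewrite big_nil.
by apply: (ext_eq _ (extD (H i) IH)) => t x _ _; rewrite big_cons.
Qed.

Lemma ext_cont_ext f t : ext f -> 0 < t < T -> cont_ext Om (f t).
Proof.
move=> [G [cG Gf]] tT; exists (fun x => G (t, x)); split; last by move=> x Ox; rewrite Gf.
apply/subspace_continuousP => x cx.
have /subspace_continuousP/(_ (t, x)) h := cG.
have it : `]0, T[%classic t by rewrite /= in_itv/=.
have {}h := h (conj it cx).
apply: cvg_trans h.
move=> A /= hA; have {}hA : nbhs (t, x) (fun z => (`]0, T[%classic `*` closure Om) z -> A (G z)) := hA.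
suff : nbhs x (fun y => closure Om y -> A (G (t, y))) by [].
have [[A1 A2] /= [h1 h2] h12] := hA.
apply: filterS h2 => y A2y Oy; apply: (h12 (t, y)) => //.
by split => //=; exact: nbhs_singleton.
Qed.

(** Extensions are continuous only over the open time interval, so compactness gives bounds on
    compact subintervals. *)
Lemma ext_bounded f a b : ext f -> 0 < a -> b < T ->
  exists2 C, 0 <= C & forall t x, a <= t <= b -> Om x -> `|f t x| <= C.
Proof.
move=> [G [cG Gf]] a0 bT.
pose K : set (R * V) := `[a, b]%classic `*` closure Om.
have sK : K `<=` `]0, T[%classic `*` closure Om.
  move=> [t x] [/=]; rewrite !in_itv/= => /andP[h1 h2] cx; split => //.
  by apply/andP; split; [exact: lt_le_trans h1|exact: le_lt_trans bT].
have cK : compact K by apply: compact_setX; [exact: segment_compact|exact: compact_closure_bounded].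
have cGK : {within K, continuous G} by exact: continuous_subspaceW sK cG.
have /compact_bounded[C [_ hC]] := continuous_compact cGK cK.
exists (`|C| + 1); first by rewrite addr_ge0.
move=> t x tab Ox; have tT : 0 < t < T.
  by move: tab => /andP[h1 h2]; apply/andP; split; lra.
rewrite -Gf//; apply: (hC (`|C| + 1)); first by have := ler_norm C; lra.
exists (t, x) => //; split => /=; [by rewrite in_itv|exact: subset_closure].
Qed.

Lemma ext_near f t x eta : ext f -> 0 < t < T -> Om x -> 0 < eta ->
  exists2 h, 0 < h & forall s y, `|s - t| <= h -> `|y - x| <= h ->
    [/\ 0 < s < T, Om y & `|f s y - f t x| <= eta].
Proof.
move=> [G [cG Gf]] tT Ox eta0.
pose U : set (R * V) := `]0, T[%classic `*` Om.
have oU : open U.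
  rewrite openE => -[s y] [/= hs hy]; exists (`]0, T[%classic, Om) => //=.
  by split; apply: open_nbhs_nbhs; split => //; exact: interval_open.
have sU : U `<=` `]0, T[%classic `*` closure Om.
  by move=> [s y] [hs hy]; split => //; exact: subset_closure.
have Utx : U (t, x) by split => //=; rewrite in_itv.
have cGU : {for (t, x), continuous G}.
  have := continuous_subspaceW sU cG; rewrite continuous_open_subspace// => /(_ (t, x)).
  by apply; rewrite inE.
have N : nbhs (t, x) [set z | U z /\ `|G z - G (t, x)| <= eta].
  apply: filterI; first exact: open_nbhs_nbhs.
  by have /cvgrPdist_le/(_ _ eta0) := cGU; apply: filterS => z; rewrite distrC.
have [[A B] /= [/nbhs_ballP[a /= a0 hA] /nbhs_ballP[b /= b0 hB]] AB] := N.
exists (Num.min a b / 2); first by rewrite divr_gt0// lt_min a0.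
move=> s y hs hy.
have m0 : Num.min a b / 2 < a.
  by have : Num.min a b <= a by [rewrite ge_min lexx]; have : 0 < Num.min a b by [rewrite lt_min a0]; lra.
have m1 : Num.min a b / 2 < b.
  by have : Num.min a b <= b by [rewrite ge_min lexx orbT]; have : 0 < Num.min a b by [rewrite lt_min a0]; lra.
have As : A s by apply: hA; rewrite -ball_normE/= distrC (le_lt_trans hs).
have By : B y by apply: hB; rewrite -ball_normE/= distrC (le_lt_trans hy).
have [[/= sT Oy] h] := AB (s, y) (conj As By).
rewrite in_itv/= in sT; split => //.
by rewrite -(Gf s y)// -(Gf t x).
Qed.

(** [Ck_up_to_boundary 1] unfolded into a flat list, the form in which closure under sums, products
    and compositions is proved. *)
Definition C1_field f := [/\ ext f,
  (forall i t x, 0 < t < T -> Om x -> derivable (f t) x (e_ i)),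
  (forall i, ext (fun t => partial i (f t))),
  (forall t x, 0 < t < T -> Om x -> derivable (f ^~ x) t 1) & ext (dt f)].

Lemma C1_field_slice f t : C1_field f -> 0 < t < T -> C1_ext Om (f t).
Proof.
move=> [f0 f1 f2 _ _] tT; split; first exact: ext_cont_ext.
  by move=> i x Ox; exact: f1.
by move=> i; exact: (ext_cont_ext (f2 i)).
Qed.

Lemma Ck1_C1_field f : Ck_up_to_boundary 1 Om T f -> C1_field f.
Proof.
move=> [f0 [f1 [f2 [f3 _]]]]; split; [exact: f0| | |exact: f2|exact: f3].
  by move=> i t x tT Ox; have [h _] := f1 i; exact: (h t x tT Ox).
by move=> i; have [_ [h _]] := f1 i; exact: h.
Qed.

Lemma Ck2_C1_field f : Ck_up_to_boundary 2 Om T f ->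
  [/\ C1_field f, forall i, C1_field (fun t => partial i (f t)) & C1_field (dt f)].
Proof.
move=> [f0 [f1 [f2 f3]]]; split; last exact: (Ck1_C1_field f3).
  have [f30 _] := f3; split; [exact: f0| | |exact: f2|exact: f30].
    by move=> i t x tT Ox; have [h _] := f1 i; exact: (h t x tT Ox).
  by move=> i; have [_ [h _]] := f1 i; exact: h.
by move=> i; have [_ h] := f1 i; exact: (Ck1_C1_field h).
Qed.

Lemma dt_is_derive f t x : derivable (f ^~ x) t 1 -> is_derive t 1 (f ^~ x) (dt f t x).
Proof. by move=> h; apply: DeriveDef => //; rewrite /dt derive1E. Qed.

Lemma dtD f g t x : C1_field f -> C1_field g -> 0 < t < T -> Om x ->
  dt (fun t x => f t x + g t x) t x = dt f t x + dt g t x.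
Proof.
move=> [_ _ _ f1 _] [_ _ _ g1 _] tT Ox; rewrite {1}/dt derive1E.
have df := dt_is_derive (f1 t x tT Ox); have dg := dt_is_derive (g1 t x tT Ox).
by have [_] := is_deriveD df dg.
Qed.

Lemma dtM f g t x : C1_field f -> C1_field g -> 0 < t < T -> Om x ->
  dt (fun t x => f t x * g t x) t x = f t x * dt g t x + g t x * dt f t x.
Proof.
move=> [_ _ _ f1 _] [_ _ _ g1 _] tT Ox; rewrite {1}/dt derive1E.
have df := dt_is_derive (f1 t x tT Ox); have dg := dt_is_derive (g1 t x tT Ox).
by have [_] := is_deriveM df dg.
Qed.

Lemma C1_fieldD f g : C1_field f -> C1_field g -> C1_field (fun t x => f t x + g t x).
Proof.
move=> Hf Hg; have [f0 f1 f2 f3 f4] := Hf; have [g0 g1 g2 g3 g4] := Hg; split.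
- exact: extD.
- by move=> i t x tT Ox; apply: derivableD; [exact: f1|exact: g1].
- move=> i; apply: (ext_eq _ (extD (f2 i) (g2 i))) => t x tT Ox.
  by rewrite (partialD _ (C1_field_slice Hf tT) (C1_field_slice Hg tT)).
- by move=> t x tT Ox; apply: derivableD; [exact: f3|exact: g3].
- by apply: (ext_eq _ (extD f4 g4)) => t x tT Ox; rewrite dtD.
Qed.

Lemma C1_fieldM f g : C1_field f -> C1_field g -> C1_field (fun t x => f t x * g t x).
Proof.
move=> Hf Hg; have [f0 f1 f2 f3 f4] := Hf; have [g0 g1 g2 g3 g4] := Hg; split.
- exact: extM.
- by move=> i t x tT Ox; apply: derivableM; [exact: f1|exact: g1].
- move=> i; apply: (ext_eq _ (extD (extM f0 (g2 i)) (extM g0 (f2 i)))) => t x tT Ox.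
  by rewrite (partialM _ (C1_field_slice Hf tT) (C1_field_slice Hg tT)).
- by move=> t x tT Ox; apply: derivableM; [exact: f3|exact: g3].
- by apply: (ext_eq _ (extD (extM f0 g4) (extM g0 f4))) => t x tT Ox; rewrite dtM.
Qed.

Lemma partial_cst i (c : R) (x : V) : partial i (fun _ : V => c) x = 0.
Proof. exact: derive_cst. Qed.

Lemma dt_cst (c t : R) (x : V) : dt (fun _ _ => c) t x = 0.
Proof. by rewrite /dt derive1_cst. Qed.

Lemma C1_field_cst (c : R) : C1_field (fun _ _ => c).
Proof.
split.
- exact: ext_cst.
- by move=> i t x _ _; exact: derivable_cst.
- by move=> i; apply: (ext_eq _ (ext_cst 0)) => t x _ _; rewrite partial_cst.
- by move=> t x _ _; exact: derivable_cst.
- by apply: (ext_eq _ (ext_cst 0)) => t x _ _; rewrite dt_cst.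
Qed.

Lemma C1_fieldZ (c : R) f : C1_field f -> C1_field (fun t x => c * f t x).
Proof. exact: (C1_fieldM (C1_field_cst c)). Qed.

Lemma C1_field_sum (I : Type) (r : seq I) (f : I -> R -> V -> R) :
  (forall i, C1_field (f i)) -> C1_field (fun t x => \sum_(i <- r) f i t x).
Proof.
move=> H; elim: r => [|i r IH].
  by under eq_fun do under eq_fun do rewrite big_nil; exact: C1_field_cst.
by under eq_fun do under eq_fun do rewrite big_cons; exact: C1_fieldD.
Qed.

Lemma partial_sum (I : Type) (r : seq I) (f : I -> R -> V -> R) t x j :
  (forall i, C1_field (f i)) -> 0 < t < T -> Om x ->
  partial j (fun x => \sum_(i <- r) f i t x) x = \sum_(i <- r) partial j (f i t) x.
Proof.
move=> H tT Ox; elim: r => [|i r IH].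
  by rewrite big_nil; under eq_fun do rewrite big_nil; exact: partial_cst.
rewrite big_cons -IH -(partialD _ (C1_field_slice (H i) tT) (C1_field_slice (C1_field_sum r H) tT))//.
by congr partial; apply/funext => y; rewrite big_cons.
Qed.

Lemma dt_sum (I : Type) (r : seq I) (f : I -> R -> V -> R) t x :
  (forall i, C1_field (f i)) -> 0 < t < T -> Om x ->
  dt (fun t x => \sum_(i <- r) f i t x) t x = \sum_(i <- r) dt (f i) t x.
Proof.
move=> H tT Ox; elim: r => [|i r IH].
  by rewrite big_nil; under eq_fun do under eq_fun do rewrite big_nil; exact: dt_cst.
rewrite big_cons -IH -(dtD (H i) (C1_field_sum r H))//.
by congr dt; apply/funext => s; apply/funext => y; rewrite big_cons.
Qed.

Section composition.
Variables (psi dpsi : R -> R).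
Hypothesis dpsiP : forall s : R, is_derive s 1 psi (dpsi s).
Hypothesis cdpsi : continuous dpsi.

Lemma partial_comp f i t x : C1_field f -> 0 < t < T -> Om x ->
  is_derive x (e_ i) (fun x => psi (f t x)) (dpsi (f t x) * partial i (f t) x).
Proof.
move=> [_ f1 _ _ _] tT Ox.
exact: (is_derive_comp1 (dpsiP _) (derivableP (f1 i t x tT Ox))).
Qed.

Lemma dt_comp f t x : C1_field f -> 0 < t < T -> Om x ->
  is_derive t 1 (fun t => psi (f t x)) (dpsi (f t x) * dt f t x).
Proof.
move=> [_ _ _ f1 _] tT Ox.
exact: (is_derive_comp1 (dpsiP _) (dt_is_derive (f1 t x tT Ox))).
Qed.

Lemma C1_field_comp f : C1_field f -> C1_field (fun t x => psi (f t x)).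
Proof.
move=> Hf; have [f0 f1 f2 f3 f4] := Hf.
have cpsi : continuous psi.
  by move=> s; apply/differentiable_continuous/derivable1_diffP; have [] := dpsiP s.
split.
- exact: ext_comp.
- by move=> i t x tT Ox; have [] := partial_comp i Hf tT Ox.
- move=> i; apply: (ext_eq _ (extM (ext_comp cdpsi f0) (f2 i))) => t x tT Ox.
  by have [_] := partial_comp i Hf tT Ox.
- by move=> t x tT Ox; have [] := dt_comp Hf tT Ox.
- apply: (ext_eq _ (extM (ext_comp cdpsi f0) f4)) => t x tT Ox.
  by rewrite {2}/dt derive1E; have [_] := dt_comp Hf tT Ox.
Qed.

End composition.

Lemma norm_scale_delta (r : R) (i : 'I_d) : `|r *: e_ i| <= `|r|.
Proof.
rewrite [leLHS]/Num.Def.normr/= mx_normrE; apply/bigmax_leP; split => // -[a b] _ /=.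
by rewrite !mxE normrM ler_piMr//; case: (_ && _); rewrite ?normr1 ?normr0.
Qed.

(** Schwarz's theorem in the plane of time and [e_ i]. Differentiating [|grad phi|^2] in time
    produces the time derivative of the gradient, while Green's identity tested with [lam * dt phi]
    produces the gradient of the time derivative. *)
Lemma partial_dtC f i t x : Ck_up_to_boundary 2 Om T f -> 0 < t < T -> Om x ->
  partial i (dt f t) x = dt (fun t => partial i (f t)) t x.
Proof.
move=> /Ck2_C1_field [H0 /(_ i) H1 H2] tT Ox.
have [f0 f1 f2 f3 f4] := H0; have [p0 p1 p2 p3 p4] := H1; have [q0 q1 q2 q3 q4] := H2.
have [e e0 he] := ext_near f0 tT Ox ltr01.
have dom (s r : R) : `|s| <= e -> `|r| <= e -> 0 < s *: 1 + t < T /\ Om (r *: e_ i + x).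
  move=> hs hr; have [] // := he (s *: 1 + t) (r *: e_ i + x).
    by rewrite addrK scaler1.
  by rewrite addrK (le_trans (norm_scale_delta _ _)).
have cont g : ext g -> forall eta, 0 < eta -> exists2 h, 0 < h & forall s r : R,
    `|s| <= h -> `|r| <= h -> `|g (s *: 1 + t) (r *: e_ i + x) - g t x| <= eta.
  move=> cg eta eta0; have [h h0 hh] := ext_near cg tT Ox eta0; exists h => // s r hs hr.
  have [] // := hh (s *: 1 + t) (r *: e_ i + x).
    by rewrite addrK scaler1.
  by rewrite addrK (le_trans (norm_scale_delta _ _)).
have := @mixed_derivatives_eq R
  (fun s r : R => f (s *: 1 + t) (r *: e_ i + x))
  (fun s r : R => dt f (s *: 1 + t) (r *: e_ i + x))
  (fun s r : R => partial i (f (s *: 1 + t)) (r *: e_ i + x))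
  (fun s r : R => partial i (dt f (s *: 1 + t)) (r *: e_ i + x))
  (fun s r : R => dt (fun t => partial i (f t)) (s *: 1 + t) (r *: e_ i + x)) e e0.
rewrite !scale0r !add0r; apply.
- move=> s r hs hr; have [sT Or] := dom s r (ltW hs) (ltW hr).
  apply/(@is_derive_lineP R R (fun u => f u (r *: e_ i + x)) t 1 s).
  exact: dt_is_derive (f3 _ _ sT Or).
- move=> s r hs hr; have [sT Or] := dom s r (ltW hs) (ltW hr).
  apply/(@is_derive_lineP R V (dt f (s *: 1 + t)) x (e_ i) r).
  exact: derivableP (q1 _ _ _ sT Or).
- move=> s r hs hr; have [sT Or] := dom s r (ltW hs) (ltW hr).
  apply/(@is_derive_lineP R V (f (s *: 1 + t)) x (e_ i) r).
  exact: derivableP (f1 _ _ _ sT Or).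
- move=> s r hs hr; have [sT Or] := dom s r (ltW hs) (ltW hr).
  apply/(@is_derive_lineP R R (fun u => partial i (f u) (r *: e_ i + x)) t 1 s).
  exact: (@dt_is_derive (fun t => partial i (f t)) _ _ (p3 _ _ sT Or)).
- exact: (cont (fun t => partial i (dt f t)) (q2 i)).
- exact: (cont (dt (fun t => partial i (f t))) p4).
Qed.

(** Symmetry of the Hessian, used to recognise half the gradient of [|grad phi|^2] in the capillary
    force. *)
Lemma partialC f i j t x : Ck_up_to_boundary 2 Om T f -> 0 < t < T -> Om x ->
  partial i (partial j (f t)) x = partial j (partial i (f t)) x.
Proof.
move=> /Ck2_C1_field [H0 H1 _] tT Ox.
have [f0 f1 f2 _ _] := H0; have [_ pj1 pj2 _ _] := H1 j; have [_ pi1 pi2 _ _] := H1 i.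
have [e e0 he] := ext_near f0 tT Ox ltr01.
have t0 h : 0 <= h -> `|t - t| <= h by rewrite subrr normr0.
have near_ (h s r : R) : `|s| <= h / 2 -> `|r| <= h / 2 -> `|s *: e_ j + (r *: e_ i + x) - x| <= h.
  move=> hs hr; rewrite addrA addrK (le_trans (ler_normD _ _))//.
  by have := norm_scale_delta s j; have := norm_scale_delta r i; lra.
have e20 : 0 < e / 2 by rewrite divr_gt0.
have dom (s r : R) : `|s| <= e / 2 -> `|r| <= e / 2 -> Om (s *: e_ j + (r *: e_ i + x)).
  by move=> hs hr; have [] // := he t (s *: e_ j + (r *: e_ i + x)) (t0 _ (ltW e0)) (near_ e s r hs hr).
have cont g : ext g -> forall eta, 0 < eta -> exists2 h, 0 < h & forall s r : R,
    `|s| <= h -> `|r| <= h ->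
    `|g t (s *: e_ j + (r *: e_ i + x)) - g t x| <= eta.
  move=> cg eta eta0; have [h h0 hh] := ext_near cg tT Ox eta0.
  exists (h / 2); first by rewrite divr_gt0.
  move=> s r hs hr.
  by have [] := hh t (s *: e_ j + (r *: e_ i + x)) (t0 _ (ltW h0)) (near_ h s r hs hr).
have := @mixed_derivatives_eq R
  (fun s r : R => f t (s *: e_ j + (r *: e_ i + x)))
  (fun s r : R => partial j (f t) (s *: e_ j + (r *: e_ i + x)))
  (fun s r : R => partial i (f t) (s *: e_ j + (r *: e_ i + x)))
  (fun s r : R => partial i (partial j (f t)) (s *: e_ j + (r *: e_ i + x)))
  (fun s r : R => partial j (partial i (f t)) (s *: e_ j + (r *: e_ i + x))) (e / 2) e20.
rewrite !scale0r !add0r; apply.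
- move=> s r hs hr; have Or := dom s r (ltW hs) (ltW hr).
  apply/(@is_derive_lineP R V (f t) (r *: e_ i + x) (e_ j) s).
  exact: derivableP (f1 _ _ _ tT Or).
(* Swapping the two increments exhibits the point on a line in direction [e_ i]. *)
- move=> s r hs hr; have := dom s r (ltW hs) (ltW hr); rewrite addrCA => Or.
  under eq_fun do rewrite addrCA.
  apply/(@is_derive_lineP R V (partial j (f t)) (s *: e_ j + x) (e_ i) r).
  exact: derivableP (pj1 _ _ _ tT Or).
- move=> s r hs hr; have := dom s r (ltW hs) (ltW hr); rewrite addrCA => Or.
  under eq_fun do rewrite addrCA.
  apply/(@is_derive_lineP R V (f t) (s *: e_ j + x) (e_ i) r).
  exact: derivableP (f1 _ _ _ tT Or).
- move=> s r hs hr; have Or := dom s r (ltW hs) (ltW hr).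
  apply/(@is_derive_lineP R V (partial i (f t)) (r *: e_ i + x) (e_ j) s).
  exact: derivableP (pi1 _ _ _ tT Or).
- exact: (cont (fun t => partial i (partial j (f t))) (pj2 i)).
- exact: (cont (fun t => partial j (partial i (f t))) (pi2 j)).
Qed.

(** On the window between [t / 2] and [(t + T) / 2], away from the ends of the time interval, [dt f]
    is bounded by a constant, which is integrable because [Om] is bounded. *)
Lemma derive_space_integral f t : C1_field f -> 0 < t < T ->
  derivable (fun t => \int_(x in Om) f t x) t 1 /\
  derive1 (fun t => \int_(x in Om) f t x) t = \int_(x in Om) dt f t x.
Proof.
move=> Hf tT; have [f0 f1 f2 f3 f4] := Hf; have /andP[t0 t1] := tT.
pose a := t / 2; pose b := (t + T) / 2.
have a0 : 0 < a by rewrite /a; lra.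
have bT : b < T by rewrite /b; lra.
have [C C0 hC] := ext_bounded f4 a0 bT.
have tab : `]a, b[%classic t by rewrite /= in_itv/= /a /b; apply/andP; split; lra.
have inT s : `]a, b[%classic s -> 0 < s < T /\ a <= s <= b.
  by rewrite /= in_itv/= => /andP[h1 h2]; split; apply/andP; split; lra.
pose F (s : R) (y : d.-tuple (measurableTypeR R)) := f s (row_of_tuple y).
have mOm := measurable_open_row oOm.
have I1 s : `]a, b[%classic s ->
    (lebesgue_tuple R d).-integrable (@row_of_tuple R d @^-1` Om) (EFin \o F s).
  move=> /inT[sT _].
  exact: (cont_bounded_integrable oOm bOm (cont_ext_cont_bounded oOm bOm (ext_cont_ext f0 sT))).
have I2 s y : `]a, b[%classic s -> (@row_of_tuple R d @^-1` Om) y -> derivable (F ^~ y) s 1.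
  by move=> /inT[sT _] Oy; exact: f3.
have I3 : (lebesgue_tuple R d).-integrable (@row_of_tuple R d @^-1` Om)
    (EFin \o (fun=> C)).
  exact: (cont_bounded_integrable oOm bOm (cont_bounded_cst Om C)).
have I4 s y : `]a, b[%classic s -> (@row_of_tuple R d @^-1` Om) y -> `|partial1of2 F s y| <= C.
  by move=> /inT[_ sab] Oy; exact: hC.
split.
  exact: (@derivable_under_integral _ _ _ (lebesgue_tuple R d) F _ mOm t a b tab I1 I2 (fun=> C) (fun=> C0) I3 I4).
exact: (@differentiation_under_integral _ _ _ (lebesgue_tuple R d) F _ mOm t a b tab I1 I2 (fun=> C) (fun=> C0) I3 I4).
Qed.

End time_fields.

(** * Energy balance *)

(** The energy balance at one point, with every derivative replaced by a free number. [f], [fd] and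
    [H] stand for the gradients of [phi] and of its time derivative and for the Hessian of [phi];
    [A] and [B] for viscous and elastic stress; [N], [dN] for [nu] and its derivative; [w1] for the
    derivative of the double well; [c] for the friction coefficient. On the right, the sums up to
    the one with [DFD] are divergences; what is subtracted is the dissipation and friction. *)
Lemma energy_balance_algebra (R : realFieldType) (d : nat)
  (u ut gp f fd mu1 D2mu DN DQ : 'I_d -> R) (Du A DA H B DB F Ft : 'I_d -> 'I_d -> R)
  (DF DFD : 'I_d -> 'I_d -> 'I_d -> R)
  (eta N dN w1 ft mu lam gam tau k c trE : R) :
  (forall i j, A i j = eta * Du i j) ->
  (forall i j, B i j = N * (\sum_l F i l * F j l - (i == j)%:R)) ->
  (forall i j, H i j = H j i) ->
  (forall i, ut i + \sum_j u j * Du i j + gp i - \sum_j DA i j =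
     - lam * \sum_j (f i * H j j + f j * H i j) + \sum_j DB i j - c * u i) ->
  \sum_i Du i i = 0 ->
  (forall i l, Ft i l - k * (N * \sum_j DFD i l j + 2 * \sum_j DN j * DF i l j)
     + \sum_j u j * DF i l j = \sum_m Du i m * F m l) ->
  ft + \sum_j u j * f j = tau * \sum_j D2mu j ->
  mu = - lam * \sum_j H j j + lam * gam * w1 + dN / 2 * trE ->
  (forall j, DQ j = - (\sum_i u i * Du i j + gp j + lam * \sum_i f i * H i j
     + (lam * gam * w1 * f j + (dN / 2 * trE * f j + N * \sum_i \sum_l F i l * DF i l j)))) ->
  \sum_i u i * ut i + lam * \sum_i f i * fd i + lam * gam * w1 * ft + dN / 2 * trE * ft
    + N * \sum_i \sum_l F i l * Ft i l
  = \sum_j u j * DQ j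
    + \sum_i \sum_j (u i * (DA i j + DB i j) + (A i j + B i j) * Du i j)
    + \sum_j (tau * mu * D2mu j + mu1 j * (tau * mu1 j))
    + \sum_j (lam * ft * H j j + f j * (lam * fd j))
    + \sum_i \sum_l \sum_j (k * (N ^+ 2 * F i l) * DFD i l j
        + DF i l j * (k * (N ^+ 2 * DF i l j + F i l * (2 * N * DN j))))
    - (eta * (\sum_i \sum_j Du i j * Du i j) + tau * \sum_j mu1 j * mu1 j)
    - k * (N ^+ 2 * (\sum_i \sum_l \sum_j DF i l j * DF i l j))
    - c * \sum_i u i * u i.
Proof.
move=> hA hB hH hu hdiv hF hphi hmu hQ.
pose S1 := \sum_i u i * \sum_j u j * Du i j.
pose S2 := \sum_i u i * gp i.
pose S3 := \sum_i u i * \sum_j DA i j.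
pose S4 := \sum_i u i * f i.
pose S5 := \sum_i u i * \sum_j f j * H i j.
pose S6 := \sum_i u i * \sum_j DB i j.
pose S7 := \sum_i u i * u i.
pose L := \sum_j H j j.
pose LF := \sum_i \sum_l F i l * \sum_j DFD i l j.
pose NF := \sum_i \sum_l F i l * \sum_j DN j * DF i l j.
pose UF := \sum_i \sum_l F i l * \sum_j u j * DF i l j.
pose GF := \sum_i \sum_l F i l * \sum_m Du i m * F m l.
have E1 : \sum_i u i * ut i = - S1 - S2 + S3 - lam * (S4 * L + S5) + S6 - c * S7.
  rewrite /S1 /S2 /S3 /S4 /S5 /S6 /S7 mulr_suml -big_split/= !mulr_sumr -!sumrN -!big_split/=.
  apply: eq_bigr => i _.
  have -> : ut i = - lam * \sum_j (f i * H j j + f j * H i j) + \sum_j DB i j - c * u i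
     - \sum_j u j * Du i j - gp i + \sum_j DA i j by rewrite -hu; ring.
  by rewrite big_split/= -mulr_sumr -/L; ring.
have E2 : \sum_j u j * DQ j = - (S1 + S2 + lam * S5
    + (lam * gam * w1 * S4 + (dN / 2 * trE * S4 + N * UF))).
  have -> : S1 = \sum_j u j * \sum_i u i * Du i j.
    rewrite /S1; under eq_bigr do rewrite mulr_sumr.
    rewrite exchange_big/=; apply: eq_bigr => j _; rewrite mulr_sumr.
    by apply: eq_bigr => i _; ring.
  have -> : UF = \sum_j u j * \sum_i \sum_l F i l * DF i l j.
    rewrite /UF; under [RHS]eq_bigr do rewrite mulr_sumr.
    rewrite [RHS]exchange_big/=; apply: eq_bigr => i _.
    under [RHS]eq_bigr do rewrite mulr_sumr.
    rewrite [RHS]exchange_big/=; apply: eq_bigr => l _; rewrite mulr_sumr.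
    by apply: eq_bigr => j _; ring.
  rewrite /S2 /S4 /S5.
  transitivity (\sum_j - (u j * (\sum_i u i * Du i j) + u j * gp j + lam * (u j * \sum_i f i * H j i)
    + (lam * gam * w1 * (u j * f j) + (dN / 2 * trE * (u j * f j)
    + N * (u j * \sum_i \sum_l F i l * DF i l j))))).
    apply: eq_bigr => j _; rewrite hQ.
    (* The gradient inside [DQ] and the capillary force in [S5] contract the Hessian on different
       indices. *)
    have -> : \sum_i f i * H i j = \sum_i f i * H j i by apply: eq_bigr => i _; rewrite hH.
    ring.
  by rewrite sumrN !big_split/= -!mulr_sumr.
have E3 : \sum_i \sum_j (u i * (DA i j + DB i j) + (A i j + B i j) * Du i j) =
    S3 + S6 + eta * (\sum_i \sum_j Du i j * Du i j) + N * GF.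
  (* The power of the elastic stress equals the stretching term of the [F]-equation: the identity
     part of the stress contributes [- N * div u = 0]. *)
  have -> : N * GF = \sum_i \sum_j B i j * Du i j.
    have -> : \sum_i \sum_j B i j * Du i j =
        \sum_i \sum_j N * (\sum_l F i l * F j l) * Du i j - N * \sum_i Du i i.
      rewrite mulr_sumr -sumrB; apply: eq_bigr => i _.
      under eq_bigr do rewrite hB mulrBr mulrBl.
      rewrite sumrB; congr (_ - _).
      rewrite (bigD1 i)//= eqxx mulr1 big1 ?addr0// => j /negbTE ji.
      by rewrite eq_sym ji mulr0 mul0r.
    rewrite hdiv mulr0 subr0 /GF mulr_sumr; apply: eq_bigr => i _.
    rewrite mulr_sumr; under [RHS]eq_bigr do rewrite mulr_sumr mulr_suml.
    rewrite [RHS]exchange_big/=; apply: eq_bigr => l _; rewrite !mulr_sumr.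
    by apply: eq_bigr => m _; ring.
  rewrite /S3 /S6 mulr_sumr -!big_split/=; apply: eq_bigr => i _.
  rewrite !mulr_sumr -!big_split/=; apply: eq_bigr => j _.
  by rewrite hA; ring.
have E4 : \sum_j (tau * mu * D2mu j + mu1 j * (tau * mu1 j)) =
    mu * (tau * \sum_j D2mu j) + tau * \sum_j mu1 j * mu1 j.
  by rewrite !mulr_sumr -big_split/=; apply: eq_bigr => j _; ring.
have E5 : \sum_j (lam * ft * H j j + f j * (lam * fd j)) = lam * ft * L + lam * \sum_j f j * fd j.
  by rewrite !mulr_sumr -big_split/=; apply: eq_bigr => j _; ring.
have E6 : \sum_i \sum_l \sum_j (k * (N ^+ 2 * F i l) * DFD i l j
        + DF i l j * (k * (N ^+ 2 * DF i l j + F i l * (2 * N * DN j)))) =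
    k * N ^+ 2 * LF + k * (N ^+ 2 * (\sum_i \sum_l \sum_j DF i l j * DF i l j)) + 2 * k * N * NF.
  rewrite /LF /NF !mulr_sumr -!big_split/=; apply: eq_bigr => i _.
  rewrite !mulr_sumr -!big_split/=; apply: eq_bigr => l _.
  rewrite !mulr_sumr -!big_split/=; apply: eq_bigr => j _; ring.
have E7 : \sum_i \sum_l F i l * Ft i l = k * (N * LF + 2 * NF) - UF + GF.
  rewrite /LF /NF /UF /GF !mulr_sumr -!big_split/= mulr_sumr -sumrN -!big_split/=.
  apply: eq_bigr => i _.
  rewrite !mulr_sumr -!big_split/= mulr_sumr -sumrN -!big_split/=; apply: eq_bigr => l _.
  rewrite -hF; ring.
have hft : ft = tau * \sum_j D2mu j - S4 by rewrite -hphi addrK.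
(* The chemical potential absorbs both potential terms, in the time derivative and in the transport
   term; with [hft] all products with [u . grad phi] then cancel. *)
have hw : lam * gam * w1 + dN / 2 * trE = mu + lam * L by rewrite hmu -/L; ring.
rewrite E1 E2 E3 E4 E5 E6 E7 -/S7.
rewrite (_ : - S1 - S2 + S3 - lam * (S4 * L + S5) + S6 - c * S7 + lam * (\sum_i f i * fd i)
  + lam * gam * w1 * ft + dN / 2 * trE * ft =
  - S1 - S2 + S3 - lam * (S4 * L + S5) + S6 - c * S7 + lam * (\sum_i f i * fd i)
  + (lam * gam * w1 + dN / 2 * trE) * ft); last by ring.
rewrite (_ : lam * gam * w1 * S4 + (dN / 2 * trE * S4 + N * UF) =
  (lam * gam * w1 + dN / 2 * trE) * S4 + N * UF); last by ring.
by rewrite hw hft; ring.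
Qed.

(** * Integrals that vanish by the boundary conditions *)

Section integral_identities.
Context {R : realType} {d : nat}.
Local Notation V := 'rV[R]_d.
Local Notation e_ i := (delta_mx 0 i : V).
Variables (Om : set V) (n : V -> V).
Hypotheses (oOm : open Om) (bOm : bounded_set Om) (hn : outward_unit_normal Om n).

Lemma has_trace_mul0 (q f : V -> R) x : bdry Om x -> cont_ext Om q -> has_trace Om f x 0 ->
  has_trace Om (fun y => q y * f y) x 0.
Proof.
move=> [cx _] [G [cG Gq]] hf; have := cvgM (cont_ext_trace cG Gq cx) hf.
by rewrite mulr0; apply.
Qed.

Lemma has_trace_sum0 (I : Type) (r : seq I) (f : I -> V -> R) x :
  (forall i, has_trace Om (f i) x 0) -> has_trace Om (fun y => \sum_(i <- r) f i y) x 0.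
Proof.
move=> H; rewrite /has_trace.
have := @cvg_sum_seq R V I (within Om (nbhs x)) _ r f (fun=> 0) H.
by rewrite big1//; apply.
Qed.

(** For solenoidal [u] the integrand is the divergence of [q * u], which has zero trace. *)
Lemma integral_transport (u : 'I_d -> V -> R) (q : V -> R) :
  (forall i, C1_ext Om (u i)) -> (forall i x, bdry Om x -> has_trace Om (u i) x 0) ->
  (forall x, Om x -> \sum_i partial i (u i) x = 0) -> C1_ext Om q ->
  \int_(x in Om) \sum_j u j x * partial j q x = 0.
Proof.
move=> Cu u0 divu Cq.
have TX : tangential_field Om n (fun j y => q y * u j y).
  split; first by move=> j; exact: C1_ext_M.
  move=> x bx; apply: has_trace_sum0 => j.
  apply: has_trace_mul0 => //; first exact: cont_ext_cst.
  by apply: has_trace_mul0 => //; [have [] := Cq|exact: u0].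
rewrite -[RHS](integral_divergence_tangential oOm bOm hn TX).
apply: eq_space_integral => x Ox.
under [RHS]eq_bigr => j _ do rewrite (partialM _ Cq (Cu j) Ox).
by rewrite big_split/= -mulr_sumr divu// mulr0 add0r.
Qed.

(** For each [i] the field is [u i] times the [i]-th row of the stress, tangential because [u i]
    vanishes on the boundary. *)
Lemma integral_work (u : 'I_d -> V -> R) (G : 'I_d -> 'I_d -> V -> R) :
  (forall i, C1_ext Om (u i)) -> (forall i x, bdry Om x -> has_trace Om (u i) x 0) ->
  (forall i j, C1_ext Om (G i j)) ->
  \int_(x in Om) \sum_i \sum_j (u i x * partial j (G i j) x + G i j x * partial j (u i) x) = 0.
Proof.
move=> Cu u0 CG.
have Ti i : tangential_field Om n (fun j y => u i y * G i j y).
  split; first by move=> j; exact: C1_ext_M.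
  move=> x bx; apply: has_trace_sum0 => j.
  apply: has_trace_mul0 => //; first exact: cont_ext_cst.
  rewrite (_ : (fun y => _) = fun y => G i j y * u i y); last by apply/funext => y; rewrite mulrC.
  by apply: has_trace_mul0 => //; [have [] := CG i j|exact: u0].
have cb i j : cont_bounded Om (fun x => u i x * partial j (G i j) x + G i j x * partial j (u i) x).
  have [u1 _ u2] := Cu i; have [G1 _ G2] := CG i j.
  by apply: cont_ext_cont_bounded => //; apply: cont_extD; exact: cont_extM.
rewrite space_integral_sum//; last by move=> i; exact: cont_bounded_sum.
apply: big1 => i _; rewrite -[RHS](integral_divergence_tangential oOm bOm hn (Ti i)).
apply: eq_space_integral => x Ox; apply: eq_bigr => j _.
by rewrite (partialM _ (Cu i) (CG i j) Ox).
Qed.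

(** The field is [q * grad g]; the Neumann condition on [g] makes it tangential. *)
Lemma integral_green (q g : V -> R) :
  C1_ext Om q -> (forall j, C1_ext Om (partial j g)) ->
  (forall x, bdry Om x -> has_normal_derivative Om n g x 0) ->
  \int_(x in Om) \sum_j (q x * partial j (partial j g) x + partial j g x * partial j q x) = 0.
Proof.
move=> Cq Cg g0.
have TX : tangential_field Om n (fun j y => q y * partial j g y).
  split; first by move=> j; exact: C1_ext_M.
  move=> x bx.
  rewrite (_ : (fun y => _) = fun y => q y * dotv (n x) (grad g y)).
    by apply: has_trace_mul0 => //; [have [] := Cq|exact: g0].
  apply/funext => y; rewrite /dotv mulr_sumr; apply: eq_bigr => j _.
  by rewrite mxE mulrCA.
rewrite -[RHS](integral_divergence_tangential oOm bOm hn TX).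
apply: eq_space_integral => x Ox; apply: eq_bigr => j _.
by rewrite (partialM _ Cq (Cg j) Ox).
Qed.

End integral_identities.

(** * Calculus rules for fields at an interior point *)

Section field_identities.
Context {R : realType} {d : nat}.
Local Notation V := 'rV[R]_d.
Variables (Om : set V) (T : R).
Implicit Types (f g : R -> V -> R).
Local Notation ext := (extends_continuously Om T).
Local Notation C1 := (C1_field Om T).

Lemma C1_field_ext f : C1 f -> ext f.
Proof. by case. Qed.

Lemma C1_field_ext_partial f i : C1 f -> ext (fun t => partial i (f t)).
Proof. by case. Qed.

Variables (t : R) (x : V).
Hypotheses (tT : 0 < t < T) (Ox : Om x).

Lemma field_partialD f g j : C1 f -> C1 g ->
  partial j (fun x => f t x + g t x) x = partial j (f t) x + partial j (g t) x.
Proof. by move=> Hf Hg; rewrite (partialD _ (C1_field_slice Hf tT) (C1_field_slice Hg tT)). Qed.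

Lemma field_partialM f g j : C1 f -> C1 g ->
  partial j (fun x => f t x * g t x) x = f t x * partial j (g t) x + g t x * partial j (f t) x.
Proof. by move=> Hf Hg; rewrite (partialM _ (C1_field_slice Hf tT) (C1_field_slice Hg tT)). Qed.

Lemma field_partialZ c f j : C1 f -> partial j (fun x => c * f t x) x = c * partial j (f t) x.
Proof.
move=> Hf; rewrite (field_partialM j (C1_field_cst Om T c) Hf).
by rewrite partial_cst mulr0 addr0.
Qed.

Lemma field_dtZ c f : C1 f -> dt (fun t x => c * f t x) t x = c * dt f t x.
Proof.
by move=> Hf; rewrite (dtM (C1_field_cst Om T c) Hf tT Ox) dt_cst mulr0 addr0.
Qed.

Lemma field_partial_sqsum (I : Type) (r : seq I) (f : I -> R -> V -> R) j : (forall i, C1 (f i)) ->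
  partial j (fun x => \sum_(i <- r) f i t x * f i t x) x =
  2 * \sum_(i <- r) f i t x * partial j (f i t) x.
Proof.
move=> H; rewrite (partial_sum r j (fun i => C1_fieldM (H i) (H i)) tT Ox).
rewrite mulr_sumr; apply: eq_bigr => i _; rewrite (field_partialM j (H i) (H i)); ring.
Qed.

Lemma field_dt_sqsum (I : Type) (r : seq I) (f : I -> R -> V -> R) : (forall i, C1 (f i)) ->
  dt (fun t x => \sum_(i <- r) f i t x * f i t x) t x = 2 * \sum_(i <- r) f i t x * dt (f i) t x.
Proof.
move=> H; rewrite (dt_sum r (fun i => C1_fieldM (H i) (H i)) tT Ox).
rewrite mulr_sumr; apply: eq_bigr => i _; rewrite (dtM (H i) (H i) tT Ox); ring.
Qed.

Lemma field_partial_comp (psi : R -> R) f j : (forall s : R, derivable psi s 1) -> C1 f ->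
  partial j (fun x => psi (f t x)) x = derive1 psi (f t x) * partial j (f t) x.
Proof.
move=> dpsi Hf; have H (s : R) : is_derive s 1 psi (derive1 psi s).
  by apply: DeriveDef => //; rewrite derive1E.
by have [_] := partial_comp H j Hf tT Ox.
Qed.

Lemma field_dt_comp (psi : R -> R) f : (forall s : R, derivable psi s 1) -> C1 f ->
  dt (fun t x => psi (f t x)) t x = derive1 psi (f t x) * dt f t x.
Proof.
move=> dpsi Hf; have H (s : R) : is_derive s 1 psi (derive1 psi s).
  by apply: DeriveDef => //; rewrite derive1E.
by rewrite {1}/dt derive1E; have [_] := dt_comp H Hf tT Ox.
Qed.

End field_identities.

Lemma field_comp_C1 {R : realType} {d : nat} (Om : set 'rV[R]_d) (T : R) (psi : R -> R)
  (f : R -> 'rV[R]_d -> R) : (forall s : R, derivable psi s 1) -> continuous (derive1 psi) ->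
  C1_field Om T f -> C1_field Om T (fun t x => psi (f t x)).
Proof.
move=> dpsi cpsi; apply: (@C1_field_comp _ _ _ _ psi (derive1 psi)) => // s.
by apply: DeriveDef => //; rewrite derive1E.
Qed.

Lemma Ck_real1P {R : realType} (g : R -> R) : Ck_real 1 g ->
  (forall s : R, derivable g s 1) /\ continuous (derive1 g).
Proof. by move=> [h1 h2]; split; [exact: (h1 0%N isT)|exact: h2]. Qed.

Lemma Ck_real3P {R : realType} (g : R -> R) : Ck_real 3 g ->
  (forall s : R, derivable g s 1) /\ continuous (derive1 g).
Proof.
move=> [h1 _]; split; first exact: (h1 0%N isT).
by move=> s; apply/differentiable_continuous/derivable1_diffP; exact: (h1 1%N isT).
Qed.

Lemma double_wellP {R : realType} (h : R) :
  (forall s : R, derivable (double_well h) s 1) /\ continuous (derive1 (double_well h)).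
Proof.
pose p : {poly R} := (4 * h ^+ 2)^-1 *: (('X - 1%:P) ^+ 2 * 'X ^+ 2).
have -> : double_well h = horner p.
  apply/funext => s; rewrite /p /double_well hornerZ hornerM !horner_exp hornerX.
  by rewrite hornerD hornerN hornerC hornerX mulrC.
split; first exact: derivable_horner.
by rewrite -derivE; exact: continuous_horner.
Qed.

Lemma dotv_grad {R : realType} {d : nat} (f g : 'rV[R]_d -> R) x :
  dotv (grad f x) (grad g x) = \sum_j partial j f x * partial j g x.
Proof. by apply: eq_bigr => j _; rewrite !mxE. Qed.

Lemma dotv_gradr {R : realType} {d : nat} (v : 'rV[R]_d) (g : 'rV[R]_d -> R) x :
  dotv v (grad g x) = \sum_j v 0 j * partial j g x.
Proof. by apply: eq_bigr => j _; rewrite !mxE. Qed.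

Lemma mxtrace_gram_sub1 {R : realType} {d : nat} (F : 'M[R]_d) :
  \tr (F *m F^T - 1%:M) = \sum_i \sum_l F i l * F i l + (- d%:R).
Proof.
rewrite raddfB /= mxtrace1; congr (_ - _); apply: eq_bigr => i _; rewrite mxE.
by apply: eq_bigr => l _; rewrite mxE.
Qed.

Lemma gram_sub1E {R : realType} {d : nat} (F : 'M[R]_d) i j :
  (F *m F^T - 1%:M) i j = \sum_l F i l * F j l - (i == j)%:R.
Proof. by rewrite !mxE; congr (_ - _); apply: eq_bigr => l _; rewrite mxE. Qed.

Theorem mainTheorem2 (R : realType) (d : nat) (hd : d = 2%N \/ d = 3%N)
  (Om : set 'rV[R]_d) (hOm : bounded_domain Om) (hbdry : Ck_boundary 2 Om)
  (n : 'rV[R]_d -> 'rV[R]_d) (hn : outward_unit_normal Om n)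
  (T : R) (hT : 0 < T)
  (lam gam tau h k : R)
  (hlam : 0 < lam) (hgam : 0 < gam) (htau : 0 < tau) (hh : 0 < h) (hk : 0 < k)
  (eta kappa nu : R -> R)
  (heta : Ck_real 1 eta) (hkappa : Ck_real 1 kappa) (hnu : Ck_real 3 nu)
  (alpha beta : R) (halpha : 0 < alpha) (hbeta : 0 < beta)
  (hbounds : forall s, [/\ alpha <= eta s <= beta, alpha <= nu s <= beta &
                           alpha <= kappa s <= beta])
  (u : R -> 'rV[R]_d -> 'rV[R]_d) (p : R -> 'rV[R]_d -> R)
  (F : R -> 'rV[R]_d -> 'M[R]_d) (phi mu : R -> 'rV[R]_d -> R)
  (u_smooth : forall i, Ck_up_to_boundary 2 Om T (component u i))
  (p_smooth : Ck_up_to_boundary 1 Om T p)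
  (F_smooth : forall i j, Ck_up_to_boundary 2 Om T (entry F i j))
  (phi_smooth : Ck_up_to_boundary 2 Om T phi)
  (mu_smooth : Ck_up_to_boundary 2 Om T mu)
  (u_eq : forall t x, 0 < t < T -> Om x -> forall i,
     dt (component u i) t x + dotv (u t x) (grad (component u i t) x)
       + partial i (p t) x
       - divergence (fun y => eta (phi t y) *: grad (component u i t) y) x
     = - lam * divergence
                 (fun y => grad (phi t) y 0 i *: grad (phi t) y) x
       + divergence
           (fun y => nu (phi t y) *: row i (F t y *m (F t y)^T - 1%:M)) x
       - eta (phi t x) * (1 - phi t x) * u t x 0 i / kappa (phi t x))
  (div_eq : forall t x, 0 < t < T -> Om x -> divergence (u t) x = 0)
  (F_eq : forall t x, 0 < t < T -> Om x -> forall i j,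
     dt (entry F i j) t x
       - k * (nu (phi t x) * laplacian (entry F i j t) x
              + 2 * dotv (grad (nu \o phi t) x) (grad (entry F i j t) x))
       + dotv (u t x) (grad (entry F i j t) x)
     = \sum_l partial l (component u i t) x * F t x l j)
  (phi_eq : forall t x, 0 < t < T -> Om x ->
     dt phi t x + dotv (u t x) (grad (phi t) x) = tau * laplacian (mu t) x)
  (mu_eq : forall t x, 0 < t < T -> Om x ->
     mu t x = - lam * laplacian (phi t) x
              + lam * gam * derive1 (double_well h) (phi t x)
              + derive1 nu (phi t x) / 2 * \tr (F t x *m (F t x)^T - 1%:M))
  (u_bc : forall t x, 0 < t < T -> bdry Om x ->
     forall i, has_trace Om (component u i t) x 0)
  (mu_bc : forall t x, 0 < t < T -> bdry Om x ->
     has_normal_derivative Om n (mu t) x 0)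
  (phi_bc : forall t x, 0 < t < T -> bdry Om x ->
     has_normal_derivative Om n (phi t) x 0)
  (F_bc : forall t x, 0 < t < T -> bdry Om x ->
     forall i j, has_normal_derivative Om n (entry F i j t) x 0) :
  let energy (t : R) : R :=
    \int_(x in Om)
      (dotv (u t x) (u t x)
       + lam * dotv (grad (phi t) x) (grad (phi t) x)
       + 2 * lam * gam * double_well h (phi t x)
       + nu (phi t x) * \tr (F t x *m (F t x)^T - 1%:M)) in
  forall t, 0 < t < T ->
    derivable energy t 1 /\
    1 / 2 * derive1 energy t
    = - (\int_(x in Om)
           (eta (phi t x)
              * (\sum_i dotv (grad (component u i t) x)
                             (grad (component u i t) x))
            + tau * dotv (grad (mu t) x) (grad (mu t) x)))
      - k * (\int_(x in Om)
               (nu (phi t x) ^+ 2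
                * (\sum_i \sum_j dotv (grad (entry F i j t) x)
                                      (grad (entry F i j t) x))))
      - (\int_(x in Om)
           (eta (phi t x) / kappa (phi t x) * (1 - phi t x)
              * dotv (u t x) (u t x))).
Proof.
move=> energy t tT.
have [oOm _ _ bOm] := hOm.
have Cu i : C1_field Om T (component u i) by have [] := Ck2_C1_field (u_smooth i).
have Cdu i j : C1_field Om T (fun t => partial j (component u i t)).
  by have [_ D _] := Ck2_C1_field (u_smooth i); exact: D.
have CF i j : C1_field Om T (entry F i j) by have [] := Ck2_C1_field (F_smooth i j).
have CdF i j l : C1_field Om T (fun t => partial l (entry F i j t)).
  by have [_ D _] := Ck2_C1_field (F_smooth i j); exact: D.
have [Cphi Cdphi Cphit] := Ck2_C1_field phi_smooth.
have [Cmu Cdmu _] := Ck2_C1_field mu_smooth.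
have Cp := Ck1_C1_field p_smooth.
have [deta ceta] := Ck_real1P heta.
have [dkappa ckappa] := Ck_real1P hkappa.
have [dnu cnu] := Ck_real3P hnu.
have [dW cW] := @double_wellP R h.
pose N s x := nu (phi s x).
have CN : C1_field Om T N by exact: field_comp_C1.
pose tr_ s x := \sum_i \sum_l entry F i l s x * entry F i l s x + (- d%:R).
have CtrF : C1_field Om T (fun s x => \sum_i \sum_l entry F i l s x * entry F i l s x).
  by apply: C1_field_sum => i; apply: C1_field_sum => l; exact: C1_fieldM.
have Ctr : C1_field Om T tr_ by exact: (C1_fieldD CtrF (C1_field_cst Om T _)).
pose A i j s x := eta (phi s x) * partial j (component u i s) x.
have CA i j : C1_field Om T (A i j).
  by apply: (C1_fieldM _ (Cdu i j)); exact: field_comp_C1.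
pose B i j s x := N s x * (\sum_l entry F i l s x * entry F j l s x + (- (i == j)%:R)).
have CB i j : C1_field Om T (B i j).
  apply: (C1_fieldM CN); apply: C1_fieldD; last exact: C1_field_cst.
  by apply: C1_field_sum => l; exact: C1_fieldM.
pose q1 s x := \sum_i component u i s x * component u i s x.
pose q2 s x := \sum_i partial i (phi s) x * partial i (phi s) x.
pose q3 s x := double_well h (phi s x).
pose q4 s x := N s x * tr_ s x.
have C1q : C1_field Om T q1 by apply: C1_field_sum => i; exact: C1_fieldM.
have C2q : C1_field Om T q2 by apply: C1_field_sum => i; exact: (C1_fieldM (Cdphi i) (Cdphi i)).
have C3q : C1_field Om T q3 by exact: field_comp_C1.
have C4q : C1_field Om T q4 by exact: C1_fieldM.
pose e s x := q1 s x + lam * q2 s x + 2 * lam * gam * q3 s x + q4 s x.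
have Ce : C1_field Om T e.
  by apply: (C1_fieldD (C1_fieldD (C1_fieldD C1q (C1_fieldZ lam C2q)) (C1_fieldZ _ C3q)) C4q).
have energyE : energy = fun s => \int_(x in Om) e s x.
  apply/funext => s; congr space_integral; apply/funext => x.
  by rewrite /e /q1 /q2 /q3 /q4 /N /tr_ dotv_grad mxtrace_gram_sub1.
have [de1 de2] := derive_space_integral oOm bOm Ce tT.
rewrite energyE; split; first exact: de1.
rewrite de2.
(* Minus half the energy density minus the pressure: its transport by [u] collects all convective
   terms. *)
pose Q s x := (- (1 / 2)) * q1 s x + (-1) * p s x + (- (lam / 2)) * q2 s x
  + (- (lam * gam)) * q3 s x + (- (1 / 2)) * q4 s x.
have CQ : C1_field Om T Q.
  exact: (C1_fieldD (C1_fieldD (C1_fieldD (C1_fieldD (C1_fieldZ _ C1q) (C1_fieldZ _ Cp))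
    (C1_fieldZ _ C2q)) (C1_fieldZ _ C3q)) (C1_fieldZ _ C4q)).
pose G i j s x := A i j s x + B i j s x.
have CG i j : C1_field Om T (G i j) by exact: (C1_fieldD (CA i j) (CB i j)).
pose taumu s x := tau * mu s x.
have Ctaumu : C1_field Om T taumu by exact: C1_fieldZ.
pose lamphit s x := lam * dt phi s x.
have Clamphit : C1_field Om T lamphit by exact: C1_fieldZ.
(* Green's identity with this factor yields [k * N * F] times the diffusion operator of the
   [F]-equation, plus the dissipation [k * nu ^+ 2 * |grad F|^2]. *)
pose NNF i l s x := k * (N s x * N s x * entry F i l s x).
have CNNF i l : C1_field Om T (NNF i l).
  by apply: C1_fieldZ; exact: (C1_fieldM (C1_fieldM CN CN) (CF i l)).
(* [I1], [I2], the two [green] terms for [mu] and [phi], and [I5] will integrate to 0; [D1], [D2],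
   [D3] are the integrands that remain. *)
pose I1 s x := \sum_j component u j s x * partial j (Q s) x.
pose I2 s x := \sum_i \sum_j (component u i s x * partial j (G i j s) x
  + G i j s x * partial j (component u i s) x).
pose green (q g : R -> 'rV[R]_d -> R) s x := \sum_j (q s x * partial j (partial j (g s)) x
  + partial j (g s) x * partial j (q s) x).
pose I5 s x := \sum_i \sum_l green (NNF i l) (entry F i l) s x.
pose D1 s x := eta (phi s x) * (\sum_i \sum_j partial j (component u i s) x * partial j (component u i s) x)
  + tau * \sum_j partial j (mu s) x * partial j (mu s) x.
pose D2 s x := nu (phi s x) ^+ 2 *
  (\sum_i \sum_l \sum_j partial j (entry F i l s) x * partial j (entry F i l s) x).
pose D3 s x := eta (phi s x) / kappa (phi s x) * (1 - phi s x) * q1 s x.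
have bt (f : R -> 'rV[R]_d -> R) : extends_continuously Om T f -> cont_bounded Om (f t).
  by move=> Ef; exact: (cont_ext_cont_bounded oOm bOm (ext_cont_ext Ef tT)).
have Egreen q g : C1_field Om T q -> (forall j, C1_field Om T (fun s => partial j (g s))) ->
    extends_continuously Om T (green q g).
  move=> Cq Cg; apply: ext_sum => j; apply: extD; apply: extM.
  - exact: C1_field_ext.
  - exact: (C1_field_ext_partial j (Cg j)).
  - exact: (C1_field_ext (Cg j)).
  - exact: C1_field_ext_partial.
have b1 : cont_bounded Om (I1 t).
  apply: bt; apply: ext_sum => j; apply: extM; first exact: C1_field_ext.
  exact: C1_field_ext_partial.
have b2 : cont_bounded Om (I2 t).
  apply: bt; apply: ext_sum => i; apply: ext_sum => j; apply: extD; apply: extM.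
  - exact: C1_field_ext.
  - exact: C1_field_ext_partial.
  - exact: C1_field_ext.
  - exact: C1_field_ext_partial.
have b3 : cont_bounded Om (green taumu mu t) by apply: bt; exact: Egreen.
have b4 : cont_bounded Om (green lamphit phi t) by apply: bt; exact: Egreen.
have b5 i l : cont_bounded Om (green (NNF i l) (entry F i l) t).
  exact: (bt _ (Egreen (NNF i l) (entry F i l) (CNNF i l) (CdF i l))).
have b5' : cont_bounded Om (I5 t).
  by apply: (@cont_bounded_sum _ _ _ _ _ (fun i x => \sum_l green (NNF i l) (entry F i l) t x)) => i; exact: cont_bounded_sum.
have Eeta : extends_continuously Om T (fun s x => eta (phi s x)).
  by apply: C1_field_ext; exact: field_comp_C1.
have bd1 : cont_bounded Om (D1 t).
  apply: bt; apply: extD.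
    apply: (extM Eeta); apply: ext_sum => i; apply: ext_sum => j.
    by apply: extM; exact: C1_field_ext_partial.
  apply: (extM (ext_cst Om T tau)); apply: ext_sum => j.
  by apply: extM; exact: C1_field_ext_partial.
have bd2 : cont_bounded Om (D2 t).
  apply: bt; apply: extM; first by apply: extM; exact: (C1_field_ext CN).
  apply: ext_sum => i; apply: ext_sum => l; apply: ext_sum => j.
  by apply: extM; exact: C1_field_ext_partial.
have bd3 : cont_bounded Om (D3 t).
  apply: bt; apply: extM; last exact: C1_field_ext.
  apply: extM; last first.
    by apply: (@ext_comp _ _ _ _ (fun s => 1 - s) phi); [move=> s; apply: cvgB; [exact: cvg_cst|exact: cvg_id]|exact: C1_field_ext].
  apply: (extM Eeta); apply: (@ext_comp _ _ _ _ (fun s => (kappa s)^-1) phi); last exact: C1_field_ext.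
  move=> s; apply: cvgV; last by apply/differentiable_continuous/derivable1_diffP.
  (* The lower bound [alpha] keeps [kappa] away from 0, so the friction coefficient is
     continuous. *)
  by rewrite gt_eqF//; have [_ _ /andP[h1 _]] := hbounds s; exact: lt_le_trans h1.
have J1 : \int_(x in Om) I1 t x = 0.
  apply: (integral_transport oOm bOm hn (fun i => C1_field_slice (Cu i) tT) _ _ (C1_field_slice CQ tT)).
    by move=> i x bx; exact: u_bc.
  by move=> x Ox; exact: div_eq.
have J2 : \int_(x in Om) I2 t x = 0.
  apply: (integral_work oOm bOm hn (fun i => C1_field_slice (Cu i) tT) _ (fun i j => C1_field_slice (CG i j) tT)).
  by move=> i x bx; exact: u_bc.
have J3 : \int_(x in Om) green taumu mu t x = 0.
  apply: (integral_green oOm bOm hn (C1_field_slice Ctaumu tT) (fun j => C1_field_slice (Cdmu j) tT)).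
  by move=> x bx; exact: mu_bc.
have J4 : \int_(x in Om) green lamphit phi t x = 0.
  apply: (integral_green oOm bOm hn (C1_field_slice Clamphit tT) (fun j => C1_field_slice (Cdphi j) tT)).
  by move=> x bx; exact: phi_bc.
have J5 : \int_(x in Om) I5 t x = 0.
  rewrite (@space_integral_sum _ _ _ oOm bOm _ _ (fun i x => \sum_l green (NNF i l) (entry F i l) t x)); last first.
    by move=> i; exact: cont_bounded_sum.
  apply: big1 => i _; rewrite (space_integral_sum oOm bOm _ (b5 i)); apply: big1 => l _.
  apply: (integral_green oOm bOm hn (C1_field_slice (CNNF i l) tT) (fun j => C1_field_slice (CdF i l j) tT)).
  by move=> x bx; exact: F_bc.
(* The pointwise identity: derivatives of the composite fields are expanded, the equations are put
   in coordinates, and [energy_balance_algebra] concludes. *)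
have key x : Om x -> 1 / 2 * dt e t x = I1 t x + I2 t x + green taumu mu t x
    + green lamphit phi t x + I5 t x + (-1) * D1 t x + (- k) * D2 t x + (-1) * D3 t x.
  move=> Ox.
  have dq1 : dt q1 t x = 2 * \sum_i component u i t x * dt (component u i) t x.
    exact: (field_dt_sqsum tT Ox _ Cu).
  have dq2 : dt q2 t x = 2 * \sum_i partial i (phi t) x * partial i (dt phi t) x.
    apply: (etrans (field_dt_sqsum tT Ox (index_enum _) Cdphi)); apply: (congr1 ( *%R 2)).
    by apply: eq_bigr => i _; rewrite (partial_dtC oOm i phi_smooth tT Ox).
  have dq3 : dt q3 t x = derive1 (double_well h) (phi t x) * dt phi t x.
    exact: (field_dt_comp tT Ox dW Cphi).
  have dN : dt N t x = derive1 nu (phi t x) * dt phi t x by exact: (field_dt_comp tT Ox dnu Cphi).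
  have dtr : dt tr_ t x = 2 * \sum_i \sum_l F t x i l * dt (entry F i l) t x.
    apply: (etrans (dtD CtrF (C1_field_cst Om T _) tT Ox)); rewrite dt_cst addr0.
    have CFs i : C1_field Om T (fun s x => \sum_l entry F i l s x * entry F i l s x).
      by apply: C1_field_sum => l; exact: C1_fieldM.
    apply: (etrans (dt_sum _ CFs tT Ox)); rewrite mulr_sumr; apply: eq_bigr => i _.
    exact: (field_dt_sqsum tT Ox _ (CF i)).
  have dq4 : dt q4 t x = N t x * dt tr_ t x + tr_ t x * dt N t x by exact: (dtM CN Ctr tT Ox).
  have dte : dt e t x = dt q1 t x + lam * dt q2 t x + 2 * lam * gam * dt q3 t x + dt q4 t x.
    have Z2 := C1_fieldZ lam C2q; have Z3 := C1_fieldZ (2 * lam * gam) C3q.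
    have s1 : dt (fun s x => q1 s x + lam * q2 s x) t x = dt q1 t x + lam * dt q2 t x.
      by apply: (etrans (dtD C1q Z2 tT Ox)); congr (_ + _); exact: (field_dtZ tT Ox lam C2q).
    have s2 : dt (fun s x => q1 s x + lam * q2 s x + 2 * lam * gam * q3 s x) t x =
        dt q1 t x + lam * dt q2 t x + 2 * lam * gam * dt q3 t x.
      apply: (etrans (dtD (C1_fieldD C1q Z2) Z3 tT Ox)); congr (_ + _); first exact: s1.
      exact: (field_dtZ tT Ox _ C3q).
    apply: (etrans (dtD (C1_fieldD (C1_fieldD C1q Z2) Z3) C4q tT Ox)).
    by apply: (congr1 (+%R^~ (dt q4 t x))); exact: s2.
  have pN j : partial j (N t) x = derive1 nu (phi t x) * partial j (phi t) x.
    exact: (field_partial_comp tT Ox j dnu Cphi).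
  have pq1 j : partial j (q1 t) x = 2 * \sum_i component u i t x * partial j (component u i t) x.
    exact: (field_partial_sqsum tT Ox _ j Cu).
  have pq2 j : partial j (q2 t) x = 2 * \sum_i partial i (phi t) x * partial j (partial i (phi t)) x.
    exact: (field_partial_sqsum tT Ox _ j Cdphi).
  have pq3 j : partial j (q3 t) x = derive1 (double_well h) (phi t x) * partial j (phi t) x.
    exact: (field_partial_comp tT Ox j dW Cphi).
  have ptr j : partial j (tr_ t) x = 2 * \sum_i \sum_l F t x i l * partial j (entry F i l t) x.
    apply: (etrans (field_partialD tT Ox j CtrF (C1_field_cst Om T _))); rewrite partial_cst addr0.
    have CFs i : C1_field Om T (fun s x => \sum_l entry F i l s x * entry F i l s x).
      by apply: C1_field_sum => l; exact: C1_fieldM.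
    apply: (etrans (partial_sum _ j CFs tT Ox)); rewrite mulr_sumr; apply: eq_bigr => i _.
    exact: (field_partial_sqsum tT Ox _ j (CF i)).
  have pq4 j : partial j (q4 t) x = N t x * partial j (tr_ t) x + tr_ t x * partial j (N t) x.
    exact: (field_partialM tT Ox j CN Ctr).
  have pQ j : partial j (Q t) x = - (1 / 2) * partial j (q1 t) x + (-1) * partial j (p t) x
      + (- (lam / 2)) * partial j (q2 t) x + (- (lam * gam)) * partial j (q3 t) x
      + (- (1 / 2)) * partial j (q4 t) x.
    have Z1 := C1_fieldZ (- (1 / 2)) C1q; have Z2 := C1_fieldZ (-1) Cp.
    have Z3 := C1_fieldZ (- (lam / 2)) C2q; have Z4 := C1_fieldZ (- (lam * gam)) C3q.
    have Z5 := C1_fieldZ (- (1 / 2)) C4q.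
    apply: (etrans (field_partialD tT Ox j (C1_fieldD (C1_fieldD (C1_fieldD Z1 Z2) Z3) Z4) Z5)).
    apply: (congr2 +%R); last exact: (field_partialZ tT Ox _ j C4q).
    apply: (etrans (field_partialD tT Ox j (C1_fieldD (C1_fieldD Z1 Z2) Z3) Z4)).
    apply: (congr2 +%R); last exact: (field_partialZ tT Ox _ j C3q).
    apply: (etrans (field_partialD tT Ox j (C1_fieldD Z1 Z2) Z3)).
    apply: (congr2 +%R); last exact: (field_partialZ tT Ox _ j C2q).
    apply: (etrans (field_partialD tT Ox j Z1 Z2)).
    by apply: (congr2 +%R); [exact: (field_partialZ tT Ox _ j C1q)|exact: (field_partialZ tT Ox _ j Cp)].
  have hu' i : dt (component u i) t x + \sum_j u t x 0 j * partial j (component u i t) x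
      + partial i (p t) x - \sum_j partial j (A i j t) x =
      - lam * \sum_j (partial i (phi t) x * partial j (partial j (phi t)) x
        + partial j (phi t) x * partial j (partial i (phi t)) x)
      + \sum_j partial j (B i j t) x
      - eta (phi t x) / kappa (phi t x) * (1 - phi t x) * u t x 0 i.
    have := u_eq t x tT Ox i; rewrite dotv_gradr.
    have -> : divergence (fun y => eta (phi t y) *: grad (component u i t) y) x =
        \sum_j partial j (A i j t) x.
      apply: eq_bigr => j _; congr partial; apply/funext => y.
      by rewrite !mxE.
    have -> : divergence (fun y => grad (phi t) y 0 i *: grad (phi t) y) x =
        \sum_j (partial i (phi t) x * partial j (partial j (phi t)) x
          + partial j (phi t) x * partial j (partial i (phi t)) x).
      apply: eq_bigr => j _; apply: etrans (field_partialM tT Ox j (Cdphi i) (Cdphi j)).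
      by congr partial; apply/funext => y; rewrite !mxE.
    have -> : divergence (fun y => nu (phi t y) *: row i (F t y *m (F t y)^T - 1%:M)) x =
        \sum_j partial j (B i j t) x.
      apply: eq_bigr => j _; congr partial; apply/funext => y.
      by rewrite mxE [X in _ * X]mxE gram_sub1E.
    by move=> ->; congr (_ - _); rewrite mulrAC [X in X * _]mulrAC.
  have := @energy_balance_algebra R d (fun i => u t x 0 i) (fun i => dt (component u i) t x)
    (fun i => partial i (p t) x) (fun i => partial i (phi t) x) (fun i => partial i (dt phi t) x)
    (fun j => partial j (mu t) x) (fun j => partial j (partial j (mu t)) x)
    (fun j => partial j (N t) x) (fun j => partial j (Q t) x)
    (fun i j => partial j (component u i t) x) (fun i j => A i j t x)
    (fun i j => partial j (A i j t) x) (fun i j => partial j (partial i (phi t)) x)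
    (fun i j => B i j t x) (fun i j => partial j (B i j t) x)
    (fun i l => F t x i l) (fun i l => dt (entry F i l) t x)
    (fun i l j => partial j (entry F i l t) x)
    (fun i l j => partial j (partial j (entry F i l t)) x)
    (eta (phi t x)) (N t x) (derive1 nu (phi t x)) (derive1 (double_well h) (phi t x))
    (dt phi t x) (mu t x) lam gam tau k (eta (phi t x) / kappa (phi t x) * (1 - phi t x)) (tr_ t x).
  move=> /(_ (fun i j => erefl) (fun i j => erefl)
    (fun i j => partialC oOm j i phi_smooth tT Ox) hu' (div_eq t x tT Ox)) K1.
  have hF' i l : dt (entry F i l) t x - k * (N t x * \sum_j partial j (partial j (entry F i l t)) x
      + 2 * \sum_j partial j (N t) x * partial j (entry F i l t) x)
      + \sum_j u t x 0 j * partial j (entry F i l t) x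
      = \sum_m partial m (component u i t) x * F t x m l.
    by have := F_eq t x tT Ox i l; rewrite dotv_grad dotv_gradr.
  have hphi' : dt phi t x + \sum_j u t x 0 j * partial j (phi t) x =
      tau * \sum_j partial j (partial j (mu t)) x.
    by have := phi_eq t x tT Ox; rewrite dotv_gradr.
  have hmu' : mu t x = - lam * \sum_j partial j (partial j (phi t)) x
      + lam * gam * derive1 (double_well h) (phi t x) + derive1 nu (phi t x) / 2 * tr_ t x.
    by have := mu_eq t x tT Ox; rewrite mxtrace_gram_sub1.
  have hQ' j : partial j (Q t) x = - (\sum_i u t x 0 i * partial j (component u i t) x
      + partial j (p t) x + lam * \sum_i partial i (phi t) x * partial j (partial i (phi t)) x
      + (lam * gam * derive1 (double_well h) (phi t x) * partial j (phi t) x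
      + (derive1 nu (phi t x) / 2 * tr_ t x * partial j (phi t) x
      + N t x * \sum_i \sum_l F t x i l * partial j (entry F i l t) x))).
    by rewrite pQ pq1 pq2 pq3 pq4 ptr pN; field.
  have {K1} K2 := K1 hF' hphi' hmu' hQ'.
  transitivity (\sum_i u t x 0 i * dt (component u i) t x
    + lam * (\sum_i partial i (phi t) x * partial i (dt phi t) x)
    + lam * gam * derive1 (double_well h) (phi t x) * dt phi t x
    + derive1 nu (phi t x) / 2 * tr_ t x * dt phi t x
    + N t x * (\sum_i \sum_l F t x i l * dt (entry F i l) t x)).
    by rewrite dte dq1 dq2 dq3 dq4 dtr dN; field.
  have g2 : I2 t x = \sum_i \sum_j (u t x 0 i * (partial j (A i j t) x + partial j (B i j t) x)
      + (A i j t x + B i j t x) * partial j (component u i t) x).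
    apply: eq_bigr => i _; apply: eq_bigr => j _.
    by apply: (congr2 +%R) => //; apply: (congr1 ( *%R _)); exact: (field_partialD tT Ox j (CA i j) (CB i j)).
  have g3 : green taumu mu t x = \sum_j (tau * mu t x * partial j (partial j (mu t)) x
      + partial j (mu t) x * (tau * partial j (mu t) x)).
    apply: eq_bigr => j _; apply: (congr2 +%R) => //; apply: (congr1 ( *%R _)).
    exact: (field_partialZ tT Ox tau j Cmu).
  have g4 : green lamphit phi t x = \sum_j (lam * dt phi t x * partial j (partial j (phi t)) x
      + partial j (phi t) x * (lam * partial j (dt phi t) x)).
    apply: eq_bigr => j _; apply: (congr2 +%R) => //; apply: (congr1 ( *%R _)).
    exact: (field_partialZ tT Ox lam j Cphit).
  have pNNF i l j : partial j (NNF i l t) x = k * (N t x ^+ 2 * partial j (entry F i l t) x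
      + F t x i l * (2 * N t x * partial j (N t) x)).
    apply: (etrans (field_partialZ tT Ox k j (C1_fieldM (C1_fieldM CN CN) (CF i l)))).
    apply: (congr1 ( *%R k)); apply: (etrans (field_partialM tT Ox j (C1_fieldM CN CN) (CF i l))).
    apply: (congr2 +%R); first by rewrite expr2.
    apply: (congr1 ( *%R _)); apply: (etrans (field_partialM tT Ox j CN CN)); ring.
  have g5 : I5 t x = \sum_i \sum_l \sum_j (k * (N t x ^+ 2 * F t x i l) * partial j (partial j (entry F i l t)) x
      + partial j (entry F i l t) x * (k * (N t x ^+ 2 * partial j (entry F i l t) x
        + F t x i l * (2 * N t x * partial j (N t) x)))).
    apply: eq_bigr => i _; apply: eq_bigr => l _; apply: eq_bigr => j _.
    by apply: (congr2 +%R); [rewrite expr2|rewrite pNNF].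
  by rewrite K2 g2 g3 g4 g5 !mulN1r mulNr.
pose Z1 := cont_boundedD (cont_boundedD (cont_boundedD (cont_boundedD b1 b2) b3) b4) b5'.
pose Zd1 := cont_boundedM (cont_bounded_cst Om (-1 : R)) bd1.
pose Zd2 := cont_boundedM (cont_bounded_cst Om (- k : R)) bd2.
pose Zd3 := cont_boundedM (cont_bounded_cst Om (-1 : R)) bd3.
have bde : cont_bounded Om (dt e t) by apply: bt; have [] := Ce.
rewrite -(space_integralZ oOm bOm (1 / 2) bde) (eq_space_integral key).
rewrite (space_integralD oOm bOm (cont_boundedD (cont_boundedD Z1 Zd1) Zd2) Zd3).
rewrite (space_integralD oOm bOm (cont_boundedD Z1 Zd1) Zd2) (space_integralD oOm bOm Z1 Zd1).
rewrite (space_integralD oOm bOm (cont_boundedD (cont_boundedD (cont_boundedD b1 b2) b3) b4) b5').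
rewrite (space_integralD oOm bOm (cont_boundedD (cont_boundedD b1 b2) b3) b4).
rewrite (space_integralD oOm bOm (cont_boundedD b1 b2) b3) (space_integralD oOm bOm b1 b2).
rewrite J1 J2 J3 J4 J5 !add0r.
rewrite (space_integralZ oOm bOm _ bd1) (space_integralZ oOm bOm _ bd2) (space_integralZ oOm bOm _ bd3).
rewrite !mulN1r mulNr.
congr (- _ - k * _ - _); congr space_integral; apply/funext => x.
- rewrite /D1; congr (_ * _ + _ * _); last by rewrite dotv_grad.
  by apply: eq_bigr => i _; rewrite dotv_grad.
- by rewrite /D2; congr (_ * _); apply: eq_bigr => i _; apply: eq_bigr => l _; rewrite dotv_grad.
Qed.
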